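(* The set of Skolem functions $<2^{\mathbf{x}^{\mathbf{x}}}$ has order type $\leq\varepsilon_0$.
   Context: $Sk$ is the smallest set of functions $\mathbb R^{>0}\to\mathbb R^{>0}$ containing the constant function $1$ and the identity function $\mathbf{x}$, and closed under $f+g$, $fg$ and $f^g$. It is ordered by $f<g$ iff $f(x)<g(x)$ for all sufficiently large $x$; this is a well order. $\varepsilon_0=\sup\{\omega,\omega^\omega,\omega^{\omega^\omega},\dots\}$ is the least ordinal $\varepsilon$ with $\varepsilon=\omega^\varepsilon$. *)

(* Defs.v *)
From HB Require Import structures.
From mathcomp Require Import all_boot all_order all_algebra.
From mathcomp Require Import interval_inference.
From mathcomp Require Import mathcomp_extra boolp classical_sets reals exp.

Set Implicit Arguments.
Unset Strict Implicit.
Unset Printing Implicit Defensive.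

Import Order.TTheory GRing.Theory Num.Theory.

Local Open Scope classical_set_scope.
Local Open Scope ring_scope.

(* Ordinals as well-founded trees: [Ord f] denotes the least ordinal strictly
   greater than every [f i].  Distinct trees may denote the same ordinal, so
   equality of ordinals is [oeq], not Leibniz equality. *)
Inductive ord : Type := Ord (I : Type) (f : I -> ord).

Fixpoint ole (a b : ord) {struct a} : Prop :=
  let: Ord _ f := a in let: Ord _ g := b in
  forall i, exists j, ole (f i) (g j).

Definition olt (a b : ord) : Prop :=
  let: Ord _ g := b in exists j, ole a (g j).

Definition oeq (a b : ord) : Prop := ole a b /\ ole b a.

Definition ozero : ord := Ord (fun e : Empty_set => match e with end).

Definition osucc (a : ord) : ord := Ord (fun _ : unit => a).

Definition oindex (a : ord) : Type := let: Ord J _ := a in J.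

Definition obelow (a : ord) : oindex a -> ord :=
  match a return oindex a -> ord with Ord _ f => f end.

Definition osup (I : Type) (F : I -> ord) : ord :=
  Ord (fun p : {i : I & oindex (F i)} => obelow (projT2 p)).

(* Uniform versions (no case split into successor and limit) of the usual
   recursions on the second argument:
     a + b = sup ({a} `|` {(a + c) + 1 | c < b}),
     a * b = sup {a * c + a | c < b},
     a ^ b = sup ({1} `|` {a ^ c * a | c < b}), the last one for a > 0. *)
Fixpoint oadd (a b : ord) {struct b} : ord :=
  let: Ord J g := b in
  osup (fun o : option J => if o is Some j then osucc (oadd a (g j)) else a).

Fixpoint omul (a b : ord) {struct b} : ord :=
  let: Ord _ g := b in osup (fun j => oadd (omul a (g j)) a).

Fixpoint oexp (a b : ord) {struct b} : ord :=
  let: Ord J g := b in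
  osup (fun o : option J =>
          if o is Some j then omul (oexp a (g j)) a else osucc ozero).

Definition onat (n : nat) : ord := iter n osucc ozero.

Definition oomega : ord := osup onat.

(* omega, omega ^ omega, omega ^ (omega ^ omega), ... *)
Definition otower (n : nat) : ord := iter n (oexp oomega) oomega.

Definition epsilon0 : ord := osup otower.

(* (A, lt) is order-isomorphic to the set of ordinals < a.  As the ordinals
   < a are well ordered, this includes that lt well orders A. *)
Definition has_order_type (T : Type) (A : set T) (lt : T -> T -> Prop)
    (a : ord) : Prop :=
  exists h : T -> ord,
    [/\ forall x, A x -> olt (h x) a,
        forall b, olt b a -> exists2 x, A x & oeq (h x) b,
        forall x y, A x -> A y -> oeq (h x) (h y) -> x = y
      & forall x y, A x -> A y -> (lt x y <-> olt (h x) (h y))].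

(* Domain and codomain are the positive reals, so Leibniz equality of Skolem
   functions ignores the junk values of powR at nonpositive bases. *)
Definition ppow (R : realType) (a b : {posnum R}) : {posnum R} :=
  (a%:num `^ b%:num)%:pos.

Inductive Sk (R : realType) : set ({posnum R} -> {posnum R}) :=
| Sk_one : Sk (fun=> 1%:pos)
| Sk_id : Sk id
| Sk_add f g : Sk f -> Sk g -> Sk (fun x => ((f x)%:num + (g x)%:num)%:pos)
| Sk_mul f g : Sk f -> Sk g -> Sk (fun x => ((f x)%:num * (g x)%:num)%:pos)
| Sk_pow f g : Sk f -> Sk g -> Sk (fun x => ppow (f x) (g x)).

Definition evlt (R : realType) (f g : {posnum R} -> {posnum R}) : Prop :=
  exists M : R, forall x : {posnum R}, M < x%:num -> (f x)%:num < (g x)%:num.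

Definition two_pow_xx (R : realType) : {posnum R} -> {posnum R} :=
  fun x => ppow 2%:pos (ppow x x).

(* Main.v *)
(** The order on Skolem functions is total because they lie in a Hardy field,
and two of them that agree eventually agree everywhere by analyticity.  So it
suffices to bound the order type below each function.

A Skolem function below [2 ^ (x ^ x)] is generated from [1] and [x] by sums,
products, [f |-> f ^ x] and [f |-> f ^ (p ^ x)] with [p >= 2].  Its logarithm
has size about [x ^ j * n ^ x]; one inducts on the weight [n] and, for a given
weight, on the level [j].  At level [j + 1] the functions are sums of products
[w * u ^ x] with [w] built from smaller weights and [u] at level [j].  Order
types are bounded by powers of omega, through natural sums.  Passing to sums
only exponentiates the order type of the set of Archimedean classes, as
boundedly many terms of a sum not above a given function dominate it.  The class
of [w * u ^ x] only depends on [u] up to a factor [1 + O(1 / x)], and comparing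
sums up to [1 + O(1 / x ^ i)] does not exponentiate: expanding logarithms
asymptotically, functions in distinct classes differ by a factor [x] at least,
so only the top [i] classes matter.  Thus each weight adds finitely many
exponentials, and every bound stays below [epsilon0]. *)

Require Import Defs.
From Stdlib Require List.
From mathcomp Require Import all_boot all_order all_algebra.
From mathcomp Require Import zify ring lra.
From mathcomp Require Import interval_inference boolp classical_sets functions reals.
From mathcomp Require Import topology normedtype sequences derive realfun exp.

Set Implicit Arguments.
Unset Strict Implicit.
Unset Printing Implicit Defensive.

Import Order.TTheory GRing.Theory Num.Theory.
Import numFieldNormedType.Exports.

Local Open Scope classical_set_scope.

(** * Ordinals and natural sums *)

(** Bounds are proved for partial orders, through all their linear extensions, and not for the
    linear order itself. This tolerates non-unique representations by terms, and products turn into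
    natural sums, which are commutative and strictly monotone in both arguments. The obstacle is
    that a fixed weight has unboundedly many levels [j]: one exponential per level would already
    reach [epsilon0] within one weight. So two bounds run in parallel over the levels. The coarse
    one, up to relative error [O(x^-i)], loses one order of precision per level, because
    [(1 + O(x^-(i+1)))^x = 1 + O(x^-i)]; it is proved for every [i] at once, with an exponent
    [omega^(eta + 2 j)] independent of [i]. The exact one takes its bound for Archimedean classes
    from the coarse one, so that its own exponent grows by additions only. The gap by a factor [x]
    between classes rests on arithmetic: in the expansions of logarithms the coefficient of [ln x]
    is an integer, so a quotient that is neither exponentially large nor exponentially small behaves
    like an integral power of [x]. *)

Lemma ole_refl a : ole a a.
Proof. by elim: a => I f IH i; exists i; apply: IH. Qed.

Lemma ole_trans a b c : ole a b -> ole b c -> ole a c.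
Proof.
elim: a b c => I f IH [J g] [K h] ab bc i.
by have [j fg] := ab i; have [k gh] := bc j; exists k; apply: IH fg gh.
Qed.

Lemma olt_ole_trans a b c : olt a b -> ole b c -> olt a c.
Proof.
case: b c => [J g] [K h] [j aj] bc; have [k gh] := bc j.
by exists k; apply: ole_trans aj gh.
Qed.

Lemma ole_olt_trans a b c : ole a b -> olt b c -> olt a c.
Proof. by case: c => [K h] ab [k bk]; exists k; apply: ole_trans ab bk. Qed.

Lemma oltW a b : olt a b -> ole a b.
Proof.
elim: b a => J g IH [I f] [j aj] i; exists j; apply: IH.
by case: (g j) aj => K h /(_ i) [k fk]; exists k.
Qed.

Lemma olt_trans a b c : olt a b -> olt b c -> olt a c.
Proof. by move=> ab /oltW; apply: olt_ole_trans. Qed.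

(** If some [f i] lies below no [g j], induction puts every [g j] strictly below that [f i];
    excluded middle decides whether there is such an index. *)
Lemma ole_or_olt a b : ole a b \/ olt b a.
Proof.
elim: a b => I f IH [J g].
have [H|/existsNP[i Hi]] := pselect (forall i, exists j, ole (f i) (g j)).
  by left.
right; exists i; have gf j : olt (g j) (f i).
  by case: (IH i (g j)) => // ?; case: Hi; exists j.
by case: (f i) gf.
Qed.

Lemma olt_irr a : ~ olt a a.
Proof.
elim: a => I f IH [i H]; apply: (IH i); apply: olt_ole_trans H.
by exists i; apply: ole_refl.
Qed.

Lemma olt_index I (f : I -> ord) i : olt (f i) (Ord f).
Proof. by exists i; apply: ole_refl. Qed.

Lemma oltE a b : olt a b <-> exists j : oindex b, ole a (obelow j).
Proof. by case: b. Qed.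

Lemma ole_olt a b : (forall c, olt c a -> olt c b) <-> ole a b.
Proof.
split; last by move=> ab c ca; apply: olt_ole_trans ca ab.
case: a b => [I f] [J g] H i.
by have [j] := H (f i) (olt_index f i); exists j.
Qed.

Lemma ole_zero a : ole ozero a. Proof. by case: a => J g []. Qed.

Lemma olt_succ a : olt a (osucc a). Proof. by exists tt; apply: ole_refl. Qed.

Lemma osucc_ole a b : olt a b -> ole (osucc a) b.
Proof. by case: b => J g [j aj] _; exists j. Qed.

Lemma ole_osup I (F : I -> ord) i : ole (F i) (osup F).
Proof.
case E : (F i) => [J g] j /=.
have e : oindex (F i) = J by rewrite E.
suff [k Hk] : exists k : oindex (F i), g j = obelow k.
  by exists (existT _ i k); rewrite Hk; apply: ole_refl.
by rewrite E; exists j.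
Qed.

Lemma osup_ole I (F : I -> ord) b : (forall i, ole (F i) b) -> ole (osup F) b.
Proof.
case: b => J g H [i k] /=; have := H i.
by case: (F i) k => K h k /(_ k).
Qed.

Lemma olt_osup I (F : I -> ord) a : olt a (osup F) <-> exists i, olt a (F i).
Proof.
split=> [[[i k] /= ak]|[i ai]]; last exact: olt_ole_trans ai (ole_osup F i).
by exists i; rewrite oltE; exists k.
Qed.

(* Hessenberg's natural sum. *)
Fixpoint nadd (a : ord) : ord -> ord :=
  let: Ord K f := a in
  fix naddr (b : ord) : ord := let: Ord J g := b in
    Ord (fun k : K + J => match k with
                          | inl i => nadd (f i) (Ord g)
                          | inr j => naddr (g j)
                          end).

Lemma naddE K f J g : nadd (@Ord K f) (@Ord J g) =
  Ord (fun k : K + J => match k with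
                        | inl i => nadd (f i) (Ord g)
                        | inr j => nadd (Ord f) (g j) end).
Proof. by []. Qed.

Lemma naddC a b : ole (nadd a b) (nadd b a).
Proof.
elim: a b => I f IHa; elim=> J g IHb.
by rewrite !naddE => -[i|j]; [exists (inr i); apply: IHa|exists (inl j); apply: IHb].
Qed.

Lemma nadd_le2l a b b' : ole b b' -> ole (nadd a b) (nadd a b').
Proof.
elim: a b b' => I f IHa; elim=> J g IHb [J' g'] bb'; rewrite !naddE => -[i|j].
  by exists (inl i); apply: IHa.
by have [j' H] := bb' j; exists (inr j'); apply: IHb.
Qed.

Lemma nadd_le a a' b b' : ole a a' -> ole b b' -> ole (nadd a b) (nadd a' b').
Proof.
move=> aa' bb'; apply: ole_trans (nadd_le2l a bb') _.
apply: ole_trans (naddC _ _) _; apply: ole_trans (nadd_le2l b' aa') _.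
exact: naddC.
Qed.

Lemma nadd_lt2l a b b' : olt b b' -> olt (nadd a b) (nadd a b').
Proof. by case: a b' => [I f] [J g] [j bj]; exists (inr j); apply: nadd_le2l. Qed.

Lemma nadd_lt2r a a' b : olt a a' -> olt (nadd a b) (nadd a' b).
Proof.
move=> aa'; apply: ole_olt_trans (naddC _ _) _.
exact: olt_ole_trans (nadd_lt2l b aa') (naddC _ _).
Qed.

Lemma nadd_index a b c : olt c (nadd a b) ->
  (exists2 a', olt a' a & ole c (nadd a' b)) \/
  (exists2 b', olt b' b & ole c (nadd a b')).
Proof.
case: a b => [I f] [J g] [[i|j] H]; [left|right].
  by exists (f i) => //; apply: olt_index.
by exists (g j) => //; apply: olt_index.
Qed.

Lemma naddA a b c : ole (nadd a (nadd b c)) (nadd (nadd a b) c).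
Proof.
elim: a b c => I f IHa; elim=> J g IHb; elim=> K h IHc.
rewrite !naddE => -[i|[j|k]].
- by exists (inl (inl i)); apply: IHa.
- by exists (inl (inr j)); apply: IHb.
- by exists (inr k); apply: IHc.
Qed.

Lemma naddA' a b c : ole (nadd (nadd a b) c) (nadd a (nadd b c)).
Proof.
elim: a b c => I f IHa; elim=> J g IHb; elim=> K h IHc.
rewrite !naddE => -[[i|j]|k].
- by exists (inl i); apply: (IHa i (Ord g) (Ord h)).
- by exists (inr (inl j)); apply: (IHb j (Ord h)).
- by exists (inr (inr k)); apply: IHc.
Qed.

Lemma nadd0r a : ole (nadd a ozero) a.
Proof. by elim: a => I f IH [i|[]]; exists i; apply: IH. Qed.

Lemma nadd_gel a b : ole a (nadd a b).
Proof. by elim: a b => I f IH [J g] i; exists (inl i); apply: IH. Qed.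

Lemma nadd_ger a b : ole b (nadd a b).
Proof. exact: ole_trans (nadd_gel b a) (naddC _ _). Qed.

Definition natmul (n : nat) (a : ord) : ord := iter n (nadd a) ozero.

Lemma natmul_le n a b : ole a b -> ole (natmul n a) (natmul n b).
Proof.
by move=> ab; elim: n => [|n IH]; [apply: ole_refl|apply: nadd_le].
Qed.

Lemma natmulD m n a : ole (nadd (natmul m a) (natmul n a)) (natmul (m + n) a).
Proof.
elim: m => [|m IH] /=; first exact: ole_trans (naddC _ _) (nadd0r _).
exact: ole_trans (naddA' _ _ _) (nadd_le2l _ IH).
Qed.

(* [omega ^ e], as the closure of [{omega ^ e' | e' < e}] under natural sums. *)
Fixpoint wexp (e : ord) : ord :=
  let: Ord J f := e in
  Ord (fun s : seq J => foldr (fun i => nadd (wexp (f i))) ozero s).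

Lemma wexp_le e e' : ole e e' -> ole (wexp e) (wexp e').
Proof.
elim: e e' => I f IH [J g] H /=.
elim=> [|i s [t st]]; first by exists [::]; apply: ole_refl.
by have [j fg] := H i; exists (j :: t); apply: nadd_le => //; apply: IH.
Qed.

Lemma olt_wexp_nadd a b e :
  olt a (wexp e) -> olt b (wexp e) -> olt (nadd a b) (wexp e).
Proof.
case: e => I f [s sa] [t tb]; exists (s ++ t).
apply: ole_trans (nadd_le sa tb) _; elim: {sa} s => [|i s IH] /=.
  exact: ole_trans (naddC _ _) (nadd0r _).
exact: ole_trans (naddA' _ _ _) (nadd_le2l _ IH).
Qed.

Lemma olt_wexp_zero e : olt ozero (wexp e).
Proof. by case: e => I f; exists [::]; apply: ole_refl. Qed.

Lemma wexp_lt e e' : olt e e' -> olt (wexp e) (wexp e').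
Proof.
case: e' => J g [j ej]; exists [:: j] => /=.
exact: ole_trans (wexp_le ej) (nadd_gel _ _).
Qed.

Lemma olt_wexp_natmul n a e : olt a (wexp e) -> olt (natmul n a) (wexp e).
Proof.
move=> ae; elim: n => [|n IH]; first exact: olt_wexp_zero.
exact: olt_wexp_nadd.
Qed.

Lemma ole_wexp e : ole e (wexp e).
Proof.
elim: e => I f IH; apply/ole_olt => c [i ci].
apply: ole_olt_trans ci _; apply: ole_olt_trans (IH i) _.
exact/wexp_lt/olt_index.
Qed.

Lemma osucc_nadd a : ole (osucc a) (nadd a (osucc ozero)).
Proof.
apply: osucc_ole; apply: ole_olt_trans (nadd_gel a ozero) _.
exact/nadd_lt2l/olt_succ.
Qed.

Lemma olt_wexp_osucc a e : olt ozero e -> olt a (wexp e) -> olt (osucc a) (wexp e).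
Proof.
move=> e0 ae; apply: ole_olt_trans (osucc_nadd a) _; apply: olt_wexp_nadd => //.
apply: ole_olt_trans (wexp_lt e0); apply: osucc_ole; exact: olt_wexp_zero.
Qed.

(** * Natural sums against the usual sum, product and power *)

Lemma oaddE a J (g : J -> ord) c :
  olt c (oadd a (Ord g)) <-> olt c a \/ exists j, ole c (oadd a (g j)).
Proof.
rewrite [oadd _ _]/= olt_osup; split=> [[[j [_ H]|]]|[H|[j H]]].
- by right; exists j.
- by left.
- by exists None.
- by exists (Some j), tt.
Qed.

Lemma oadd_lt2l a b b' : olt b b' -> olt (oadd a b) (oadd a b').
Proof.
suff le2 c c' : ole c c' -> ole (oadd a c) (oadd a c').
  by case: b' => J g [j bj]; apply/oaddE; right; exists j; apply: le2.
elim: c c' => I f IH [J g] H; apply/ole_olt => d /oaddE [da|[i di]].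
  by apply/oaddE; left.
by apply/oaddE; right; have [j fg] := H i; exists j; apply: ole_trans di (IH _ _ fg).
Qed.

Lemma oadd_gel a b : ole a (oadd a b).
Proof. by case: b => J g; apply/ole_olt => c ca; apply/oaddE; left. Qed.

Lemma oadd_ger a b : ole b (oadd a b).
Proof.
elim: b => J g IH; apply/ole_olt => c [j cj]; apply/oaddE; right; exists j.
exact: ole_trans cj (IH j).
Qed.

Lemma oadd_nadd a b : ole (oadd a b) (nadd a b).
Proof.
elim: b => J g IH; apply/ole_olt => c /oaddE [ca|[j cj]].
  exact: olt_ole_trans ca (nadd_gel _ _).
apply: ole_olt_trans cj _; apply: ole_olt_trans (IH j) _.
exact/nadd_lt2l/olt_index.
Qed.

Lemma omul0 a : ole (omul a ozero) ozero.
Proof. by case=> [[]]. Qed.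

Lemma omulS a b : ole (omul a (osucc b)) (oadd (omul a b) a) /\
  ole (oadd (omul a b) a) (omul a (osucc b)).
Proof.
split; first by apply: osup_ole => _; apply: ole_refl.
exact: (ole_osup (fun _ : unit => oadd (omul a b) a) tt).
Qed.

Lemma omul_onat_natmul a n : ole (omul a (onat n)) (natmul n a).
Proof.
elim: n => [|n IH]; first exact: omul0.
apply: ole_trans (omulS _ _).1 _; apply: ole_trans (oadd_nadd _ _) _.
apply: ole_trans (naddC _ _) _; exact: nadd_le2l.
Qed.

Section Principal.
Variable a : ord.
Hypothesis a_closed : forall b c, olt b a -> olt c a -> olt (nadd b c) a.

Lemma omul_onat_split n c : olt c (omul a (onat n.+1)) ->
  olt c (omul a (onat n)) \/
  exists2 c', olt c' a & ole c (nadd (omul a (onat n)) c').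
Proof.
move=> /olt_ole_trans/(_ (omulS _ _).1).
case: a => I f /oaddE [H|[i H]]; [by left|right].
by exists (f i); [apply: olt_index|apply: ole_trans H (oadd_nadd _ _)].
Qed.

(* Below an additively closed ordinal the natural and the usual sum agree. *)
Lemma nadd_omul_onat n : ole (nadd (omul a (onat n)) a) (omul a (onat n.+1)).
Proof.
elim: n => [|n IH].
  apply: ole_trans (nadd_le (@omul0 a) (ole_refl _)) _.
  apply: ole_trans (naddC _ _) _; apply: ole_trans (nadd0r _) _.
  exact: ole_trans (oadd_ger _ _) (omulS _ _).2.
(* For a tail [b] below [a], natural and usual sum with [a * (n + 1)] agree: a smaller left summand
   is at most [a * n] plus something below [a], and the latter absorbs [b] by [a_closed]. *)
have low b : olt b a ->
    ole (nadd (omul a (onat n.+1)) b) (oadd (omul a (onat n.+1)) b).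
  elim: b => J g IHb ba; apply/ole_olt => c /nadd_index [[d da cd]|[d [j dj] cd]].
    apply: olt_ole_trans (oadd_gel _ _); apply: ole_olt_trans cd _.
    have [dn|[c' c'a dc]] := omul_onat_split da.
      apply: olt_ole_trans IH; apply: olt_trans (nadd_lt2r _ dn) (nadd_lt2l _ ba).
    apply: ole_olt_trans (nadd_le dc (ole_refl _)) _.
    apply: ole_olt_trans (naddA' _ _ _) _.
    by apply: olt_ole_trans IH; apply: nadd_lt2l; apply: a_closed.
  apply/oaddE; right; exists j; apply: ole_trans cd _.
  apply: ole_trans (nadd_le2l _ dj) _; apply: IHb.
  exact: olt_trans (olt_index g j) ba.
apply: ole_trans (omulS _ _).2; apply/ole_olt => c /nadd_index [[d da cd]|[b ba cb]].
  apply: ole_olt_trans cd _.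
  have [dn|[c' c'a dc]] := omul_onat_split da.
    apply: olt_ole_trans (nadd_lt2r _ dn) _; apply: ole_trans IH _.
    exact: oadd_gel.
  apply: ole_olt_trans (nadd_le dc (ole_refl _)) _.
  apply: ole_olt_trans (naddA' _ _ _) _.
  apply: ole_olt_trans (nadd_le2l _ (naddC _ _)) _.
  apply: ole_olt_trans (naddA _ _ _) _.
  apply: ole_olt_trans (nadd_le IH (ole_refl _)) _.
  by apply: ole_olt_trans (low _ c'a) _; apply: oadd_lt2l.
by apply: ole_olt_trans cb _; apply: ole_olt_trans (low _ ba) _; apply: oadd_lt2l.
Qed.

Lemma natmul_omul_onat n : ole (natmul n a) (omul a (onat n)).
Proof.
elim: n => [|n IH]; first exact: ole_zero.
apply: ole_trans (nadd_le2l _ IH) _.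
exact: ole_trans (naddC _ _) (nadd_omul_onat n).
Qed.

End Principal.

Lemma onat_index n (k : oindex (onat n)) : exists m, obelow k = onat m.
Proof. by case: n k => [[]|n] k; exists n. Qed.

Lemma olt_omul_omega a c : olt ozero a ->
  (olt c (omul a oomega) <-> exists n, olt c (omul a (onat n))).
Proof.
move=> a0; rewrite [omul _ _]/= olt_osup; split=> [[[n k] /= H]|[[|n] H]].
- have [m e] := onat_index k; exists m.+1.
  by rewrite e in H; apply: olt_ole_trans H (omulS _ _).2.
- by have := olt_ole_trans H (@omul0 a) => -[[]].
exists (existT _ n.+1 tt) => /=; exact: olt_ole_trans H (omulS _ _).1.
Qed.

Lemma olt_oexp J (g : J -> ord) c : olt c (oexp oomega (Ord g)) <->
  ole c ozero \/ exists j, olt c (omul (oexp oomega (g j)) oomega).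
Proof.
rewrite [oexp _ _]/= olt_osup; split=> [[[j H|[_ H]]]|[H|[j H]]].
- by right; exists j.
- by left.
- by exists None, tt.
- by exists (Some j).
Qed.

Lemma olt_zero_oexp e : olt ozero (oexp oomega e).
Proof. by case: e => J g; apply/olt_oexp; left; apply: ole_refl. Qed.

(** Two nonzero ordinals below [omega ^ e] lie below natural multiples of one common smaller power.
    By induction that power is closed, so its natural multiples are usual ones and remain below
    [omega ^ e]. *)
Lemma oexp_closed e b c :
  olt b (oexp oomega e) -> olt c (oexp oomega e) -> olt (nadd b c) (oexp oomega e).
Proof.
elim: e b c => J g IH b c.
have bnd d : olt d (oexp oomega (Ord g)) ->
    ole d ozero \/ exists j n, ole d (natmul n (oexp oomega (g j))).
  move=> /olt_oexp [|[j /(olt_omul_omega _ (olt_zero_oexp _)) [n dn]]]; first by left.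
  by right; exists j, n; apply: ole_trans (oltW dn) (omul_onat_natmul _ _).
have bnd' d j n : ole d (natmul n (oexp oomega (g j))) -> olt d (oexp oomega (Ord g)).
  move=> H; apply/olt_oexp; right; exists j; apply/olt_omul_omega.
    exact: olt_zero_oexp.
  exists n.+1; apply: ole_olt_trans H _.
  apply: olt_ole_trans (natmul_omul_onat (@IH j) n.+1) => /=.
  apply: ole_olt_trans (nadd_ger ozero _) _; exact/nadd_lt2r/olt_zero_oexp.
move=> /[dup] bE /bnd [b0|[i [m bm]]] /[dup] cE /bnd [c0|[j [n cn]]].
- apply: ole_olt_trans bE; apply: ole_trans (nadd_le2l _ c0) _; exact: nadd0r.
- apply: ole_olt_trans cE; apply: ole_trans (naddC _ _) _.
  apply: ole_trans (nadd_le2l _ b0) _; exact: nadd0r.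
- apply: ole_olt_trans bE; apply: ole_trans (nadd_le2l _ c0) _; exact: nadd0r.
have [H|/oltW H] := ole_or_olt (oexp oomega (g i)) (oexp oomega (g j)).
  apply: (bnd' _ j (m + n)%N); apply: ole_trans (natmulD _ _ _).
  by apply: nadd_le => //; apply: ole_trans bm (natmul_le _ H).
apply: (bnd' _ i (m + n)%N); apply: ole_trans (natmulD _ _ _).
by apply: nadd_le => //; apply: ole_trans cn (natmul_le _ H).
Qed.

Lemma oexp_lt_index J (g : J -> ord) j :
  olt (oexp oomega (g j)) (oexp oomega (Ord g)).
Proof.
apply/olt_oexp; right; exists j; apply/olt_omul_omega; first exact: olt_zero_oexp.
exists 2%N; apply: olt_ole_trans (natmul_omul_onat (@oexp_closed _) 2) => /=.
apply: ole_olt_trans (nadd_gel _ ozero) _; apply: nadd_lt2l.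
exact: olt_ole_trans (olt_zero_oexp _) (nadd_gel _ _).
Qed.

(** Carries the powers built from natural sums over to the exponentiation that defines [epsilon0]:
    finite natural sums of smaller powers cannot leave [omega ^ e], which is closed under them. *)
Lemma wexp_oexp e : ole (wexp e) (oexp oomega e).
Proof.
elim: e => J g IH; apply/ole_olt => c [s cs]; apply: ole_olt_trans cs _.
elim: s => [|j s IHs]; first exact: olt_zero_oexp.
by apply: oexp_closed => //; apply: ole_olt_trans (IH j) (oexp_lt_index g j).
Qed.

Lemma oexp_le e e' : ole e e' -> ole (oexp oomega e) (oexp oomega e').
Proof.
elim: e e' => I f IH [J g] H; apply/ole_olt => c /olt_oexp [c0|[i ci]].
  by apply/olt_oexp; left.
have [j fg] := H i.
have [n cn] := (olt_omul_omega _ (olt_zero_oexp _)).1 ci.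
have := ole_trans (oltW cn) (omul_onat_natmul _ _).
move=> /ole_trans /(_ (natmul_le n (IH _ _ fg))) {}cn.
apply: ole_olt_trans cn _; elim: n => [|n IHn]; first exact: olt_zero_oexp.
by apply: oexp_closed => //; apply: oexp_lt_index.
Qed.

Lemma oexp_lt e e' : olt e e' -> olt (oexp oomega e) (oexp oomega e').
Proof.
case: e' => J g [j ej]; exact: ole_olt_trans (oexp_le ej) (oexp_lt_index g j).
Qed.

Lemma otower_le m n : (m <= n)%N -> ole (otower m) (otower n).
Proof.
move=> /subnK <-; elim: (n - m)%N => [|k IH]; first exact: ole_refl.
apply: ole_trans IH _; exact: ole_trans (ole_wexp _) (wexp_oexp _).
Qed.

Lemma wexp_epsilon0 e : olt e epsilon0 -> olt (wexp e) epsilon0.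
Proof.
move=> /olt_osup[n en]; apply/olt_osup; exists n.+1.
exact: ole_olt_trans (wexp_oexp e) (oexp_lt en).
Qed.

Lemma nadd_epsilon0 a b :
  olt a epsilon0 -> olt b epsilon0 -> olt (nadd a b) epsilon0.
Proof.
move=> /olt_osup[m am] /olt_osup[n bn]; apply/olt_osup; exists (maxn m n).+1.
apply: (@oexp_closed (otower (maxn m n))).
  by apply: (olt_ole_trans am (@otower_le m (maxn m n).+1 _)); rewrite leqW ?leq_maxl.
by apply: (olt_ole_trans bn (@otower_le n (maxn m n).+1 _)); rewrite leqW ?leq_maxr.
Qed.

Lemma zero_epsilon0 : olt ozero epsilon0.
Proof. by apply/olt_osup; exists 1%N; apply: olt_zero_oexp. Qed.

Lemma osucc_epsilon0 a : olt a epsilon0 -> olt (osucc a) epsilon0.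
Proof.
move=> ae; apply: ole_olt_trans (osucc_nadd a) _; apply: nadd_epsilon0 => //.
apply: ole_olt_trans (wexp_epsilon0 zero_epsilon0).
exact/osucc_ole/olt_wexp_zero.
Qed.

(** * Bounding order types by powers of omega *)

(** Containment in a finite union of sets satisfying [P], in a form that comes with an induction
    adding one piece at a time. *)
Inductive fcover (T : Type) (P : set T -> Prop) : set T -> Prop :=
| fcover0 : fcover P set0
| fcoverS X Y Z : P X -> fcover P Y -> Z `<=` X `|` Y -> fcover P Z.

Lemma fcover_mono T (P Q : set T -> Prop) X :
  (forall Y, P Y -> Q Y) -> fcover P X -> fcover Q X.
Proof.
move=> PQ; elim=> [|Y Y' Z PY _ IH ZY]; first exact: fcover0.
by apply: fcoverS IH ZY; apply: PQ.
Qed.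

Lemma fcover_sub T (P : set T -> Prop) X Y : X `<=` Y -> fcover P Y -> fcover P X.
Proof.
move=> XY cY; case: cY XY => [X0|A B Z PA cB ZAB XZ].
  by rewrite subset0 in X0; rewrite X0; apply: fcover0.
exact: fcoverS PA cB (subset_trans XZ ZAB).
Qed.

Lemma fcoverU T (P : set T -> Prop) X Y :
  fcover P X -> fcover P Y -> fcover P (X `|` Y).
Proof.
move=> cX cY; elim: cX => [|A B Z PA cB IH ZAB]; first by rewrite set0U.
by apply: fcoverS PA IH _; rewrite setUA; apply: setSU.
Qed.

Lemma fcover1 T (P : set T -> Prop) X : P X -> fcover P X.
Proof. by move=> PX; apply: fcoverS PX (fcover0 _) _; rewrite setU0. Qed.

Lemma fcover_in T (P : set T -> Prop) Z :
  (forall X Y, Y `<=` X -> P X -> P Y) -> fcover P Z ->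
  fcover (fun Y => P Y /\ Y `<=` Z) Z.
Proof.
move=> Psub cZ; suff H Z' : Z' `<=` Z -> fcover (fun Y => P Y /\ Y `<=` Z') Z'.
  exact: H.
elim: cZ Z' => [|X Y {}Z PX _ IH ZXY] Z'.
  by rewrite subset0 => ->; apply: fcover0.
move=> Z'Z; apply: (@fcoverS _ _ (X `&` Z') (Y `&` Z')).
- by split; [apply: Psub PX; apply: subIsetl|apply: subIsetr].
- apply: fcover_mono (IH (Y `&` Z') _) => [A [PA AY]|]; last exact: subIsetl.
  by split=> //; apply: subset_trans AY _; apply: subIsetr.
- by move=> z Z'z; have [?|?] := ZXY _ (Z'Z _ Z'z); [left|right].
Qed.

(** [F] is a relation because a function may be represented by several parameters. Pieces can be cut
    down to [Z], so [PQ] is asked only inside [Z]. *)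
Lemma fcover_image T T' (P : set T -> Prop) (Q : set T' -> Prop)
    (F : T -> T' -> Prop) Z :
  (forall X Y, Y `<=` X -> P X -> P Y) ->
  (forall Y, P Y -> Y `<=` Z -> Q [set z | exists2 y, Y y & F y z]) ->
  fcover P Z -> fcover Q [set z | exists2 y, Z y & F y z].
Proof.
move=> Psub PQ /(fcover_in Psub); elim=> [|X Y Z' [PX XZ] _ IH ZXY].
  by apply: fcover_sub (fcover0 _) => z [].
apply: fcoverS (PQ X PX XZ) IH _ => z [y /ZXY [?|?] ?]; [left|right]; by exists y.
Qed.

(** In a linear extension of [le] everything strictly below [x] is residual to [x]; bounds on
    residuals are thus bounds on initial segments. *)
Definition residual T (le : T -> T -> Prop) (X : set T) (x : T) : set T :=
  [set y | X y /\ ~ le x y].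

(* [wbound le e X]: every linear extension of [le] on [X] has order type at most
   [omega ^ e].  Covering the residuals by finitely many sets of smaller
   exponent makes the de Jongh-Parikh bound for products ([wbound_prod]) a
   direct induction. *)
Fixpoint wbound T (le : T -> T -> Prop) (e : ord) (X : set T) : Prop :=
  let: Ord J f := e in
  forall x, X x -> fcover (fun Y => exists j, wbound le (f j) Y) (residual le X x).

Lemma wbound_sub T (le : T -> T -> Prop) e X Y :
  Y `<=` X -> wbound le e X -> wbound le e Y.
Proof.
case: e => J f YX H y Yy; apply: fcover_sub (H y (YX _ Yy)).
by move=> z [Yz ?]; split=> //; apply: YX.
Qed.

Lemma wbound_le T (le : T -> T -> Prop) e e' X :
  ole e e' -> wbound le e X -> wbound le e' X.
Proof.
elim: e e' X => J f IH [K g] X fg H x Xx; apply: fcover_mono (H x Xx) => Y [j Hj].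
by have [k fk] := fg j; exists k; apply: IH fk Hj.
Qed.

Lemma wboundP T (le : T -> T -> Prop) e X : wbound le e X <->
  forall x, X x ->
    fcover (fun Y => exists2 e', olt e' e & wbound le e' Y) (residual le X x).
Proof.
case: e => J f; split=> H x Xx; apply: fcover_mono (H x Xx) => Y.
  by move=> [j Hj]; exists (f j) => //; apply: olt_index.
by move=> [e' [j ej] He']; exists j; apply: wbound_le ej He'.
Qed.

Lemma wbound_index_sub T (le : T -> T -> Prop) (J : Type) (f : J -> ord) X Y :
  Y `<=` X -> (exists j, wbound le (f j) X) -> exists j, wbound le (f j) Y.
Proof. by move=> YX [j H]; exists j; apply: wbound_sub H. Qed.

(** If [z'] is residual to [z], then every parameter of [z'] is residual to every parameter of [z],
    by monotonicity; covers of residuals can therefore be transported. *)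
Lemma wbound_image T T' (le : T -> T -> Prop) (le' : T' -> T' -> Prop)
    (F : T -> T' -> Prop) e X Z :
  (forall z, Z z -> exists2 x, X x & F x z) ->
  (forall x x' z z', X x -> X x' -> Z z -> Z z' ->
     F x z -> F x' z' -> le x x' -> le' z z') ->
  wbound le e X -> wbound le' e Z.
Proof.
elim: e X Z => J f IH X Z ZE mono wX z Zz; have [x Xx xz] := ZE z Zz.
apply: fcover_sub (@fcover_image _ _ _ (fun Y => exists j, wbound le' (f j) Y)
  (fun x z => F x z /\ Z z) _ (@wbound_index_sub _ _ _ _) _ (wX x Xx)).
  move=> z' [Zz' Nz]; have [x' Xx' xz'] := ZE z' Zz'.
  by exists x' => //; split=> // xx'; apply/Nz/(mono x x').
move=> Y [j wY] YX; exists j; apply: (IH j Y) wY => [z' [y Yy [yz' _]]|].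
  by exists y.
move=> a a' b b' /YX[Xa _] /YX[Xa' _] [_ _ [_ Zb]] [_ _ [_ Zb']]; exact: mono.
Qed.

Lemma wbound_rel T (le le' : T -> T -> Prop) e X :
  (forall x y, X x -> X y -> le x y -> le' x y) -> wbound le e X -> wbound le' e X.
Proof.
move=> H; apply: (@wbound_image _ _ _ _ eq) => [z Zz|x x' z z' Xx Xx' _ _ <- <-].
  by exists z.
exact: H.
Qed.

(** If [z'] is not above [z], its first coordinate is not above [x] or its second is not above [y].
    Each alternative lowers one of the two exponents, and the natural sum decreases strictly in
    both. *)
Lemma wbound_prod T1 T2 T (le1 : T1 -> T1 -> Prop) (le2 : T2 -> T2 -> Prop)
    (le : T -> T -> Prop) (F : T1 -> T2 -> T -> Prop) e1 e2 X1 X2 Z :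
  (forall z, Z z -> exists x y, [/\ X1 x, X2 y & F x y z]) ->
  (forall x x' y y' z z', X1 x -> X1 x' -> X2 y -> X2 y' -> Z z -> Z z' ->
     F x y z -> F x' y' z' -> le1 x x' -> le2 y y' -> le z z') ->
  wbound le1 e1 X1 -> wbound le2 e2 X2 -> wbound le (nadd e1 e2) Z.
Proof.
elim: e1 e2 X1 X2 Z => J1 f1 IH1; elim=> J2 f2 IH2 X1 X2 Z ZE mono w1 w2.
apply/wboundP => z Zz; have [x [y [X1x X2y Fxyz]]] := ZE z Zz.
pose P Y := exists2 e', olt e' (nadd (Ord f1) (Ord f2)) & wbound le e' Y.
apply: (@fcover_sub _ P _
   ([set z' | exists2 x', residual le1 X1 x x' &
      Z z' /\ exists2 y', X2 y' & F x' y' z'] `|`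
    [set z' | exists2 y', residual le2 X2 y y' &
      Z z' /\ exists2 x', X1 x' & F x' y' z'])).
  move=> z' [Zz' Nzz']; have [x' [y' [X1x' X2y' F']]] := ZE z' Zz'.
  have [xx'|Nxx'] := pselect (le1 x x').
    right; exists y'; last by split=> //; exists x'.
    by split=> // yy'; apply: Nzz'; apply: (mono x x' y y').
  by left; exists x' => //; split=> //; exists y'.
apply: fcoverU.
  apply: (@fcover_image _ _ _ P
    (fun x' z' => Z z' /\ exists2 y', X2 y' & F x' y' z') _
    (@wbound_index_sub _ _ _ _) _ (w1 x X1x)).
  move=> Y [j wY] YX; exists (nadd (f1 j) (Ord f2)); first exact/nadd_lt2r/olt_index.
  apply: (IH1 j (Ord f2) Y X2) wY w2 => [z' [a Ya [_ [b X2b Fab]]]|].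
    by exists a, b.
  move=> a a' b b' c c' /YX[Xa _] /YX[Xa' _] Yb Yb' [? ? [Zc _]] [? ? [Zc' _]].
  exact: mono.
apply: (@fcover_image _ _ _ P
  (fun y' z' => Z z' /\ exists2 x', X1 x' & F x' y' z') _
  (@wbound_index_sub _ _ _ _) _ (w2 y X2y)).
move=> Y [j wY] YX; exists (nadd (Ord f1) (f2 j)); first exact/nadd_lt2l/olt_index.
apply: (IH2 j X1 Y) w1 wY => [z' [b Yb [_ [a X1a Fab]]]|].
  by exists a, b.
move=> a a' b b' c c' Xa Xa' /YX[Yb _] /YX[Yb' _] [? ? [Zc _]] [? ? [Zc' _]].
exact: mono.
Qed.

(** A bounded set is well-quasi-ordered: [x] generates everything but its residual, whose finitely
    many pieces have finite bases by induction. This is what makes constants that depend on an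
    element uniform. *)
Lemma wbound_basis T (le : T -> T -> Prop) e X : (forall x, le x x) ->
  wbound le e X ->
  exists s : seq T, (forall x, List.In x s -> X x) /\
    forall x, X x -> exists2 b, List.In b s & le b x.
Proof.
move=> refl; elim: e X => J f IH X wX.
have [[x Xx]|X0] := pselect (exists x, X x); last first.
  by exists [::]; split=> // x Xx; case: X0; exists x.
suff [s [sX sr]] : exists s : seq T, (forall x, List.In x s -> X x) /\
    forall y, residual le X x y -> exists2 b, List.In b s & le b y.
  exists (x :: s); split=> [y [<-//|/sX//]|y Xy].
  have [xy|Nxy] := pselect (le x y); first by exists x => //; left.
  by have [|b bs by_] := sr y; [|exists b => //; right].
have := fcover_in (@wbound_index_sub _ _ _ _) (wX x Xx).
have: residual le X x `<=` X by move=> y [].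
move: (residual le X x) => Z ZX; elim=> [|A B C [[j wA] AZ] _ [s [sX sB]] CAB].
  by exists [::].
have [t [tA tb]] := IH j A wA.
exists (t ++ s); split=> y.
  by rewrite List.in_app_iff => -[/tA/AZ/ZX//|/sX].
by case/CAB => [/tb|/sB] [b bs]; exists b => //; rewrite List.in_app_iff; [left|right].
Qed.

(* [obound le b X]: linear extensions of [le] on [X] have order type at most [b]. *)
Fixpoint obound T (le : T -> T -> Prop) (b : ord) (X : set T) : Prop :=
  let: Ord J f := b in
  forall x, X x -> exists j, obound le (f j) (residual le X x).

Lemma obound_sub T (le : T -> T -> Prop) b X Y :
  Y `<=` X -> obound le b X -> obound le b Y.
Proof.
elim: b X Y => J f IH X Y YX H y Yy; have [j Hj] := H y (YX _ Yy).
by exists j; apply: IH Hj => z [/YX].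
Qed.

Lemma obound_le T (le : T -> T -> Prop) b c X :
  ole b c -> obound le b X -> obound le c X.
Proof.
elim: b c X => J f IH [K g] X fg H x Xx; have [j Hj] := H x Xx.
by have [k fk] := fg j; exists k; apply: IH fk Hj.
Qed.

Lemma oboundU T (le : T -> T -> Prop) b c X Y :
  obound le b X -> obound le c Y -> obound le (nadd b c) (X `|` Y).
Proof.
elim: b c X Y => J f IHb; elim=> K g IHc X Y bX cY z [Xz|Yz].
  have [j bj] := bX z Xz; exists (inl j).
  apply: obound_sub (IHb j (Ord g) _ _ bj cY) => w [[Xw|Yw] Nw]; [left|right] => //.
have [k ck] := cY z Yz; exists (inr k).
by apply: obound_sub (IHc k _ _ bX ck) => w [[Xw|Yw] Nw]; [left|right].
Qed.

(** The definition of [wexp] is made for this: a residual is a finite union of pieces of type at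
    most [omega ^ (f j)], and the types of a union add up naturally. *)
Lemma wbound_obound T (le : T -> T -> Prop) e X :
  wbound le e X -> obound le (wexp e) X.
Proof.
elim: e X => J f IH X wX x Xx.
have := wX x Xx; move: (residual le X x) => Z.
elim=> [|A B C [j wA] _ [s sB] CAB]; first by exists [::].
exists (j :: s); apply: obound_sub CAB _; apply: oboundU sB; exact: IH.
Qed.

(** * Sums of functions *)

Local Open Scope ring_scope.

Section Eventually.
Variable R : realType.
Implicit Types (P Q : R -> Prop).

Definition ev P : Prop := exists M : R, forall x, M < x -> P x.

Lemma ev1 P Q : ev P -> (forall x, P x -> Q x) -> ev Q.
Proof. by move=> [M H] PQ; exists M => x /H /PQ. Qed.

Lemma ev2 P1 P2 Q : ev P1 -> ev P2 -> (forall x, P1 x -> P2 x -> Q x) -> ev Q.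
Proof.
move=> [M H] [N K] PQ; exists (Num.max M N) => x.
by rewrite gt_max => /andP[/H ? /K ?]; apply: PQ.
Qed.

Lemma ev_and P1 P2 : ev P1 -> ev P2 -> ev (fun x => P1 x /\ P2 x).
Proof. by move=> H1 H2; apply: ev2 H1 H2 _. Qed.

Lemma ev3 P1 P2 P3 Q : ev P1 -> ev P2 -> ev P3 ->
  (forall x, P1 x -> P2 x -> P3 x -> Q x) -> ev Q.
Proof.
move=> H1 H2 H3 PQ; apply: ev2 H1 (ev_and H2 H3) _ => x ? [? ?]; exact: PQ.
Qed.

Lemma ev4 P1 P2 P3 P4 Q : ev P1 -> ev P2 -> ev P3 -> ev P4 ->
  (forall x, P1 x -> P2 x -> P3 x -> P4 x -> Q x) -> ev Q.
Proof.
by move=> H1 H2 H3 H4 PQ; apply: ev3 H1 H2 (ev_and H3 H4) _ => x ? ? [? ?]; apply: PQ.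
Qed.

Lemma evT P : (forall x, P x) -> ev P. Proof. by move=> H; exists 0 => x _. Qed.

Lemma ev_gt M : ev (fun x => M < x). Proof. by exists M. Qed.

Lemma ev_ge M : ev (fun x => M <= x). Proof. by exists M => x /ltW. Qed.

Lemma ev_ex P : ev P -> exists x, P x.
Proof. by move=> [M H]; exists (M + 1); apply: H; rewrite ltrDl. Qed.

End Eventually.

Section Sums.
Variable R : realType.
Local Notation fn := (R -> R).
Implicit Types (f g h y z : fn) (G : set fn).

Definition leinf f g : Prop := ev (fun x => f x <= g x).

(** The preorder behind the Archimedean classes. *)
Definition dom f g : Prop := exists C, ev (fun x => f x <= C * g x).

Definition lei i f g : Prop := exists C, ev (fun x => f x <= g x + C * (g x / x ^+ i)).

(** The error is measured against a fixed [y], so that all nonnegative functions of size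
    [O(y / x ^ i)] become equivalent. *)
Definition ley y i f g : Prop := exists C, ev (fun x => f x <= g x + C * (y x / x ^+ i)).

Definition xshift k g : fn := fun x => x ^+ k * g x.

Inductive sums G : set fn :=
| sums0 : sums G (fun=> 0)
| sumsS g f : G g -> sums G f -> sums G (g \+ f).

Fixpoint nsums n G : set fn :=
  if n is m.+1 then [set f | exists g h, [/\ G g, nsums m G h & f = g \+ h]]
  else [set fun=> 0].

Definition evnneg G := forall g, G g -> ev (fun x => 0 <= g x).

Lemma sums_sub G G' : G `<=` G' -> sums G `<=` sums G'.
Proof.
move=> sG z; elim=> [|g f Gg _ IH]; first exact: sums0.
by apply: sumsS => //; apply: sG.
Qed.

Lemma nsums_sub n G G' : G `<=` G' -> nsums n G `<=` nsums n G'.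
Proof.
move=> sG; elim: n => // n IH z [g [h [Gg nh ->]]].
by exists g, h; split; [apply: sG|apply: IH|].
Qed.

Lemma sums_add G f g : sums G f -> sums G g -> sums G (f \+ g).
Proof.
move=> + Gg; elim=> [|h f' Gh _ IH].
  by rewrite (_ : _ \+ g = g) //; apply/funext => x /=; rewrite add0r.
rewrite (_ : _ \+ g = h \+ (f' \+ g)); first exact: sumsS.
by apply/funext => x /=; rewrite addrA.
Qed.

Lemma sums_split G (P : fn -> Prop) z : sums G z ->
  exists n a b, [/\ nsums n [set g | G g /\ P g] a,
    sums [set g | G g /\ ~ P g] b & z = a \+ b].
Proof.
elim=> [|g f Gg _ [n [a [b [na sb ->]]]]].
  exists 0%N, (fun=> 0), (fun=> 0); split=> //; first exact: sums0.
  by apply/funext => x /=; rewrite addr0.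
have [Pg|NPg] := pselect (P g).
  exists n.+1, (g \+ a), b; split=> //; first by exists g, a.
  by apply/funext => x /=; rewrite addrA.
exists n, a, (g \+ b); split=> //; first exact: sumsS.
by apply/funext => x /=; rewrite addrCA.
Qed.

Lemma sumsU A B z : sums (A `|` B) z ->
  exists a b, [/\ sums A a, sums B b & z = a \+ b].
Proof.
elim=> [|g f [Ag|Bg] _ [a [b [sa sb ->]]]].
- exists (fun=> 0), (fun=> 0); split; [exact: sums0|exact: sums0|].
  by apply/funext => x /=; rewrite addr0.
- exists (g \+ a), b; split=> //; first exact: sumsS.
  by apply/funext => x /=; rewrite addrA.
- exists a, (g \+ b); split=> //; first exact: sumsS.
  by apply/funext => x /=; rewrite addrCA.
Qed.

Lemma sums_ge0 G z : evnneg G -> sums G z -> ev (fun x => 0 <= z x).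
Proof.
move=> G0; elim=> [|g f Gg _ IH]; first exact: evT.
by apply: ev2 (G0 _ Gg) IH _ => x /=; apply: addr_ge0.
Qed.

Lemma leinf_refl f : leinf f f. Proof. exact: evT. Qed.

Lemma leinf_add f f' g g' : leinf f f' -> leinf g g' -> leinf (f \+ g) (f' \+ g').
Proof. by move=> H K; apply: ev2 H K _ => x /=; apply: lerD. Qed.

Lemma lei_refl i f : lei i f f.
Proof. by exists 0; apply: evT => x; rewrite mul0r addr0. Qed.

Lemma ley_refl y i f : ley y i f f.
Proof. by exists 0; apply: evT => x; rewrite mul0r addr0. Qed.

Lemma ley_add y i f f' g g' :
  ley y i f f' -> ley y i g g' -> ley y i (f \+ g) (f' \+ g').
Proof.
move=> [C H] [D K]; exists (C + D); apply: ev2 H K _ => x /= H K.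
by rewrite mulrDl addrACA; apply: lerD.
Qed.

Lemma dom_pos f g : ev (fun x => 0 <= g x) -> dom f g ->
  exists2 C, 0 < C & ev (fun x => f x <= C * g x).
Proof.
move=> g0 [C H]; exists (`|C| + 1); first by rewrite ltr_wpDl.
apply: ev2 g0 H _ => x g0 /le_trans; apply; apply: ler_wpM2r => //.
by apply: le_trans (ler_norm C) _; rewrite lerDl.
Qed.

Lemma dom_trans f g h : ev (fun x => 0 <= g x) -> dom f g -> dom g h -> dom f h.
Proof.
move=> g0 /(dom_pos g0)[C C0 H] [D K]; exists (C * D); apply: ev2 H K _ => x H K.
by apply: le_trans H _; rewrite -mulrA ler_pM2l.
Qed.

Lemma wbound_nsums (le : fn -> fn -> Prop) d G n : (forall f, le f f) ->
  (forall f f' g g', le f f' -> le g g' -> le (f \+ g) (f' \+ g')) ->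
  wbound le d G -> wbound le (natmul n d) (nsums n G).
Proof.
move=> refl add wG; elim: n => [|n IH].
  apply/wboundP => x ->; apply: fcover_sub (fcover0 _) => y [-> []]; exact: refl.
apply: (@wbound_prod _ _ _ le le le (fun a b c => c = a \+ b) _ _ G (nsums n G)) => //.
by move=> a a' b b' c c' _ _ _ _ _ _ -> ->; apply: add.
Qed.

Lemma wbound_sums0 (le : fn -> fn -> Prop) e : (forall f, le f f) ->
  wbound le e (sums set0).
Proof.
move=> refl; apply/wboundP => z sz; apply: fcover_sub (fcover0 _).
case: sz => [|g f []]; move=> w [sw []]; case: sw => [|g f []]; exact: refl.
Qed.

Lemma fcover_bigU T (P : set T -> Prop) (F : nat -> set T) N :
  (forall n, P (F n)) -> fcover P [set z | exists2 n, (n < N)%N & F n z].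
Proof.
move=> PF; elim: N => [|N IH]; first by apply: fcover_sub (fcover0 _) => z [].
apply: fcoverS (PF N) IH _ => z [n]; rewrite ltnS leq_eqVlt => /orP[/eqP->|nN] Fz.
  by left.
by right; exists n.
Qed.

Lemma nat_gt_ex (C : R) : exists n : nat, C <= n%:R.
Proof.
exists (Num.bound `|C|); apply: le_trans (ler_norm C) _.
exact/ltW/archi_boundP.
Qed.

Lemma nsums_lower n G z (c : R) a :
  (forall g, G g -> ev (fun x => z x <= c * g x)) ->
  nsums n G a -> ev (fun x => n%:R * z x <= c * a x).
Proof.
move=> H; elim: n a => [|n IH] a /=; first by move=> ->; apply: evT => x; rewrite mul0r mulr0.
move=> [g [h [Gg nh ->]]]; apply: ev2 (H g Gg) (IH h nh) _ => x /= Hg Hh.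
by rewrite -natr1 mulrDl mul1r mulrDr addrC lerD.
Qed.

Lemma dom_uniform (s : seq fn) z :
  (forall b, List.In b s -> ev (fun x => 0 <= b x)) ->
  (forall b, List.In b s -> dom z b) ->
  exists N : nat, forall b, List.In b s -> ev (fun x => z x <= N%:R * b x).
Proof.
elim: s => [|a s IH] b0 bz; first by exists 0%N.
have [b bs|b bs|N HN] := IH; [by apply: b0; right|by apply: bz; right|].
have [C HC] := bz a (or_introl erefl); have [M HM] := nat_gt_ex C.
have up K L b : (K <= L)%N -> ev (fun x => 0 <= b x) ->
    ev (fun x => z x <= K%:R * b x) -> ev (fun x => z x <= L%:R * b x).
  move=> KL b0' H; apply: ev2 b0' H _ => x b0' /le_trans; apply.
  by rewrite ler_wpM2r // ler_nat.
exists (maxn M N) => b [<-|bs].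
  apply: (@up M); [exact: leq_maxl|by apply: b0; left|].
  have a0 := b0 a (or_introl erefl).
  apply: ev2 a0 HC _ => x a0 /le_trans; apply; exact: ler_wpM2r.
by apply: (@up N); [exact: leq_maxr|apply: b0; right|apply: HN].
Qed.

(* Only boundedly many terms of a sum below [z] can dominate [z]. *)
Lemma wbound_sums G G' d e eta : evnneg G -> wbound leinf d G -> olt d (wexp eta) ->
  G' `<=` G -> wbound dom e G' -> wbound leinf (wexp (nadd eta e)) (sums G').
Proof.
move=> G0 wG deta; elim: e G' => J f IH G' sG' wG'; apply/wboundP => z Sz.
have z0 : ev (fun x => 0 <= z x) by apply: sums_ge0 Sz => g /sG'; apply: G0.
set E := wexp _.
(* [B] is the union of the [dom]-residuals of the terms of [z]. A function outside [B] dominates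
   every term of [z], hence [z]; inside [B] smaller exponents are available. *)
have [B [sB cB bigB]] : exists B, [/\ B `<=` G',
    fcover (fun Y => exists j, wbound dom (f j) Y) B &
    forall g, G' g -> ~ B g -> dom z g].
  elim: Sz {z0} => [|g h Gg _ [B [sB cB bigB]]].
    exists set0; split=> //; first exact: fcover0.
    by move=> g _ _; exists 0; apply: evT => x; rewrite mul0r.
  exists (B `|` residual dom G' g); split.
  - by move=> a [/sB//|[]].
  - by apply: fcoverU => //; apply: wG'.
  move=> a Ga Na; have [C HC] := bigB a Ga (fun Ba => Na (or_introl Ba)).
  have [|N1] := pselect (dom g a); last by case: Na; right.
  move=> [D HD]; exists (D + C); apply: ev2 HD HC _ => x /= HD HC.
  by rewrite mulrDl lerD.
have [a aE wB] : exists2 a, olt a E & wbound leinf a (sums B).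
  have := fcover_in (@wbound_index_sub _ _ _ _) cB.
  suff H C : fcover (fun Y => (exists j, wbound dom (f j) Y) /\ Y `<=` B) C ->
      exists2 a, olt a E & wbound leinf a (sums C) by apply: H.
  elim=> [|A B' {}C [[j wA] AB] _ [a aE wa] CAB].
    by exists ozero; [apply: olt_wexp_zero|apply: wbound_sums0 leinf_refl].
  exists (nadd (wexp (nadd eta (f j))) a).
    apply: olt_wexp_nadd => //; exact/wexp_lt/nadd_lt2l/olt_index.
  have sA : A `<=` G' by apply: subset_trans AB sB.
  apply: (@wbound_prod _ _ _ leinf leinf leinf (fun a b c => c = a \+ b) _ _
    (sums A) (sums B')) => //.
  - by move=> w /(sums_sub CAB)/sumsU [u [v [? ? ->]]]; exists u, v.
  - by move=> ? ? ? ? ? ? _ _ _ _ _ _ -> ->; apply: leinf_add.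
  - exact: IH (subset_trans sA sG') wA.
pose Big := [set g | G' g /\ ~ B g].
(* The constant in [dom z g] depends on [g]; a finite basis of [Big] for [leinf] makes it
   uniform. *)
have [N N0 HN] : exists2 N : nat, (0 < N)%N &
    forall g, Big g -> ev (fun x => z x <= N%:R * g x).
  have sBG : Big `<=` G by move=> g [/sG'].
  have [s [sBig bs]] := wbound_basis leinf_refl (wbound_sub sBG wG).
  have [N HN] := dom_uniform (fun b bs => G0 _ (sBG _ (sBig b bs)))
    (fun b bs => bigB b (sBig b bs).1 (sBig b bs).2).
  exists N.+1 => // g Bg; have [b bs' bg] := bs g Bg.
  apply: ev3 (HN b bs') bg (G0 _ (sBG _ Bg)) _ => x H1 H2 H3.
  apply: le_trans H1 _; apply: le_trans (ler_wpM2l _ H2) _ => //.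
  by rewrite ler_wpM2r // ler_nat.
pose F n := [set w | exists a b, [/\ nsums n G a, sums B b & w = a \+ b]].
(* A sum not above [z] has fewer than [N] terms in [Big], since [N] of them already add up to at
   least [z]. Its other terms form a sum over [B]. *)
apply: (@fcover_sub _ _ _ [set w | exists2 n, (n < N)%N & F n w]); last first.
  apply: fcover_bigU => n; exists (nadd (natmul n d) a).
    apply: olt_wexp_nadd => //; apply: olt_ole_trans (wexp_le (nadd_gel _ _)).
    exact: olt_wexp_natmul.
  apply: (@wbound_prod _ _ _ leinf leinf leinf (fun a b c => c = a \+ b) _ _
    (nsums n G) (sums B)) => //.
    by move=> ? ? ? ? ? ? _ _ _ _ _ _ -> ->; apply: leinf_add.
  apply: wbound_nsums => //; [exact: leinf_refl|exact: leinf_add].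
move=> w [Sw Nw]; have [n [u [v [nu sv wE]]]] := sums_split (fun g => ~ B g) Sw.
have sv' : sums B v by apply: sums_sub sv => g [_ /contrapT].
have v0 : ev (fun x => 0 <= v x) by apply: sums_ge0 sv' => g /sB/sG'; apply: G0.
exists n; last by exists u, v; split=> //; apply: nsums_sub nu => g [/sG'].
rewrite ltnNge; apply/negP => Nn; apply: Nw; rewrite wE.
apply: ev3 (nsums_lower HN nu) z0 v0 _ => x /= H z0x v0x.
apply: ler_wpDr => //; rewrite -(@ler_pM2l _ N%:R) ?ltr0n //.
by apply: le_trans H; apply: ler_wpM2r => //; rewrite ler_nat.
Qed.

(** * Sums compared up to a relative error *)

Section Gap.
Variables (G : set fn) (i : nat) (d eta : ord).
Hypothesis G0 : evnneg G.
Hypothesis gap : forall y g k, G y -> G g ->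
  dom y (xshift k g) \/ dom (xshift k.+1 g) y.
Hypothesis i0 : (0 < i)%N.
Hypothesis wGi : wbound (lei i) d G.
Hypothesis deta : olt d (wexp eta).

Lemma dom_xshift k g y : G g -> G y -> dom (xshift k g) y -> dom g y.
Proof.
move=> Gg Gy /(dom_pos (G0 Gy)) [C C0 H]; exists C.
apply: ev3 H (G0 Gg) (ev_ge 1) _ => x H g0 x1; apply: le_trans H.
by rewrite /xshift ler_peMl // exprn_ege1.
Qed.

Lemma sums_dom_upper k y z : G y ->
  sums [set g | G g /\ dom (xshift k g) y] z ->
  exists2 C, 0 < C & ev (fun x => z x <= C * (y x / x ^+ k)).
Proof.
move=> Gy; elim=> [|g f [Gg /(dom_pos (G0 Gy))[C C0 HC]] _ [D D0 HD]].
  exists 1 => //; apply: ev2 (G0 Gy) (ev_gt 0) _ => x y0 x0.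
  by rewrite mul1r divr_ge0 // exprn_ge0 // ltW.
exists (C + D); first exact: addr_gt0.
apply: ev3 HC HD (ev_gt 0) _ => x /= HC HD x0; rewrite mulrDl; apply: lerD => //.
by rewrite mulrA ler_pdivlMr ?exprn_gt0 // mulrC.
Qed.

(** Sizes below [y / x ^ i] are invisible, and by the gap terms lie on the scales [y / x ^ k] with
    [k] an integer or below. There are [m] scales left, each adding [omega ^ eta]: a sum residual to
    [z] has boundedly many terms on the scale [k], and all its other terms are smaller by a factor
    [x]. *)
Lemma wbound_scale y m k : G y -> (k + m)%N = i ->
  wbound (ley y i) (natmul m (wexp eta)) (sums [set g | G g /\ dom (xshift k g) y]).
Proof.
move=> Gy; elim: m k => [|m IH] k km; apply/wboundP => z Sz.
  rewrite addn0 in km; rewrite -km; apply: fcover_sub (fcover0 _) => w [Sw []].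
  have [C C0 HC] := sums_dom_upper Gy Sz; exists C.
  have w0 : ev (fun x => 0 <= w x) by apply: sums_ge0 Sw => g [Gg _]; apply: G0.
  by apply: ev2 HC w0 _ => x H w0; apply: le_trans H _; rewrite lerDr.
have [C C0 HC] := sums_dom_upper Gy Sz.
pose S := [set g | G g /\ dom (xshift k g) y].
pose Big := [set g | S g /\ dom y (xshift k g)].
have sBG : Big `<=` G by move=> g [[]].
have pos_xshift g : G g -> ev (fun x => 0 <= xshift k g x).
  move=> Gg; apply: ev2 (G0 Gg) (ev_gt 0) _ => x g0 x0.
  by rewrite /xshift mulr_ge0 // exprn_ge0 // ltW.
have [N N0 HN] : exists2 N : nat, (0 < N)%N &
    forall g, Big g -> ev (fun x => C * (y x / x ^+ k) <= N%:R * g x).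
  have [s [sBig bs]] := wbound_basis (@lei_refl i) (wbound_sub sBG wGi).
  have HN' b : List.In b (map (xshift k) s) -> ev (fun x => 0 <= b x) /\ dom y b.
    by move=> /List.in_map_iff [g [<- gs]]; have [Sg yg] := sBig _ gs; split=> //;
      apply: pos_xshift; case: Sg.
  have [N HN] := dom_uniform (fun b bs => (HN' b bs).1) (fun b bs => (HN' b bs).2).
  (* The factor 2 absorbs the relative error [D / x ^ i] in the comparison with a basis element,
     which is at most 1 once [x] exceeds 1 and [D]; this uses [i > 0]. *)
  have [M HM] := nat_gt_ex (C * N%:R * 2).
  exists M.+1 => // g Bg; have [b bs' [D bg]] := bs g Bg.
  have := HN _ (List.in_map (xshift k) _ _ bs').
  move=> H1; apply: ev4 H1 bg (G0 (sBG _ Bg)) (ev_gt (Num.max 1 D)) _ => x H1 H2 g0.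
  rewrite gt_max => /andP[x1 xD].
  have x0 : 0 < x by apply: lt_trans x1.
  have b2 : b x <= 2 * g x.
    apply: le_trans H2 _; rewrite [2 * _]mulr_natl mulr2n lerD2l.
    rewrite mulrCA ler_piMr // ler_pdivrMr ?exprn_gt0 // mul1r.
    apply: le_trans (ltW xD) _; rewrite -(prednK i0) exprS.
    by apply: ler_peMr; [apply: ltW|apply: exprn_ege1; apply: ltW].
  apply: (@le_trans _ _ (C * N%:R * 2 * g x)).
    rewrite -!mulrA ler_pM2l // ler_pdivrMr ?exprn_gt0 // mulrAC.
    apply: le_trans H1 _; rewrite /xshift -!mulrA ler_wpM2l // mulrCA.
    by rewrite mulrCA ler_pM2l ?exprn_gt0.
  rewrite ler_wpM2r //; apply: le_trans HM _; by rewrite ler_nat.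
pose F n := [set w | exists a b, [/\ nsums n [set g | G g /\ dom g y] a,
  sums [set g | G g /\ dom (xshift k.+1 g) y] b & w = a \+ b]].
apply: (@fcover_sub _ _ _ [set w | exists2 n, (n < N)%N & F n w]); last first.
  apply: fcover_bigU => n; exists (nadd (natmul n d) (natmul m (wexp eta))).
    by apply: nadd_lt2r; apply: olt_wexp_natmul.
  apply: (@wbound_prod _ _ _ (ley y i) (ley y i) (ley y i) (fun a b c => c = a \+ b)
    _ _ (nsums n [set g | G g /\ dom g y])
    (sums [set g | G g /\ dom (xshift k.+1 g) y])) => //.
  - by move=> ? ? ? ? ? ? _ _ _ _ _ _ -> ->; apply: ley_add.
  - apply: wbound_nsums; [exact: ley_refl|exact: ley_add|].
    apply: (@wbound_rel _ (lei i)); last by apply: wbound_sub wGi => g [].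
    move=> f g [Gf _] [Gg /(dom_pos (G0 Gy))[D D0 gy]] [E H]; exists (`|E| * D).
    apply: ev4 gy H (ev_gt 0) (G0 Gg) _ => x gy H x0 g0; apply: le_trans H _.
    rewrite lerD2l -mulrA; apply: (@le_trans _ _ (`|E| * (g x / x ^+ i))).
      by rewrite ler_wpM2r ?ler_norm // divr_ge0 // exprn_ge0 // ltW.
    by rewrite ler_wpM2l // mulrA ler_wpM2r // invr_ge0 exprn_ge0 // ltW.
  - by apply: IH; rewrite addSnnS.
move=> w [Sw Nw].
have [n [u [v [nu sv wE]]]] := sums_split (fun g => dom y (xshift k g)) Sw.
have sv' : sums [set g | G g /\ dom (xshift k.+1 g) y] v.
  by apply: sums_sub sv => g [[Gg _] Ng]; split=> //; case: (gap k Gy Gg).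
have v0 : ev (fun x => 0 <= v x) by apply: sums_ge0 sv' => g [Gg _]; apply: G0.
exists n; last first.
  exists u, v; split=> //; apply: nsums_sub nu => g [[Gg gy] _]; split=> //.
  exact: dom_xshift gy.
rewrite ltnNge; apply/negP => Nn; apply: Nw; rewrite wE.
have yk0 : ev (fun x => 0 <= y x / x ^+ k).
  apply: ev2 (G0 Gy) (ev_gt 0) _ => x y0 x0; exact: divr_ge0 y0 (exprn_ge0 k (ltW x0)).
exists 0; apply: ev4 HC (@nsums_lower _ Big (fun x => C * (y x / x ^+ k)) _ _ HN nu) v0 yk0 _.
move=> x /= H1 H v0x yx0; rewrite mul0r addr0.
apply: ler_wpDr => //; apply: le_trans H1 _; rewrite -(@ler_pM2l _ N%:R) ?ltr0n //.
by apply: le_trans H; apply: ler_wpM2r; rewrite ?ler_nat // mulr_ge0 // ltW.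
Qed.

(** Nonempty sums with a marked term [y] dominating all others. Only [y] is restricted to [G'],
    which permits an induction on the bound for the leading classes. *)
Definition topsums G' : set fn :=
  [set f | exists y h, [/\ G' y, sums [set g | G g /\ dom g y] h & f = y \+ h]].

(** For [k = 0] the gap makes [dom] total on [G], so one of the terms dominates all. *)
Lemma sums_topsums g f : G g -> sums G f -> topsums G (g \+ f).
Proof.
move=> Gg Sf; elim: Sf g Gg => [|a b Ga _ IH] g Gg.
  by exists g, (fun=> 0); split=> //; apply: sums0.
have [y [h [Gy Sh ->]]] := IH a Ga.
have [gy|yg] : dom g y \/ dom y g.
  have [[C H]|/dom_xshift H] := gap 0 Gy Gg; [right|left; exact: H].
  by exists C; apply: ev1 H _ => x; rewrite /xshift expr0 mul1r.
  exists y, (g \+ h); split=> //; first exact: sumsS.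
  by apply/funext => x /=; rewrite addrCA.
exists g, (y \+ h); split=> //; apply: sumsS => //.
apply: sums_sub Sh => c [Gc cy]; split=> //; exact: dom_trans (G0 Gy) cy yg.
Qed.

(** The leading class contributes additively. A sum residual to [z] cannot have a leading term
    strictly above that of [z], since by the gap it would exceed [z]. If the leading terms are
    equivalent, [wbound_scale] applies from [k = 0]; otherwise the leading term is residual to that
    of [z], and induction applies. *)
Lemma wbound_topsums G' e : G' `<=` G -> wbound dom e G' ->
  wbound (lei i) (nadd (osucc (natmul i (wexp eta))) e) (topsums G').
Proof.
elim: e G' => J f IH G' sG' wG'; apply/wboundP => z [y [h [G'y Sh zE]]].
set tau := natmul i (wexp eta).
have Gy := sG' _ G'y.
have xshift0 g : xshift 0 g = g by apply/funext => x; rewrite /xshift expr0 mul1r.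
pose A := [set w | sums [set g | G g /\ dom (xshift 0 g) y] w /\ dom y w].
apply: (@fcover_sub _ _ _ ([set w | exists2 y', residual dom G' y y' &
    exists2 h', sums [set g | G g /\ dom g y'] h' & w = y' \+ h'] `|` A)).
  move=> w [[y' [h' [G'y' Sh' wE]]] Nw].
  have h'0 : ev (fun x => 0 <= h' x) by apply: sums_ge0 Sh' => g [Gg _]; apply: G0.
  have [yy'|Nyy'] := pselect (dom y y'); last first.
    by left; exists y' => //; exists h'.
  right.
  have [y'y|[C H]] : dom y' y \/ dom (xshift 1 y) y'.
    by have := gap 0 (sG' _ G'y') Gy; rewrite xshift0.
    split.
      apply: sums_sub (_ : sums [set g | G g /\ dom g y] w) => [g /= [Gg]|].
        by rewrite xshift0.
      rewrite wE; apply: sumsS; first by split=> //; apply: sG'.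
      apply: sums_sub Sh' => g [Gg gy']; split=> //.
      exact: dom_trans (G0 (sG' _ G'y')) gy' y'y.
    have [C C0 H] := dom_pos (G0 (sG' _ G'y')) yy'; exists C.
    apply: ev2 H h'0 _ => x H h0; apply: le_trans H _.
    by rewrite ler_pM2l // wE lerDl.
  (* Here [x * y] is dominated by [y']; the spare factor [x] outweighs the constants, so [z] would
     lie below [w]. *)
  case: Nw; exists 0.
  have Sh0 : sums [set g | G g /\ dom (xshift 0 g) y] h.
    by apply: sums_sub Sh => g /= [Gg]; rewrite xshift0.
  have [D D0 HD] := sums_dom_upper Gy Sh0.
  apply: ev4 H HD (ev_and h'0 (G0 (sG' _ G'y')))
    (ev_gt (Num.max 1 ((1 + D) * C))) _ => x H HD' [h0 y'0].
  rewrite gt_max => /andP[x1 xD].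
  have x0 : 0 < x by apply: lt_trans x1.
  rewrite mul0r addr0 zE wE /=; apply: ler_wpDr => //.
  apply: (@le_trans _ _ ((1 + D) * y x)).
    by rewrite mulrDl mul1r lerD2l; apply: le_trans HD' _; rewrite expr0 divr1.
  rewrite -(ler_pM2l x0) mulrCA; move: H; rewrite /xshift expr1 => H.
  apply: le_trans (ler_wpM2l _ H) _; first by rewrite addr_ge0 // ltW.
  by rewrite mulrA ler_wpM2r // ltW.
apply: fcoverU.
  apply: (@fcover_image _ _ _ _ _ _ (@wbound_index_sub _ _ _ _) _ (wG' y G'y)).
  move=> Y [j wY] YX; exists (nadd (osucc tau) (f j)); first exact/nadd_lt2l/olt_index.
  have sY : Y `<=` G by move=> c /YX [/sG'].
  apply: wbound_sub (IH j Y sY wY) => w [y' Yy' [h' Sh' ->]].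
  by exists y', h'.
apply: fcover1; exists tau.
  exact: olt_ole_trans (olt_succ _) (nadd_gel _ _).
apply: (@wbound_rel _ (ley y i)); last first.
  by apply: wbound_sub (@wbound_scale y i 0 Gy (add0n i)) => w [].
move=> u v [_ _] [Sv yv] [C H].
have v0 : ev (fun x => 0 <= v x) by apply: sums_ge0 Sv => g [Gg _]; apply: G0.
have [D D0 HD] := dom_pos v0 yv; exists (`|C| * D).
apply: ev4 H HD (ev_gt 0) (G0 Gy) _ => x H HD' x0 y0; apply: le_trans H _.
rewrite lerD2l -mulrA; apply: (@le_trans _ _ (`|C| * (y x / x ^+ i))).
  by rewrite ler_wpM2r ?ler_norm // divr_ge0 // exprn_ge0 // ltW.
by rewrite ler_wpM2l // mulrA ler_wpM2r // invr_ge0 exprn_ge0 // ltW.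
Qed.

End Gap.

End Sums.

Arguments leinf {R} f g.
Arguments dom {R} f g.
Arguments lei {R} i f g.

(** * Functions below [2 ^ (x ^ x)] *)

(* [UPowX a] is [a ^ x] and [UPowK p a] is [a ^ ((p + 2) ^ x)]. *)
Inductive ut : Type :=
| UOne | UX | UAdd of ut & ut | UMul of ut & ut | UPowX of ut | UPowK of nat & ut.

(** The logarithm of a term of weight [n > 0] has the size of [n ^ x] up to powers of [x], whence
    the factor [p + 2] for an exponent [(p + 2) ^ x]. Weight 0 is reserved for terms equal to 1,
    whence the 1 in the clause for sums. *)
Fixpoint wt (t : ut) : nat :=
  match t with
  | UOne => 0
  | UX => 1
  | UAdd a b => maxn 1 (maxn (wt a) (wt b))
  | UMul a b => maxn (wt a) (wt b)
  | UPowX a => wt a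
  | UPowK p a => p.+2 * wt a
  end.

(* For terms of weight [n], the number of nested [x]-th powers above the last
   contribution of weight [n]. *)
Fixpoint lev (n : nat) (t : ut) : nat :=
  if (wt t < n)%N then 0 else
  match t with
  | UOne => 0
  | UX => 1
  | UAdd a b => maxn 1 (maxn (lev n a) (lev n b))
  | UMul a b => maxn (lev n a) (lev n b)
  | UPowX a => (lev n a).+1
  | UPowK p a => 1
  end.

Section Terms.
Variable R : realType.
Local Notation fn := (R -> R).

Lemma ln2_gt0 : 0 < ln (2 : R). Proof. by rewrite ln_gt0 // ltr1n. Qed.

Lemma ln2_ge_half : 2^-1 <= ln (2 : R).
Proof.
rewrite -ler_expR lnK ?posrE ?ltr0n //.
have := expR_ge1Dx (- (2^-1) : R); rewrite expRN => H.
rewrite -[leLHS]invrK -[leRHS]invrK lef_pV2 ?posrE ?invr_gt0 ?expR_gt0 ?ltr0n //.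
by apply: le_trans H; lra.
Qed.

Definition kpow (n : nat) (x : R) : R := expR (x * ln n%:R).

Fixpoint uev (t : ut) (x : R) : R :=
  match t with
  | UOne => 1
  | UX => x
  | UAdd a b => uev a x + uev b x
  | UMul a b => uev a x * uev b x
  | UPowX a => expR (x * ln (uev a x))
  | UPowK p a => expR (kpow p.+2 x * ln (uev a x))
  end.

Lemma kpow_gt0 n x : 0 < kpow n x. Proof. exact: expR_gt0. Qed.

Lemma kpow1 x : kpow 1 x = 1. Proof. by rewrite /kpow ln1 mulr0 expR0. Qed.

Lemma kpowM m n x : (0 < m)%N -> (0 < n)%N -> kpow (m * n) x = kpow m x * kpow n x.
Proof.
by move=> m0 n0; rewrite /kpow natrM lnM ?posrE ?ltr0n // mulrDr expRD.
Qed.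

Lemma kpow_le m n x : 0 <= x -> (0 < m)%N -> (m <= n)%N -> kpow m x <= kpow n x.
Proof.
move=> x0 m0 mn; rewrite ler_expR ler_wpM2l // ler_ln ?posrE ?ltr0n //.
  by rewrite ler_nat.
exact: leq_trans mn.
Qed.

Lemma kpow_ge1 n x : 0 <= x -> (0 < n)%N -> 1 <= kpow n x.
Proof. by move=> x0 n0; rewrite -(kpow1 x) kpow_le. Qed.

Lemma kpow_ge0 n x : 0 <= kpow n x. Proof. exact/ltW/kpow_gt0. Qed.

Lemma uev_ge1 t x : 2 <= x -> 1 <= uev t x.
Proof.
move=> x2; have x0 : 0 <= x by apply: le_trans x2.
elim: t => //= [|a IHa b IHb|a IHa b IHb|a IH|p a IH].
- by apply: le_trans x2; rewrite ler1n.
- by apply: le_trans IHa _; rewrite lerDl; apply: le_trans IHb.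
- by rewrite mulr_ege1.
- by rewrite -expR0 ler_expR mulr_ge0 // ln_ge0.
- by rewrite -expR0 ler_expR mulr_ge0 ?ln_ge0 // ltW // kpow_gt0.
Qed.

Lemma uev_gt0 t x : 2 <= x -> 0 < uev t x.
Proof. by move=> /(uev_ge1 t); apply: lt_le_trans. Qed.

Lemma uln_ge0 t x : 2 <= x -> 0 <= ln (uev t x).
Proof. by move=> /(uev_ge1 t); apply: ln_ge0. Qed.

Lemma uev_wt0 t x : wt t = 0%N -> uev t x = 1.
Proof.
elim: t => //= [a _ b _|a IHa b IHb|a IH|p a IH].
- by move=> /eqP; rewrite -leqn0 geq_max.
- by move=> /eqP; rewrite -leqn0 geq_max !leqn0 => /andP[/eqP/IHa-> /eqP/IHb->]; rewrite mulr1.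
- by move=> /IH->; rewrite ln1 mulr0 expR0.
- by move=> /eqP; rewrite muln_eq0 /= => /eqP/IH->; rewrite ln1 mulr0 expR0.
Qed.

(** Together with [uln_upper] this makes the weight visible in the growth of the function,
    independently of the term chosen. *)
Lemma uln_wt t x : 2 <= x -> (0 < wt t)%N -> ln 2 * kpow (wt t) x <= ln (uev t x).
Proof.
move=> x2; have x0 : 0 <= x by apply: le_trans x2.
have l2 : 0 <= ln (2 : R) by rewrite ln_ge0 // ler1n.
have mono (m n : nat) : (0 < m)%N -> (m <= n)%N ->
    ln 2 * kpow m x <= ln (2 : R) * kpow n x.
  by move=> m0 mn; rewrite ler_wpM2l // kpow_le.
elim: t => //= [_|a IHa b IHb _|a IHa b IHb|a IH|p a IH].
- by rewrite kpow1 mulr1 ler_ln ?posrE ?ltr0n // (lt_le_trans _ x2).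
- have a1 := uev_ge1 a x2; have b1 := uev_ge1 b x2.
  have a0 := uev_gt0 a x2; have b0 := uev_gt0 b x2.
  have la : ln (uev a x) <= ln (uev a x + uev b x).
    by rewrite ler_ln ?posrE ?addr_gt0 // lerDl ltW.
  have lb : ln (uev b x) <= ln (uev a x + uev b x).
    by rewrite ler_ln ?posrE ?addr_gt0 // lerDr ltW.
  have [->|m0] := posnP (maxn (wt a) (wt b)).
    rewrite maxn0 kpow1 mulr1 ler_ln ?posrE ?ltr0n ?addr_gt0 //.
    by rewrite (natrD _ 1 1) lerD.
  rewrite (maxn_idPr m0); move: m0; rewrite /maxn; case: ifP => _ m0.
    exact: le_trans (IHb m0) lb.
  exact: le_trans (IHa m0) la.
- rewrite lnM ?posrE ?uev_gt0 //.
  have := uln_ge0 a x2; have := uln_ge0 b x2.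
  rewrite /maxn; case: ifP => _ b0 a0 m0.
    by apply: le_trans (IHb m0) _; rewrite lerDr.
  by apply: le_trans (IHa m0) _; rewrite lerDl.
- move=> m0; rewrite expRK; apply: le_trans (IH m0) _.
  by rewrite ler_peMl ?uln_ge0 // (le_trans _ x2) // ler1n.
- rewrite muln_gt0 => /andP[_ m0]; rewrite expRK kpowM // mulrCA.
  by rewrite ler_pM2l ?kpow_gt0 // IH.
Qed.

Lemma uln_upper t : exists j : nat, forall x : R, 2 <= x ->
  ln (uev t x) <= x ^+ j * kpow (maxn 1 (wt t)) x.
Proof.
have pw (x : R) (j J : nat) (m n : nat) : 2 <= x -> (j <= J)%N -> (0 < m)%N -> (m <= n)%N ->
    x ^+ j * kpow m x <= x ^+ J * kpow n x.
  move=> x2 jJ m0 mn; have x1 : 1 <= x by apply: le_trans x2; rewrite ler1n.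
  have x0 : 0 <= x by apply: le_trans x1.
  by apply: ler_pM; rewrite ?exprn_ge0 ?kpow_ge0 ?ler_weXn2l ?kpow_le.
have x0 (x : R) : 2 <= x -> 0 <= x by apply: le_trans.
elim: t => /= [||a [i IHa] b [j IHb]|a [i IHa] b [j IHb]|a [i IHa]|p a [i IHa]].
- by exists 0%N => x x2; rewrite ln1 expr0 mul1r kpow_ge0.
- exists 1%N => x x2; rewrite kpow1 mulr1 expr1.
  by apply: le_trans (ltW (ln_sublinear _)) _; rewrite ?(lt_le_trans _ x2).
- exists (maxn i j).+1 => x x2; set n := maxn 1 (maxn _ _).
  set X := x ^+ maxn i j * kpow n x.
  have [aX bX] : ln (uev a x) <= X /\ ln (uev b x) <= X.
    by split; [apply: le_trans (IHa x x2) _|apply: le_trans (IHb x x2) _];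
      apply: pw => //; rewrite /n; lia.
  have X1 : 1 <= X.
    by rewrite mulr_ege1 ?kpow_ge1 ?x0 ?leq_maxl // exprn_ege1 // (le_trans _ x2) // ler1n.
  have aX' : uev a x <= expR X by rewrite -[leLHS]lnK ?posrE ?uev_gt0 // ler_expR.
  have bX' : uev b x <= expR X by rewrite -[leLHS]lnK ?posrE ?uev_gt0 // ler_expR.
  rewrite -[leRHS]expRK ler_ln ?posrE ?expR_gt0 ?addr_gt0 ?uev_gt0 //.
  apply: le_trans (lerD aX' bX') _; rewrite exprS -mulrA -/X.
  apply: (@le_trans _ _ (expR X * expR X)).
    rewrite -mulr2n -mulr_natl ler_pM2r ?expR_gt0 //.
    by apply: le_trans (expR_ge1Dx X); rewrite (natrD _ 1 1) lerD2l.
  by rewrite -expRD ler_expR -mulr2n -mulr_natl ler_pM2r // (lt_le_trans _ X1).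
- exists (maxn i j).+1 => x x2; set n := maxn 1 (maxn _ _).
  set X := x ^+ maxn i j * kpow n x.
  have [aX bX] : ln (uev a x) <= X /\ ln (uev b x) <= X.
    by split; [apply: le_trans (IHa x x2) _|apply: le_trans (IHb x x2) _];
      apply: pw => //; rewrite /n; lia.
  rewrite lnM ?posrE ?uev_gt0 //; apply: le_trans (lerD aX bX) _.
  rewrite exprS -mulrA -/X -mulr2n -mulr_natl ler_wpM2r //.
  by rewrite mulr_ge0 ?kpow_ge0 // exprn_ge0 // x0.
- exists i.+1 => x x2; rewrite expRK exprS -mulrA ler_wpM2l ?x0 //; exact: IHa.
- have [a0|m0] := posnP (wt a).
    exists 0%N => x x2; rewrite expRK uev_wt0 // ln1 mulr0.
    by rewrite expr0 mul1r kpow_ge0.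
  exists i => x x2; rewrite expRK.
  apply: le_trans (ler_wpM2l (kpow_ge0 _ _) (IHa x x2)) _.
  rewrite (maxn_idPr m0) (maxn_idPr _) ?muln_gt0 // kpowM //.
  by rewrite mulrCA.
Qed.

(** Terms of high level outgrow any given term of weight at most [n]; this will bound the levels in
    a residual. *)
Lemma uln_lev n t j x : 2 <= x -> (0 < n)%N -> (wt t <= n)%N -> lev n t = j.+1 ->
  ln 2 * (x ^+ j * kpow n x) <= ln (uev t x).
Proof.
move=> x2 n0; have x0 : 0 <= x by apply: le_trans x2.
have base t' : (wt t' < n)%N = false -> (wt t' <= n)%N ->
    ln 2 * (x ^+ 0 * kpow n x) <= ln (uev t' x).
  move=> H1 H2; have e : wt t' = n by apply/eqP; rewrite eqn_leq H2 leqNgt H1.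
  by rewrite expr0 mul1r -e uln_wt // e.
elim: t j => [|||a IHa b IHb|a IHa|p a IHa] //.
- by rewrite /=; case: ifP.
- by move=> j /=; case: ifP => // w wn [<-]; apply: (base UX).
- move=> a IHa b IHb [|j] wn /=; case: ifP => // w.
    by move=> _; apply: (base (UAdd a b)).
  move: wn; rewrite /= !geq_max => /and3P[_ wa wb].
  have la : ln (uev a x) <= ln (uev a x + uev b x).
    by rewrite ler_ln ?posrE ?addr_gt0 ?uev_gt0 // lerDl ltW ?uev_gt0.
  have lb : ln (uev b x) <= ln (uev a x + uev b x).
    by rewrite ler_ln ?posrE ?addr_gt0 ?uev_gt0 // lerDr ltW ?uev_gt0.
  rewrite {1}/maxn; case: ifP => // _; rewrite /maxn; case: ifP => _ H.
    exact: le_trans (IHb _ wb H) lb.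
  exact: le_trans (IHa _ wa H) la.
- move=> j /=; rewrite geq_max => /andP[wa wb]; case: ifP => // w.
  have := uln_ge0 a x2; have := uln_ge0 b x2; rewrite lnM ?posrE ?uev_gt0 // => b0 a0.
  rewrite /maxn; case: ifP => _ H.
    by apply: le_trans (IHb _ wb H) _; rewrite lerDr.
  by apply: le_trans (IHa _ wa H) _; rewrite lerDl.
- move=> [|j] wn /=; case: ifP => // w; first by move=> _; apply: (base (UPowX a)).
  move=> [H]; rewrite expRK exprS -mulrA mulrCA ler_wpM2l //; exact: IHa.
- by move=> j wn /=; case: ifP => // w [<-]; apply: (base (UPowK p a)).
Qed.

Lemma lev_wt n t : (wt t < n)%N -> lev n t = 0%N.
Proof. by case: t => //= *; rewrite ifT. Qed.

Lemma lev_ge1 n t : (0 < n)%N -> wt t = n -> (0 < lev n t)%N.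
Proof.
move=> n0; elim: t => [|||a IHa b IHb|a IHa|p a IHa] //=.
- by move=> e; rewrite -e in n0.
- by move=> <-.
- by move=> a _ b _ ->; rewrite ltnn leq_max.
- move=> e; rewrite e ltnn; move: e; rewrite /maxn; case: ifP => ab e.
    by case: ifP => [_|/negbT]; rewrite ?IHb // -leqNgt => /(leq_trans (IHb e)).
  case: ifP => [|_]; last exact: IHa.
  exact: leq_ltn_trans.
- by move=> ->; rewrite ltnn.
- by move=> ->; rewrite ltnn.
Qed.

(** The factor [w] of a product [w * u ^ x]: the power [x ^ k] times all [g m ^ ((m + 2) ^ x)] with
    [m < n]. There is one base per exponent, since powers with the same exponent merge. *)
Fixpoint wterm (n k : nat) (g : nat -> ut) : ut :=
  if n is m.+1 then UMul (UPowK m (g m)) (wterm m k g)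
  else iter k (UMul UX) UOne.

Lemma uev_xpow k x : uev (iter k (UMul UX) UOne) x = x ^+ k.
Proof. by elim: k => //= k ->; rewrite exprS. Qed.

Lemma wterm_mul n k g k' g' x : 2 <= x ->
  uev (wterm n (k + k') (fun m => UMul (g m) (g' m))) x =
  uev (wterm n k g) x * uev (wterm n k' g') x.
Proof.
move=> x2; elim: n => [|n IH] /=; first by rewrite !uev_xpow exprD.
by rewrite IH lnM ?posrE ?uev_gt0 // mulrDr expRD mulrACA.
Qed.

Lemma wterm_one n k x : uev (wterm n k (fun=> UOne)) x = x ^+ k.
Proof. by elim: n => [|n IH] /=; rewrite ?uev_xpow // ln1 mulr0 expR0 mul1r IH. Qed.

Lemma wterm_single n p a x : (p < n)%N ->
  uev (wterm n 0 (fun m => if m == p then a else UOne)) x = uev (UPowK p a) x.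
Proof.
have H m : (m <= p)%N ->
    uev (wterm m 0 (fun m => if m == p then a else UOne)) x = 1.
  elim: m => [//|m IH] mp /=; rewrite (IH (ltnW mp)) (ltn_eqF mp) /=.
  by rewrite ln1 mulr0 expR0 mulr1.
elim: n => // n IH; rewrite ltnS leq_eqVlt => /orP[/eqP <-|pn] /=.
  by rewrite H // eqxx mulr1.
by rewrite IH // gtn_eqF //= ln1 mulr0 expR0 mul1r.
Qed.

Definition lset (n j : nat) : set ut := [set t | (wt t <= n)%N /\ (lev n t <= j)%N].

Definition wgood (n : nat) (g : nat -> ut) : Prop :=
  forall m, (m < n)%N -> (m.+2 * wt (g m) <= n)%N.

Definition gset (n j : nat) : set fn :=
  [set f | exists k g u, [/\ wgood n g, lset n j u &
     f = uev (UMul (wterm n k g) (UPowX u))]].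

(** A nonempty sum, so that there is a leading term. Equality is asked for [x >= 2], where all terms
    are at least 1 and [exp] undoes [ln]. *)
Definition issum (G : set fn) (h : fn) : Prop :=
  exists g f, [/\ G g, sums G f & forall x : R, 2 <= x -> h x = g x + f x].

Lemma issum_add G h h' : issum G h -> issum G h' -> issum G (h \+ h').
Proof.
move=> [g [f [Gg Sf E]]] [g' [f' [Gg' Sf' E']]]; exists g, (f \+ (g' \+ f')).
split=> //; first by apply: sums_add => //; apply: sumsS.
by move=> x x2 /=; rewrite E // E' // !addrA.
Qed.

Lemma issum_eq G h h' : (forall x : R, 2 <= x -> h x = h' x) -> issum G h -> issum G h'.
Proof.
move=> e [g [f [Gg Sf E]]]; exists g, f; split=> // x x2; rewrite -e //; exact: E.
Qed.

Lemma issum_mul G h h' :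
  (forall g g', G g -> G g' ->
     exists2 g'', G g'' & forall x : R, 2 <= x -> g'' x = g x * g' x) ->
  issum G h -> issum G h' -> issum G (h \* h').
Proof.
move=> Gm Gh Gh'.
have H1 g : G g -> issum G (g \* h').
  move=> Gg; case: Gh' => [g' [f [Gg' Sf E]]].
  apply: (@issum_eq _ (g \* (g' \+ f))) => [x x2 /=|]; first by rewrite E.
  elim: Sf g' Gg' {E} => [|a b Ga _ IH] g' Gg'.
    have [g'' Gg'' E] := Gm g g' Gg Gg'; exists g'', (fun=> 0).
    by split=> //; [apply: sums0|move=> x x2 /=; rewrite !addr0 E].
  apply: issum_eq (issum_add _ (IH a Ga)) => [x x2 /=|].
    by rewrite [in RHS]mulrDr.
  have [g'' Gg'' E] := Gm g g' Gg Gg'; exists g'', (fun=> 0).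
  by split=> //; [apply: sums0|move=> x x2 /=; rewrite addr0 E].
case: Gh => [g [f [Gg Sf E]]].
apply: (@issum_eq _ ((g \+ f) \* h')) => [x x2 /=|]; first by rewrite E.
elim: Sf g Gg {E} => [|a b Ga _ IH] g Gg.
  by apply: issum_eq (H1 _ Gg) => x x2 /=; rewrite addr0.
apply: issum_eq (issum_add (H1 _ Gg) (IH a Ga)) => x x2 /=.
by rewrite [in RHS]mulrDl.
Qed.

Lemma issum1 G g h : G g -> (forall x : R, 2 <= x -> h x = g x) -> issum G h.
Proof.
move=> Gg E; exists g, (fun=> 0); split=> //; first exact: sums0.
by move=> x x2; rewrite addr0 E.
Qed.

(** Products are expanded by distributivity, as [gset n j] is closed under multiplication. An [x]-th
    power of [a] is a product with [u = a], whose level is one lower; a power with exponent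
    [(p + 2) ^ x] goes into the factor [w]. *)
Lemma lset_issum n j t : (0 < n)%N -> lset n j.+1 t -> issum (gset n j) (uev t).
Proof.
move=> n0; have good1 : wgood n (fun=> UOne) by move=> m _; rewrite muln0.
have one : lset n j UOne by split=> //=; case: ifP.
have xk k h : (forall x : R, 2 <= x -> h x = x ^+ k) -> issum (gset n j) h.
  move=> E; apply: (@issum1 _ (uev (UMul (wterm n k (fun=> UOne)) (UPowX UOne)))).
    by exists k, (fun=> UOne), UOne.
  by move=> x x2 /=; rewrite wterm_one ln1 mulr0 expR0 mulr1 E.
elim: t => [_|_|a IHa b IHb|a IHa b IHb|a IHa|p a IHa].
- by apply: (xk 0%N) => x x2; rewrite expr0.
- by apply: (xk 1%N) => x x2; rewrite expr1.
- move=> [/= wab lab]; apply: issum_add; [apply: IHa|apply: IHb];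
    (split; first by move: wab; rewrite !geq_max => /and3P[]);
    move: lab; (case: ifP => [w _|_]; last by rewrite !geq_max => /and3P[]);
    by rewrite lev_wt //; move: w; rewrite !gtn_max => /and3P[].
- move=> [/= wab lab]; apply: issum_mul; [|apply: IHa|apply: IHb].
  2,3: (split; first by move: wab; rewrite !geq_max => /andP[]);
    move: lab; (case: ifP => [w _|_]; last by rewrite !geq_max => /andP[]);
    by rewrite lev_wt //; move: w; rewrite !gtn_max => /andP[].
  move=> _ _ [k [g [u [gg lu ->]]]] [k' [g' [u' [gg' lu' ->]]]].
  exists (uev (UMul (wterm n (k + k') (fun m => UMul (g m) (g' m))) (UPowX (UMul u u')))).
    exists (k + k')%N, (fun m => UMul (g m) (g' m)), (UMul u u'); split=> //.
      by move=> m mn /=; rewrite maxnMr geq_max gg // gg'.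
    split=> /=; first by rewrite geq_max lu.1 lu'.1.
    by case: ifP => // _; rewrite geq_max lu.2 lu'.2.
  move=> x x2 /=; rewrite wterm_mul // lnM ?posrE ?uev_gt0 // mulrDr expRD.
  by rewrite mulrACA.
- move=> [/= wa la].
  apply: (@issum1 _ (uev (UMul (wterm n 0 (fun=> UOne)) (UPowX a)))).
    exists 0%N, (fun=> UOne), a; split=> //; split=> //.
    by move: la; case: ifP => // w _; rewrite lev_wt.
  by move=> x x2 /=; rewrite wterm_one expr0 mul1r.
- move=> [wa _]; have [pn|np] := ltnP p n.
    pose g m := if m == p then a else UOne.
    apply: (@issum1 _ (uev (UMul (wterm n 0 g) (UPowX UOne)))).
      exists 0%N, g, UOne; split=> // m mn; rewrite /g.
      by case: eqP => [->//|_]; rewrite muln0.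
    by move=> x x2 /=; rewrite wterm_single // ln1 mulr0 expR0 mulr1.
  (* For [p >= n] the bound on the weight forces the base to have weight 0, so the power is the
     constant 1. *)
  apply: (xk 0%N) => x x2 /=.
  have a0 : wt a = 0%N.
    apply/eqP; rewrite -leqn0 leqNgt; apply/negP => a0; move: wa => /=.
    rewrite leqNgt => /negP; apply; apply: (@leq_trans p.+2); first by rewrite ltnS (leqW np).
    by rewrite leq_pmulr.
  by rewrite uev_wt0 // ln1 mulr0 expR0 expr0.
Qed.

End Terms.

(** * Analytic functions *)

Section Analytic.
Variable R : realType.
Local Notation fn := (R -> R).
Implicit Types (f g h : fn) (F G : nat -> fn).

Definition shifts F (r : R) : Prop :=
  forall n t, `|t| < r -> F n t = F n 0 + t * F n.+1 t.

Definition sbound F (r K B : R) : Prop :=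
  forall n t, `|t| < r -> `|F n t| <= K * B ^+ n.

(* Real analyticity at 0, through the remainders [F n] of the expansion of [f]
   divided by [t ^ n]. *)
Definition analytic f : Prop := exists F (r K B : R),
  [/\ [/\ 0 < r, 0 <= K & 0 <= B], forall t, `|t| < r -> f t = F 0%N t, shifts F r & sbound F r K B].

Lemma analytic_ext f g (r : R) : 0 < r -> (forall t, `|t| < r -> f t = g t) ->
  analytic f -> analytic g.
Proof.
move=> r0 fg [F [r' [K [B [[r'0 K0 B0] fE Fs Fb]]]]].
exists F, (Num.min r r'), K, B; split.
- by rewrite lt_min r0.
- by move=> t; rewrite lt_min => /andP[/fg <- /fE].
- by move=> n t; rewrite lt_min => /andP[_]; apply: Fs.
- by move=> n t; rewrite lt_min => /andP[_]; apply: Fb.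
Qed.

Lemma analytic_cst c : analytic (fun=> c).
Proof.
exists (fun n _ => if n == 0%N then c else 0), 1, `|c|, 1; split=> //.
- by move=> [|n] t _ /=; rewrite mulr0 addr0.
- by move=> [|n] t _ /=; rewrite expr1n mulr1 // normr0.
Qed.

Lemma analytic_id : analytic id.
Proof.
exists (fun n t => if n == 0%N then t else if n == 1%N then 1 else 0), 1, 1, 1.
split=> //; first by move=> [|[|n]] t _ /=; rewrite ?mulr1 ?add0r ?mulr0 ?addr0.
by move=> [|[|n]] t t1 /=; rewrite expr1n mulr1; [apply: ltW|rewrite normr1|rewrite normr0].
Qed.

Lemma analytic_add f g : analytic f -> analytic g -> analytic (f \+ g).
Proof.
move=> [F [r [K [B [[r0 K0 B0] fE Fs Fb]]]]] [G [r' [K' [B' [[r'0 K'0 B'0] gE Gs Gb]]]]].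
exists (fun n => F n \+ G n), (Num.min r r'), (K + K'), (Num.max B B'); split.
- by rewrite lt_min r0 r'0 addr_ge0 // le_max B0.
- by move=> t; rewrite lt_min => /andP[tr tr'] /=; rewrite fE // gE.
- by move=> n t; rewrite lt_min => /andP[tr tr'] /=; rewrite Fs // Gs // mulrDr addrACA.
- move=> n t; rewrite lt_min => /andP[tr tr'] /=; apply: le_trans (ler_normD _ _) _.
  rewrite mulrDl lerD //.
    apply: le_trans (Fb n t tr) _; rewrite ler_wpM2l // lerXn2r ?nnegrE ?le_max ?lexx ?B0 //.
  apply: le_trans (Gb n t tr') _; rewrite ler_wpM2l // lerXn2r ?nnegrE ?le_max ?lexx ?B0 ?orbT //.
Qed.

(** The remainders of a product: expand the first factor to order [m] and then, in its term of order
    [i], the second factor to order [m - i]. *)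
Definition conv F G : nat -> fn := fun m t =>
  F m t * G 0%N t + \sum_(i < m) F i 0 * G (m - i)%N t.

Lemma shifts_conv F G (r : R) : shifts F r -> shifts G r -> shifts (conv F G) r.
Proof.
move=> Fs Gs m t tr; rewrite /conv big_ord_recr /= subSnn.
rewrite (eq_bigr (fun i : 'I_m => F i 0 * G (m - i)%N 0 + t * (F i 0 * G (m.+1 - i)%N t))).
  rewrite big_split /= -mulr_sumr !mulrDr.
  have -> : t * (F m.+1 t * G 0%N t) = (F m t - F m 0) * G 0%N t.
    by rewrite (Fs m t tr); ring.
  have -> : t * (F m 0 * G 1%N t) = F m 0 * (G 0%N t - G 0%N 0).
    by rewrite (Gs 0%N t tr); ring.
  by ring.
move=> i _; rewrite (Gs _ t tr) subSn ?mulrDr; last exact/ltnW.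
by ring.
Qed.

(** The unequal rates [2 * B] and [B] make the sum geometric instead of one of [m] equal terms. The
    rate [2 * B] is thereby preserved under repeated products with [G], as composition requires. *)
Lemma sbound_conv F G (r L K B : R) : 0 <= L -> 0 <= K -> 0 <= B -> 0 < r ->
  sbound F r L (2 * B) -> sbound G r K B -> sbound (conv F G) r (2 * L * K) (2 * B).
Proof.
move=> L0 K0 B0 r0 Fb Gb m t tr.
have z0 : `|0 : R| < r by rewrite normr0.
have s2 : (\sum_(i < m) 2 ^+ i <= 2 ^+ m :> R).
  elim: m {Fb Gb} => [|m IH]; first by rewrite big_ord0 ler01.
  by rewrite big_ord_recr /= exprS mulr_natl mulr2n lerD2r.
apply: le_trans (ler_normD _ _) _.
have -> : 2 * L * K * (2 * B) ^+ m = L * K * B ^+ m * (2 ^+ m + 2 ^+ m).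
  by rewrite exprMn; ring.
rewrite mulrDr; apply: lerD.
  rewrite normrM; apply: le_trans (ler_pM _ _ (Fb m t tr) (Gb 0%N t tr)) _ => //.
  by rewrite expr0 mulr1 exprMn le_eqVlt; apply/orP; left; apply/eqP; ring.
apply: le_trans (ler_norm_sum _ _ _) _.
apply: (@le_trans _ _ (L * K * B ^+ m * \sum_(i < m) 2 ^+ i)); last first.
  by rewrite ler_wpM2l // !mulr_ge0 // exprn_ge0.
rewrite mulr_sumr; apply: ler_sum => i _.
rewrite normrM; apply: le_trans (ler_pM _ _ (Fb i 0 z0) (Gb (m - i)%N t tr)) _ => //.
have -> : B ^+ m = B ^+ i * B ^+ (m - i) by rewrite -exprD subnKC // ltnW.
by rewrite exprMn le_eqVlt; apply/orP; left; apply/eqP; ring.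
Qed.

Lemma sbound_le F (r K B K' B' : R) : 0 <= B -> K <= K' -> B <= B' -> 0 <= K ->
  sbound F r K B -> sbound F r K' B'.
Proof.
move=> B0 KK BB K0 Fb n t tr; apply: le_trans (Fb n t tr) _.
apply: ler_pM => //; first exact: exprn_ge0.
by rewrite lerXn2r ?nnegrE // (le_trans B0).
Qed.

Lemma analytic_mul f g : analytic f -> analytic g -> analytic (f \* g).
Proof.
move=> [F [r [K [B [[r0 K0 B0] fE Fs Fb]]]]] [G [r' [K' [B' [[r'0 K'0 B'0] gE Gs Gb]]]]].
pose C := Num.max B B'.
have C0 : 0 <= C by rewrite le_max B0.
exists (conv F G), (Num.min r r'), (2 * K * K'), (2 * C); split.
- by rewrite lt_min r0 r'0 !mulr_ge0.
- move=> t; rewrite lt_min => /andP[tr tr'] /=.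
  by rewrite /conv big_ord0 addr0 fE // gE.
- apply: shifts_conv => n t; rewrite lt_min => /andP[tr tr']; [exact: Fs|exact: Gs].
- apply: sbound_conv => //; first by rewrite lt_min r0.
    apply: (@sbound_le _ _ K B) => //.
      by rewrite (@le_trans _ _ C) ?le_max ?lexx // ler_peMl // ler1n.
    by move=> n t; rewrite lt_min => /andP[tr tr']; apply: Fb.
  apply: (@sbound_le _ _ K' B') => //; first by rewrite le_max lexx orbT.
  by move=> n t; rewrite lt_min => /andP[tr tr']; apply: Gb.
Qed.

Lemma shifts_expand F (r : R) n t : shifts F r -> `|t| < r ->
  F 0%N t = \sum_(i < n) F i 0 * t ^+ i + t ^+ n * F n t.
Proof.
move=> Fs tr; elim: n => [|n IH]; first by rewrite big_ord0 add0r expr0 mul1r.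
by rewrite IH big_ord_recr /= (Fs n t tr) exprS; ring.
Qed.

Lemma succn_le_exp2 n : (n.+1%:R : R) <= 2 ^+ n.
Proof. by rewrite -natrX ler_nat; elim: n => // n IH; rewrite expnS mul2n -addnn; lia. Qed.

(** Since [f t = t * F 1 t], the [k]-th power of [f] is [t ^ k] times a function with remainders
    [P k]. The remainder [H n] expands [g] to order [n] and the cofactor of the [k]-th power to
    order [n - k]. *)
Lemma analytic_comp f g : analytic g -> analytic f -> f 0 = 0 -> analytic (g \o f).
Proof.
move=> [G [rho [L [M [[rho0 L0 M0] gE Gs Gb]]]]].
move=> [F [r [K [B [[r0 K0 B0] fE Fs Fb]]]]] f0.
pose F1 n := F n.+1.
pose P k := iter k (conv^~ F1) (fun m _ => if m == 0%N then 1 else 0).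
pose K1 := K * B.
have K10 : 0 <= K1 by rewrite mulr_ge0.
have F1s : shifts F1 r by move=> n; apply: Fs.
have F1b : sbound F1 r K1 B by move=> n t tr; rewrite /K1 -mulrA -exprS Fb.
have Ps k : shifts (P k) r.
  elim: k => [|k IH]; first by move=> [|n] t _ /=; rewrite mulr0 addr0.
  exact: shifts_conv.
have Pb k : sbound (P k) r ((2 * K1) ^+ k) (2 * B).
  elim: k => [|k IH].
    move=> [|n] t _ /=; first by rewrite normr1 !expr0 mulr1.
    by rewrite normr0 mulr_ge0 ?exprn_ge0 // mulr_ge0.
  have L0' : 0 <= (2 * K1) ^+ k by rewrite exprn_ge0 // mulr_ge0.
  have := sbound_conv L0' K10 B0 r0 IH F1b.
  by rewrite exprS [2 * _ * K1]mulrAC.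
have P0 k t : P k 0%N t = (F 1%N t) ^+ k.
  elim: k => [|k IH] //=; rewrite exprSr -IH /conv big_ord0 addr0 //.
have z0 : `|0 : R| < r by rewrite normr0.
have F00 : F 0%N 0 = 0 by rewrite -fE // f0.
have fE1 t : `|t| < r -> f t = t * F 1%N t.
  by move=> tr; rewrite fE // Fs // F00 add0r.
pose r' := Num.min r (rho / (K1 + 1)).
have K11 : 0 < K1 + 1 by rewrite ltr_wpDl.
have r'0 : 0 < r' by rewrite lt_min r0 divr_gt0.
have frho t : `|t| < r' -> `|f t| < rho.
  rewrite lt_min ltr_pdivlMr // => /andP[tr trho]; rewrite fE1 // normrM.
  apply: le_lt_trans trho; rewrite ler_wpM2l //.
  by apply: le_trans (Fb 1%N t tr) _; rewrite expr1 -/K1 lerDl.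
pose H n t := \sum_(k < n) G k 0 * P k (n - k)%N t + (F 1%N t) ^+ n * G n (f t).
(* [D] exceeds both rates, so each of the [n + 1] summands of [H n] is at most [L * D ^ n]; their
   number is absorbed by [2 ^ n], whence the rate [2 * D]. *)
pose D := 2 * K1 * M + 2 * B.
have D0 : 0 <= D by rewrite addr_ge0 // !mulr_ge0.
exists H, r', L, (2 * D); split.
- by rewrite r'0 L0 mulr_ge0.
- by move=> t tr; rewrite /H big_ord0 add0r expr0 mul1r /= gE // frho.
- move=> n t tr'; have tr : `|t| < r by move: tr'; rewrite lt_min => /andP[].
  rewrite /H f0 big_ord_recr /= subSnn.
  rewrite (eq_bigr (fun k : 'I_n => G k 0 * P k (n - k)%N 0 +
    t * (G k 0 * P k (n.+1 - k)%N t))); last first.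
    move=> k _; rewrite (Ps k _ t tr) subSn ?mulrDr; last exact/ltnW.
    by ring.
  rewrite big_split /= -mulr_sumr !mulrDr.
  have -> : t * (G n 0 * P n 1%N t) = G n 0 * (P n 0%N t - P n 0%N 0).
    by rewrite (Ps n 0%N t tr); ring.
  rewrite !P0 (Gs n (f t) (frho t tr')) (fE1 t tr) exprS; ring.
- move=> n t tr'; have tr : `|t| < r by move: tr'; rewrite lt_min => /andP[].
  apply: le_trans (ler_normD _ _) _.
  have term k : (k <= n)%N -> (2 * K1 * M) ^+ k * (2 * B) ^+ (n - k) <= D ^+ n.
    move=> kn; have -> : D ^+ n = D ^+ k * D ^+ (n - k) by rewrite -exprD subnKC.
    apply: ler_pM; rewrite ?exprn_ge0 ?mulr_ge0 // lerXn2r ?nnegrE ?mulr_ge0 //.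
      by rewrite /D lerDl mulr_ge0.
    by rewrite /D lerDr !mulr_ge0.
  apply: (@le_trans _ _ (n%:R * (L * D ^+ n) + L * D ^+ n)); last first.
    rewrite -[X in _ + X]mul1r -mulrDl natr1 exprMn mulrCA ler_wpM2l //.
    by rewrite ler_wpM2r ?exprn_ge0 // succn_le_exp2.
  apply: lerD.
    apply: le_trans (ler_norm_sum _ _ _) _.
    rewrite mulr_natl -[X in _ *+ X]card_ord -sumr_const; apply: ler_sum => k _.
    have G0 : `|0 : R| < rho by rewrite normr0.
    rewrite normrM; apply: le_trans (ler_pM _ _ (Gb k 0 G0) (Pb k _ t tr)) _ => //.
    rewrite -mulrA ler_wpM2l // mulrA -exprMn [M * _]mulrC; apply: term.
    exact/ltnW.
  rewrite normrM normrX.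
  have F1n : `|F 1%N t| <= K1 by have := Fb 1%N t tr; rewrite expr1.
  have F1e : `|F 1%N t| ^+ n <= K1 ^+ n by rewrite lerXn2r ?nnegrE.
  apply: le_trans (ler_pM _ _ F1e (Gb n _ (frho t tr'))) _; rewrite ?exprn_ge0 //.
  rewrite mulrCA ler_wpM2l // -exprMn lerXn2r ?nnegrE ?mulr_ge0 //.
  rewrite /D -mulrA mulr_natl mulr2n -addrA lerDl addr_ge0 ?mulr_ge0 //.
Qed.

Lemma le_geo0 (y K : R) : (forall n, y <= K * 2^-1 ^+ n) -> y <= 0.
Proof.
move=> H; rewrite leNgt; apply/negP => y0.
have [n Hn] := nat_gt_ex (K / y).
have := H n; rewrite exprVn ler_pdivlMr ?exprn_gt0 //.
apply/negP; rewrite -ltNge -ltr_pdivrMl // mulrC; apply: le_lt_trans Hn _.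
by apply: lt_le_trans (succn_le_exp2 n); rewrite ltr_nat.
Qed.

(** If all coefficients vanish, [|f t|] is at most [K * (B * |t|) ^ n] for every [n], which tends to
    0 as soon as [B * |t| <= 1 / 2]. Otherwise the first nonzero coefficient leads. *)
Lemma analytic_dich f : analytic f ->
  (exists2 r : R, 0 < r & forall t, `|t| < r -> f t = 0) \/
  exists k (a K r : R), [/\ a != 0, 0 < r, 0 <= K & forall t, `|t| < r ->
     exists2 h, f t = t ^+ k * (a + t * h) & `|h| <= K].
Proof.
move=> [F [r [K [B [[r0 K0 B0] fE Fs Fb]]]]].
have [H|/existsNP[n /eqP Hn]] := pselect (forall n, F n 0 = 0); [left|right].
  have rr : 0 < Num.min r (2 * (B + 1))^-1.
    by rewrite lt_min r0 invr_gt0 mulr_gt0 // ltr_wpDl.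
  exists (Num.min r (2 * (B + 1))^-1) => // t; rewrite lt_min => /andP[tr tB].
  apply/eqP; rewrite -normr_le0; apply: (@le_geo0 _ K) => n.
  rewrite fE // (shifts_expand n Fs tr) big1 => [|i _]; last by rewrite H mul0r.
  rewrite add0r normrM normrX mulrC.
  apply: le_trans (ler_wpM2r _ (Fb n t tr)) _; first exact: exprn_ge0.
  rewrite -mulrA ler_wpM2l // -exprMn lerXn2r ?nnegrE ?mulr_ge0 //.
  apply: (@le_trans _ _ ((B + 1) * `|t|)); first by rewrite ler_wpM2r // lerDl.
  by rewrite mulrC -ler_pdivlMr ?ltr_wpDl // -invfM ltW.
have ex : exists n, F n 0 != 0 by exists n.
have [k Hk kmin] := ex_minnP ex.
exists k, (F k 0), (K * B ^+ k.+1), r; split=> //; first by rewrite mulr_ge0 ?exprn_ge0.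
move=> t tr; exists (F k.+1 t); last exact: Fb.
rewrite fE // (shifts_expand k Fs tr) big1 ?add0r => [|i _]; first by rewrite -Fs.
suff -> : F i 0 = 0 by rewrite mul0r.
apply/eqP; apply: contraTT (ltn_ord i) => /kmin; by rewrite -leqNgt.
Qed.

(** Estimates of Taylor remainders, geometric in the order, give the remainder functions by division
    by [t ^ n], with the coefficient itself as the value at 0. *)
Lemma analytic_taylor f (a : nat -> R) (r K B : R) : 0 < r -> 0 <= K -> 0 <= B ->
  (forall n, `|a n| <= K * B ^+ n) ->
  (forall n t, `|t| < r -> `|f t - \sum_(i < n) a i * t ^+ i| <= K * (B * `|t|) ^+ n) ->
  analytic f.
Proof.
move=> r0 K0 B0 ab fb.
pose F n t := if t == 0 then a n else (f t - \sum_(i < n) a i * t ^+ i) / t ^+ n.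
have f0 : f 0 = a 0%N.
  have z0 : `|0 : R| < r by rewrite normr0.
  have := fb 1%N 0 z0; rewrite normr0 mulr0 expr1 mulr0 normr_le0 subr_eq0.
  by rewrite big_ord_recl big_ord0 expr0 mulr1 addr0 => /eqP.
exists F, r, K, B; split=> //.
- move=> t _; rewrite /F; case: eqP => [->//|_].
  by rewrite big_ord0 subr0 expr0 divr1.
- move=> n t tr; rewrite /F eqxx; case: eqP => [->|/eqP t0]; first by rewrite mul0r addr0.
  by rewrite big_ord_recr /= exprS; field; rewrite t0 expf_neq0.
- move=> n t tr; rewrite /F; case: (eqVneq t 0) => [_//|t0].
  rewrite normrM normrV ?unitfE ?expf_neq0 // normrX ler_pdivrMr ?exprn_gt0 ?normr_gt0 //.
  by rewrite -mulrA -exprMn; apply: fb.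
Qed.

(** Integrates a remainder estimate: the order rises by one and the constant is kept. *)
Lemma MVT_bound (h dh : fn) (c r : R) n : 0 <= c -> h 0 = 0 ->
  (forall s, `|s| < r -> is_derive s (1 : R) h (dh s)) ->
  (forall s, `|s| < r -> `|dh s| <= c * `|s| ^+ n) ->
  forall t, `|t| < r -> `|h t| <= c * `|t| ^+ n.+1.
Proof.
move=> c0 h0 dH db t tr.
have core (a b : R) : a <= b -> `|a| <= `|t| -> `|b| <= `|t| ->
    `|h b - h a| <= c * `|t| ^+ n * (b - a).
  move=> ab ha hb.
  have inr s : s \in `[a, b]%R -> `|s| <= `|t|.
    rewrite in_itv /= => /andP[as_ sb]; rewrite ler_norml; apply/andP; split.
      by apply: le_trans as_; move: ha; rewrite ler_norml => /andP[].
    by apply: le_trans sb _; move: hb; rewrite ler_norml => /andP[].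
  have [||s sab E] := @MVT_segment R h dh a b ab.
  - move=> s; rewrite in_itv /= => /andP[as_ sb]; apply: dH; apply: le_lt_trans tr.
    by apply: inr; rewrite in_itv /= !ltW.
  - apply: derivable_within_continuous => s sab.
    have sr : `|s| < r by apply: le_lt_trans tr; apply: inr sab.
    by have [] := dH s sr.
  rewrite E normrM [`|b - a|]ger0_norm ?subr_ge0 // ler_wpM2r ?subr_ge0 //.
  have st := inr s sab; apply: le_trans (db s (le_lt_trans st tr)) _.
  by rewrite ler_wpM2l // lerXn2r ?nnegrE.
have [t0|t0] := leP 0 t.
  have := core 0 t t0; rewrite normr0 h0 !subr0 exprSr => /(_ _ _)/le_trans; apply=> //.
  by rewrite ger0_norm // mulrA.
have := core t 0 (ltW t0); rewrite normr0 h0 !sub0r normrN exprSr => /(_ _ _)/le_trans.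
by apply=> //; rewrite ltr0_norm // mulrA.
Qed.

(** The remainder of order [n + 1] has the remainder of order [n] as its derivative, so the bound
    [exp 1] for order 0 propagates with rate 1. *)
Lemma analytic_expR : analytic (@expR R).
Proof.
pose a i : R := i`!%:R^-1.
apply: (@analytic_taylor _ a 1 (expR 1) 1) => //.
  move=> n; rewrite expr1n mulr1 /a ger0_norm ?invr_ge0 //.
  apply: (@le_trans _ _ 1); last by rewrite -expR0 ler_expR.
  by rewrite invf_le1 ?ltr0n ?fact_gt0 // ler1n fact_gt0.
pose p n := \poly_(i < n) a i.
have dp n : (p n.+1)^`() = p n.
  apply/polyP => i; rewrite coef_deriv !coef_poly ltnS; case: ltnP => //= _.
    by rewrite -[LHS]mulr_natr /a factS natrM invfM mulrAC mulVf ?mul1r // pnatr_eq0.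
  by rewrite mul0rn.
move=> n t t1; rewrite mul1r -horner_poly -/(p n).
elim: n t t1 => [|n IH] t t1.
  rewrite /p poly_def big_ord0 horner0 subr0 expr0 mulr1 ger0_norm ?expR_ge0 //.
  by rewrite ler_expR; apply: le_trans (ler_norm _) (ltW t1).
apply: (@MVT_bound (fun t => expR t - (p n.+1).[t]) (fun t => expR t - (p n).[t]) _ 1) => //.
- by rewrite expR0 horner_coef0 coef_poly /= /a fact0 invr1 subrr.
move=> s s1; have := is_derive_poly (p n.+1) s; rewrite dp => ?.
exact: is_deriveB.
Qed.

Lemma analytic_inv1p : analytic (fun t : R => (1 + t)^-1).
Proof.
exists (fun n t => (-1) ^+ n / (1 + t)), (2^-1), 2, 1; split.
- by rewrite invr_gt0 ltr0n.
- by move=> t _; rewrite expr0 mul1r.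
- move=> n t; rewrite ltr_norml => /andP[t1 t2]; rewrite exprS addr0; field.
  by rewrite lt0r_neq0 //; lra.
- move=> n t; rewrite ltr_norml => /andP[t1 t2].
  rewrite expr1n mulr1 normrM normrX normrN1 expr1n mul1r ger0_norm ?invr_ge0; last lra.
  rewrite -[leRHS]invrK lef_pV2 ?posrE ?invr_gt0 //; lra.
Qed.

Lemma analytic_prim f g (r : R) : 0 < r ->
  (forall t, `|t| < r -> is_derive t (1 : R) f (g t)) -> analytic g -> analytic f.
Proof.
move=> r0 fg [G [r' [K [B [[r'0 K0 B0] gE Gs Gb]]]]].
pose a i := if i is j.+1 then G j 0 / j.+1%:R else f 0.
pose p n := \poly_(i < n) a i.
pose q n := \poly_(i < n) G i 0.
have dp n : (p n.+1)^`() = q n.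
  apply/polyP => i; rewrite coef_deriv !coef_poly ltnS; case: ltnP => //= _.
    by rewrite -[LHS]mulr_natr divfK // pnatr_eq0.
  by rewrite mul0rn.
pose rr := Num.min (Num.min r r') 1.
have rr0 : 0 < rr by rewrite !lt_min r0 r'0 ltr01.
have inrr (t : R) : `|t| < rr -> [/\ `|t| < r, `|t| < r' & `|t| < 1].
  by rewrite !lt_min => /andP[/andP[]].
have rem n t : `|t| < rr -> `|f t - (p n.+1).[t]| <= K * B ^+ n * `|t| ^+ n.+1.
  apply: (@MVT_bound (fun t => f t - (p n.+1).[t]) (fun t => g t - (q n).[t])).
  - by rewrite mulr_ge0 // exprn_ge0.
  - by rewrite horner_coef0 coef_poly /= subrr.
  - by move=> s /inrr[sr _ _]; rewrite -dp; apply: is_deriveB; apply: fg.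
  - move=> s /inrr[_ sr' _]; rewrite gE // (shifts_expand n Gs sr') horner_poly.
    rewrite [X in `|X|](_ : _ = s ^+ n * G n s); last by ring.
    rewrite normrM normrX mulrC ler_wpM2r ?exprn_ge0 //; exact: Gb.
pose K' := K + `|f 0| + 1; pose B' := B + 1.
have K'0 : 0 <= K' by rewrite !addr_ge0.
have B'1 : 1 <= B' by rewrite lerDr.
have B'0 : 0 <= B' by apply: le_trans B'1.
have KB n : K * B ^+ n <= K' * B' ^+ n.+1.
  apply: ler_pM => //; first exact: exprn_ge0.
    by rewrite /K' -addrA lerDl addr_ge0.
  apply: (@le_trans _ _ (B' ^+ n)); last by rewrite ler_weXn2l.
  by rewrite lerXn2r ?nnegrE // lerDl.
apply: (@analytic_taylor _ a rr K' B') => //.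
  move=> [|n] /=; first by rewrite expr0 mulr1 /K' addrAC lerDr addr_ge0.
  apply: le_trans (KB n); rewrite normrM [X in _ * X]ger0_norm ?invr_ge0 //.
  apply: (@le_trans _ _ `|G n 0|); last by apply: Gb; rewrite normr0.
  by rewrite ler_piMr // invf_le1 ?ltr0n // ler1n.
move=> [|n] t tr; rewrite -horner_poly -/(p _).
  rewrite /p poly_def big_ord0 horner0 subr0 expr0 mulr1.
  have := rem 0%N t tr; rewrite /p poly_def big_ord_recl big_ord0 addr0 expr0.
  rewrite alg_polyC hornerC mulr1 expr1 => H.
  have [_ _ t1] := inrr t tr.
  rewrite -(subrK (f 0) (f t)); apply: le_trans (ler_normD _ _) _.
  have H' : `|f t - f 0| <= K * `|t| by [].
  have Kt : K * `|t| <= K by rewrite ler_piMr // ltW.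
  by rewrite /K'; lra.
apply: le_trans (rem n t tr) _; rewrite exprMn mulrA ler_wpM2r ?exprn_ge0 //.
Qed.

Lemma analytic_ln1p : analytic (fun t : R => ln (1 + t)).
Proof.
apply: (@analytic_prim _ (fun t => (1 + t)^-1) 1) analytic_inv1p => //.
move=> t; rewrite ltr_norml => /andP[t1 t2].
have p0 : 0 < 1 + t by lra.
have d1 := is_derive1_ln p0.
have d2 : is_derive t (1 : R) (fun t => 1 + t) 1.
  by rewrite -[X in is_derive _ _ _ X]add0r; apply: is_deriveD.
have := @is_derive1_comp R (@ln R) (fun t => 1 + t) t _ _ d1 d2.
by rewrite mulr1.
Qed.

End Analytic.

Section AnalyticMore.
Variable R : realType.
Local Notation fn := (R -> R).
Implicit Types (f g : fn).

Lemma analytic_lip f : analytic f ->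
  exists r K : R, [/\ 0 < r, 0 <= K & forall t, `|t| < r -> `|f t - f 0| <= K * `|t|].
Proof.
move=> [F [r [K [B [[r0 K0 B0] fE Fs Fb]]]]].
exists r, (K * B); split=> //; first by rewrite mulr_ge0.
move=> t tr; rewrite !fE ?normr0 // Fs // addrC addKr normrM mulrC ler_wpM2r //.
by have := Fb 1%N t tr; rewrite expr1.
Qed.

Lemma analytic_bnd f : analytic f ->
  exists r K : R, [/\ 0 < r, 0 <= K & forall t, `|t| < r -> `|f t| <= K].
Proof.
move=> [F [r [K [B [[r0 K0 B0] fE Fs Fb]]]]].
exists r, K; split=> // t tr; rewrite fE //.
by have := Fb 0%N t tr; rewrite expr0 mulr1.
Qed.

Lemma analytic_scale (c : R) f : analytic f -> analytic (fun t => c * f t).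
Proof. by move=> af; apply: analytic_mul (analytic_cst c) af. Qed.

Lemma analytic_subc f : analytic f -> analytic (fun t => f t - f 0).
Proof. by move=> af; apply: analytic_add af (analytic_cst _). Qed.

Lemma analytic_pow k : analytic (fun t : R => t ^+ k).
Proof.
elim: k => [|k IH].
  by apply: (analytic_ext ltr01 _ (analytic_cst 1)) => t _; rewrite expr0.
apply: (analytic_ext ltr01 _ (analytic_mul (@analytic_id R) IH)) => t _.
by rewrite /= exprS.
Qed.

(** Composition asks for an inner function vanishing at 0, so the value at 0 is split off first; the
    inverse and the logarithm do the same multiplicatively. *)
Lemma analytic_exp f : analytic f -> analytic (fun t => expR (f t)).
Proof.
move=> af.
have H := analytic_comp (@analytic_expR R) (analytic_subc af) (subrr _).
apply: (analytic_ext ltr01 _ (analytic_scale (expR (f 0)) H)) => t _ /=.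
by rewrite -expRD addrC subrK.
Qed.

Lemma analytic_inv f : f 0 != 0 -> analytic f -> analytic (fun t => (f t)^-1).
Proof.
move=> f0 af.
have au := analytic_scale (f 0)^-1 (analytic_subc af).
have u0 : (f 0)^-1 * (f 0 - f 0) = 0 by rewrite subrr mulr0.
have H := analytic_comp (@analytic_inv1p R) au u0.
apply: (analytic_ext ltr01 _ (analytic_scale (f 0)^-1 H)) => t _ /=.
by rewrite -invfM mulrDr mulr1 mulVKf // addrC subrK.
Qed.

Lemma analytic_ln f : 0 < f 0 -> analytic f -> analytic (fun t => ln (f t)).
Proof.
move=> f0 af.
have au := analytic_scale (f 0)^-1 (analytic_subc af).
have u0 : (f 0)^-1 * (f 0 - f 0) = 0 by rewrite subrr mulr0.
have H := analytic_add (analytic_cst (ln (f 0))) (analytic_comp (@analytic_ln1p R) au u0).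
have [r [K [r0 K0 fb]]] := analytic_lip af.
have r'0 : 0 < Num.min r (f 0 / (K + 1)).
  by rewrite lt_min r0 divr_gt0 // ltr_wpDl.
apply: (analytic_ext r'0 _ H) => t; rewrite lt_min => /andP[tr tf] /=.
have ft : 0 < f t.
  have : `|f t - f 0| < f 0.
    apply: le_lt_trans (fb t tr) _; move: tf; rewrite ltr_pdivlMr ?ltr_wpDl // => tf.
    by apply: le_lt_trans tf; rewrite mulrC ler_wpM2l // lerDl.
  by rewrite ltr_norml => /andP[+ _]; rewrite ltrBrDr addrC subrr.
have E : f 0 * (1 + (f 0)^-1 * (f t - f 0)) = f t by field; rewrite gt_eqF.
have u1 : 0 < 1 + (f 0)^-1 * (f t - f 0) by rewrite -(pmulr_rgt0 _ f0) E.
by rewrite -lnM ?posrE // E.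
Qed.

End AnalyticMore.

(** * Asymptotic expansions of logarithms *)

Section Expansions.
Variable R : realType.
Local Notation fn := (R -> R).
Implicit Types (e f g psi D : fn) (p q : {poly R}) (A k kappa theta : R).

Lemma ev_inv (r : R) : 0 < r -> ev (fun x => 0 < x /\ `|x^-1| < r).
Proof.
move=> r0; apply: ev2 (ev_gt 0) (ev_gt r^-1) _ => x x0 xr; split=> //.
by rewrite ger0_norm ?invr_ge0 ?ltW // -[ltRHS]invrK ltf_pV2 ?posrE ?invr_gt0.
Qed.

Lemma poly_lt_exp (mu C : R) N : 0 < mu -> ev (fun x => C * x ^+ N <= expR (mu * x)).
Proof.
move=> mu0; apply: ev2 (ev_gt 0) (ev_gt (C * (N.+1)`!%:R / mu ^+ N.+1)) _ => x x0 xC.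
have mx : 0 <= mu * x by rewrite mulr_ge0 // ltW.
have f0 : 0 < (N.+1)`!%:R :> R by rewrite ltr0n fact_gt0.
apply: le_trans (expR_ge1Dxn N mx); rewrite addrC; apply: ler_wpDr => //.
rewrite ler_pdivlMr // exprMn.
have H : C * (N.+1)`!%:R <= x * mu ^+ N.+1 by rewrite -ler_pdivrMr ?exprn_gt0 // ltW.
have := ler_wpM2r (exprn_ge0 N (ltW x0)) H.
rewrite (_ : C * x ^+ N * _ = C * (N.+1)`!%:R * x ^+ N); last by ring.
by rewrite (_ : mu ^+ N.+1 * x ^+ N.+1 = x * mu ^+ N.+1 * x ^+ N) // [x ^+ N.+1]exprS; ring.
Qed.

Lemma ln_small (eps : R) : 0 < eps -> ev (fun x => ln x <= eps * x).
Proof.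
move=> e0; pose d := eps / 2; have d0 : 0 < d by rewrite divr_gt0.
apply: ev2 (ev_gt 0) (ev_gt (- ln d / d)) _ => x x0; rewrite ltr_pdivrMr // => xd.
have := ln_sublinear (mulr_gt0 d0 x0); rewrite lnM ?posrE // => H.
by have -> : eps * x = d * x + x * d; [rewrite /d; field|lra].
Qed.

Lemma ln_large (B : R) : ev (fun x => B <= ln x).
Proof.
apply: ev1 (ev_gt (expR B)) _ => x xB.
by rewrite -ler_expR lnK ?ltW // posrE (lt_trans (expR_gt0 B)).
Qed.

(** Convergent Laurent series in [1 / x] with finitely many positive powers of [x]. *)
Definition laurent e : Prop := exists N a,
  analytic a /\ ev (fun x => e x = x ^+ N * a x^-1).

Lemma laurent_ext e e' : ev (fun x => e x = e' x) -> laurent e -> laurent e'.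
Proof.
by move=> E [N [a [aa H]]]; exists N, a; split=> //; apply: ev2 E H _ => x <-.
Qed.

Lemma laurent_analytic (a : fn) : analytic a -> laurent (fun x => a x^-1).
Proof. by move=> aa; exists 0%N, a; split=> //; apply: evT => x; rewrite expr0 mul1r. Qed.

Lemma laurent_cst c : laurent (fun=> c).
Proof. exact: laurent_analytic (analytic_cst c). Qed.

Lemma laurent_xn (k : nat) : laurent (fun x => x ^+ k).
Proof.
exists k, (fun=> 1); split; first exact: analytic_cst.
by apply: evT => x; rewrite mulr1.
Qed.

Lemma laurent_add e e' : laurent e -> laurent e' -> laurent (e \+ e').
Proof.
move=> [N [a [aa E]]] [M [b [ab E']]].
exists (N + M)%N, (((fun t => t ^+ M) \* a) \+ ((fun t => t ^+ N) \* b)); split.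
  by apply: analytic_add; apply: analytic_mul => //; apply: analytic_pow.
apply: ev3 E E' (ev_gt 0) _ => x /= -> -> x0; have xN := lt0r_neq0 x0.
by rewrite exprD !exprVn; field; rewrite !expf_neq0.
Qed.

Lemma laurent_mul e e' : laurent e -> laurent e' -> laurent (e \* e').
Proof.
move=> [N [a [aa E]]] [M [b [ab E']]]; exists (N + M)%N, (a \* b).
split; first exact: analytic_mul.
by apply: ev2 E E' _ => x /= -> ->; rewrite exprD mulrACA.
Qed.

Lemma laurent_upper e : laurent e -> exists C N, 0 <= C /\ ev (fun x => `|e x| <= C * x ^+ N).
Proof.
move=> [N [a [aa E]]]; have [r [K [r0 K0 ab]]] := analytic_bnd aa.
exists K, N; split=> //; apply: ev2 E (ev_inv r0) _ => x -> [x0 xr].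
have xN := exprn_ge0 N (ltW x0).
by rewrite normrM (ger0_norm xN) mulrC ler_wpM2r ?ab.
Qed.

Definition experr (A : R) psi : Prop := exists C, ev (fun x => `|psi x| <= C * expR (- A * x)).

(* Exponentially small sums [sum exp (kappa x) e(x)], up to [O(exp (- A x))]. *)
Inductive esmall (A : R) : fn -> Prop :=
| esmall_err psi : experr A psi -> esmall A psi
| esmall_cons kappa e psi psi' : kappa < 0 -> laurent e -> esmall A psi' ->
    ev (fun x => psi x = expR (kappa * x) * e x + psi' x) -> esmall A psi.

Lemma experr_ext A psi psi' : ev (fun x => psi x = psi' x) -> experr A psi -> experr A psi'.
Proof. by move=> E [C H]; exists C; apply: ev2 E H _ => x <-. Qed.

Lemma esmall_ext A psi psi' : ev (fun x => psi x = psi' x) -> esmall A psi -> esmall A psi'.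
Proof.
move=> E H; case: H E => [phi H|kappa e phi phi' k0 le H E'] E.
  by apply: esmall_err; apply: experr_ext E H.
by apply: (esmall_cons k0 le H); apply: ev2 E E' _ => x <-.
Qed.

Lemma experr0 A : experr A (fun=> 0).
Proof. by exists 0; apply: evT => x; rewrite normr0 mul0r. Qed.

Lemma experr_add A psi psi' : experr A psi -> experr A psi' -> experr A (psi \+ psi').
Proof.
move=> [C H] [C' H']; exists (C + C'); apply: ev2 H H' _ => x H H' /=.
by apply: le_trans (ler_normD _ _) _; rewrite mulrDl lerD.
Qed.

Lemma experr_bmul A psi e M : ev (fun x => `|e x| <= M) -> experr A psi -> experr A (e \* psi).
Proof.
move=> He [C H]; exists (M * C); apply: ev2 He H _ => x He H /=.
by rewrite normrM -mulrA; apply: ler_pM.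
Qed.

Lemma esmall0 A : esmall A (fun=> 0).
Proof. exact/esmall_err/experr0. Qed.

Lemma esmall_add A psi psi' : esmall A psi -> esmall A psi' -> esmall A (psi \+ psi').
Proof.
move=> H H'; elim: H => [phi H|kappa e phi phi' k0 le _ IH E]; last first.
  apply: (esmall_cons k0 le IH); apply: ev1 E _ => x /= ->; by rewrite addrA.
elim: H' => [phi' H'|kappa e phi' phi'' k0 le _ IH E].
  exact/esmall_err/experr_add.
by apply: (esmall_cons k0 le IH); apply: ev1 E _ => x /= ->; rewrite addrCA.
Qed.

Lemma esmall_bmul A psi e M : laurent e -> ev (fun x => `|e x| <= M) ->
  esmall A psi -> esmall A (e \* psi).
Proof.
move=> le be; elim=> [phi H|kappa e' phi phi' k0 le' _ IH E].
  exact/esmall_err/(experr_bmul be).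
apply: (esmall_cons k0 (laurent_mul le le') IH).
by apply: ev1 E _ => x /= ->; ring.
Qed.

Lemma exp_laurent_decay kappa e : kappa < 0 -> laurent e ->
  ev (fun x => `|expR (kappa * x) * e x| <= expR (kappa / 2 * x)).
Proof.
move=> k0 /laurent_upper [C [N [C0 H]]].
have mu0 : 0 < - kappa / 2 by rewrite divr_gt0 ?oppr_gt0.
apply: ev2 H (poly_lt_exp C N mu0) _ => x H H'.
rewrite normrM ger0_norm ?expR_ge0 //.
apply: le_trans (ler_wpM2l (expR_ge0 _) (le_trans H H')) _.
by rewrite -expRD ler_expR; lra.
Qed.

Lemma esmall_decay A psi : 0 < A -> esmall A psi ->
  exists2 theta, 0 < theta & ev (fun x => `|psi x| <= expR (- theta * x)).
Proof.
move=> A0; elim=> [phi [C H]|kappa e phi phi' k0 le _ [theta t0 IH] E].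
  exists (A / 2); first by rewrite divr_gt0.
  have A2 : 0 < A / 2 by rewrite divr_gt0.
  apply: ev2 H (poly_lt_exp C 0 A2) _ => x H; rewrite expr0 mulr1 => H'.
  apply: le_trans H (le_trans (ler_wpM2r (expR_ge0 _) H') _).
  by rewrite -expRD ler_expR; lra.
pose mu := Num.min theta (- kappa / 2).
have mu0 : 0 < mu by rewrite lt_min t0 divr_gt0 ?oppr_gt0.
exists (mu / 2); first by rewrite divr_gt0.
have mu2 : 0 < mu / 2 by rewrite divr_gt0.
apply: ev4 IH E (exp_laurent_decay k0 le) (ev_and (ev_gt 0) (poly_lt_exp 2 0 mu2)) _.
move=> x IHx -> H [x0]; rewrite expr0 mulr1 => H2.
apply: le_trans (ler_normD _ _) _.
have e1 : expR (kappa / 2 * x) <= expR (- mu * x).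
  by rewrite ler_expR ler_pM2r // lerNr -mulNr ge_min lexx orbT.
have e2 : expR (- theta * x) <= expR (- mu * x).
  by rewrite ler_expR ler_pM2r // lerN2 ge_min lexx.
apply: le_trans (lerD (le_trans H e1) (le_trans IHx e2)) _.
rewrite (_ : expR (- mu * x) + _ = 2 * expR (- mu * x)); last by rewrite mulr_natl mulr2n.
apply: le_trans (ler_wpM2r (expR_ge0 _) H2) _.
by rewrite -expRD ler_expR; lra.
Qed.

Lemma esmall_bnd A psi : 0 < A -> esmall A psi -> ev (fun x => `|psi x| <= 1).
Proof.
move=> A0 /(esmall_decay A0)[theta t0 H]; apply: ev2 H (ev_gt 0) _ => x H x0.
by apply: le_trans H _; rewrite -expR0 ler_expR mulNr oppr_le0 mulr_ge0 // ltW.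
Qed.

Lemma esmall_mul A psi psi' : 0 < A -> esmall A psi -> esmall A psi' ->
  esmall A (psi \* psi').
Proof.
move=> A0 H H'; elim: H => [phi H|kappa e phi phi' k0 le _ IH E].
  apply: esmall_err; apply: experr_ext (experr_bmul (esmall_bnd A0 H') H).
  by apply: evT => x /=; rewrite mulrC.
suff H1 : esmall A ((fun x => expR (kappa * x) * e x) \* psi').
  apply: esmall_ext (esmall_add H1 IH).
  by apply: ev1 E _ => x /= ->; ring.
elim: H' {IH} => [phi1 H1|kappa' e' phi1 phi2 k0' le' _ IH E'].
  apply: esmall_err; apply: (@experr_bmul _ _ _ 1) H1.
  apply: ev2 (exp_laurent_decay k0 le) (ev_gt 0) _ => x H x0; apply: le_trans H _.
  by rewrite -[leRHS]expR0 ler_expR; apply: mulr_le0_ge0; [lra|apply: ltW].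
apply: (@esmall_cons _ (kappa + kappa') (e \* e') _ _ _ (laurent_mul le le') IH).
  by lra.
by apply: ev1 E' _ => x /= ->; rewrite mulrDl expRD; ring.
Qed.

Lemma esmall_scale A (c : R) psi : esmall A psi -> esmall A (fun x => c * psi x).
Proof.
by apply: (@esmall_bmul _ _ _ `|c|); [apply: laurent_cst|apply: evT => x].
Qed.

Lemma esmall_comp A f psi : 0 < A -> analytic f -> f 0 = 0 -> esmall A psi ->
  esmall A (f \o psi).
Proof.
move=> A0 [F [r [K [B [[r0 K0 B0] fE Fs Fb]]]]] f0 Hpsi.
have [theta t0 Hd] := esmall_decay A0 Hpsi.
(* From the order [n >= A / theta] on, powers of [psi] fall into the error [O(exp (- A x))], so a
   Taylor polynomial suffices. *)
have [n Hn] := nat_gt_ex (A / theta).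
have F00 : F 0%N 0 = 0 by rewrite -fE ?normr0.
have small : ev (fun x => `|psi x| < r).
  have [C HC] : exists C, 0 < C /\ expR (- C) < r.
    exists (`|ln r| + 1); split; first by rewrite ltr_wpDl.
    rewrite -[ltRHS]lnK ?posrE // ltr_expR ltrNl.
    by apply: le_lt_trans (_ : `|ln r| < _); [rewrite -normrN ler_norm|rewrite ltrDl].
  apply: ev2 Hd (ev_gt (C / theta)) _ => x H xC; apply: le_lt_trans H (lt_trans _ HC.2).
  by rewrite ltr_expR mulNr ltrN2 mulrC -ltr_pdivrMr.
have poly m : esmall A (fun x => \sum_(i < m) F i 0 * psi x ^+ i).
  elim: m => [|m IH].
    by apply: esmall_ext (esmall0 A); apply: evT => x; rewrite big_ord0.
  suff Hm : esmall A (fun x => F m 0 * psi x ^+ m).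
    by apply: esmall_ext (esmall_add IH Hm); apply: evT => x; rewrite big_ord_recr.
  case: m {IH} => [|m].
    by apply: esmall_ext (esmall0 A); apply: evT => x; rewrite F00 mul0r.
  apply: esmall_scale; elim: m => [|m IH].
    by apply: esmall_ext Hpsi; apply: evT => x; rewrite expr1.
  apply: esmall_ext (esmall_mul A0 Hpsi IH).
  by apply: evT => x /=; rewrite [in RHS]exprS.
have rest : experr A (fun x => psi x ^+ n * F n (psi x)).
  exists (K * B ^+ n); apply: ev3 Hd small (ev_gt 0) _ => x H sx x0.
  rewrite normrM mulrC; apply: ler_pM => //; first exact: Fb.
  rewrite normrX; apply: le_trans (lerXn2r n _ _ H) _; rewrite ?nnegrE ?expR_ge0 //.
  rewrite -expRM_natl ler_expR mulrA ler_pM2r // mulrN lerN2 -ler_pdivrMr //.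
apply: esmall_ext (esmall_add (poly n) (esmall_err rest)).
by apply: ev1 small _ => x sx /=; rewrite fE // [RHS](shifts_expand n Fs sx).
Qed.

(* Expansions of logarithms: the part with [kappa = 0] may contain [m * ln x]
   with [m] an integer, and [exp] of it stays a Laurent series. *)
Inductive logexp (A : R) : fn -> Prop :=
| logexp_err D : experr A D -> logexp A D
| logexp_cons kappa p e D D' : (kappa < 0 -> p = 0) -> p`_0 \is a Num.int ->
    laurent e -> logexp A D' ->
    ev (fun x => D x = expR (kappa * x) * (ln x * p.[x] + e x) + D' x) -> logexp A D.

Lemma logexp_ext A D D' : ev (fun x => D x = D' x) -> logexp A D -> logexp A D'.
Proof.
move=> E H; case: H E => [phi H|kappa p e phi phi' k0 pi le H E'] E.
  by apply: logexp_err; apply: experr_ext E H.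
by apply: (logexp_cons k0 pi le H); apply: ev2 E E' _ => x <-.
Qed.

Lemma logexp_add A D D' : logexp A D -> logexp A D' -> logexp A (D \+ D').
Proof.
move=> H H'; elim: H => [phi H|kappa p e phi phi' k0 pi le _ IH E]; last first.
  apply: (logexp_cons k0 pi le IH); apply: ev1 E _ => x /= ->; by rewrite addrA.
elim: H' => [phi' H'|kappa p e phi' phi'' k0 pi le _ IH E].
  exact/logexp_err/experr_add.
by apply: (logexp_cons k0 pi le IH); apply: ev1 E _ => x /= ->; rewrite addrCA.
Qed.

Lemma logexp_opp A D : logexp A D -> logexp A (fun x => - D x).
Proof.
elim=> [phi [C H]|kappa p e phi phi' k0 pi le _ IH E].
  by apply: logexp_err; exists C; apply: ev1 H _ => x; rewrite normrN.
apply: (@logexp_cons _ kappa (- p) (fun x => (-1) * e x) _ _ _ _ _ IH).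
- by move=> /k0 ->; rewrite oppr0.
- by rewrite coefN rpredN.
- exact: laurent_mul (laurent_cst _) le.
- by apply: ev1 E _ => x ->; rewrite hornerN; ring.
Qed.

(** Multiplying by [exp (k x)] shifts the exponents and costs [k] in precision; for this reason
    expansions are established for all [A] at once. *)
Lemma logexp_expmul A k D : 0 <= k -> logexp (A + k) D ->
  logexp A (fun x => expR (k * x) * D x).
Proof.
move=> k0; elim=> [phi [C H]|kappa p e phi phi' kp pi le _ IH E].
  apply: logexp_err; exists C; apply: ev1 H _ => x H.
  rewrite normrM ger0_norm ?expR_ge0 // mulrC; apply: le_trans (ler_wpM2r _ H) _.
    exact: expR_ge0.
  by rewrite -mulrA -expRD (_ : - (A + k) * x + k * x = - A * x); last by ring.
apply: (@logexp_cons _ (kappa + k) p e _ _ _ pi le IH).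
  by move=> H; apply: kp; lra.
by apply: ev1 E _ => x ->; rewrite mulrDl expRD; ring.
Qed.

Lemma logexp_xmul A D : logexp (A + 1) D -> logexp A (fun x => x * D x).
Proof.
elim=> [phi [C H]|kappa p e phi phi' kp pi le _ IH E].
  apply: logexp_err; exists C; apply: ev2 H (ev_gt 0) _ => x H x0.
  rewrite normrM gtr0_norm // mulrC; apply: le_trans (ler_wpM2r (ltW x0) H) _.
  have C0 : 0 <= C.
    by have := le_trans (normr_ge0 _) H; rewrite pmulr_lge0 ?expR_gt0.
  rewrite -mulrA ler_wpM2l //.
  apply: le_trans (_ : _ <= expR (- (A + 1) * x) * expR x) _.
    rewrite ler_wpM2l ?expR_ge0 //; apply: le_trans (expR_ge1Dx x); lra.
  by rewrite -expRD ler_expR; lra.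
apply: (@logexp_cons _ kappa (p * 'X) (fun x => x * e x) _ _ _ _ _ IH).
- by move=> /kp ->; rewrite mul0r.
- by rewrite coefMX eqxx rpred0.
- apply: laurent_mul le; apply: laurent_ext (laurent_xn 1).
  by apply: evT => x; rewrite expr1.
- by apply: ev1 E _ => x ->; rewrite hornerMX; ring.
Qed.

Lemma esmall_logexp A psi : esmall A psi -> logexp A psi.
Proof.
elim=> [phi H|kappa e phi phi' k0 le _ IH E]; first exact: logexp_err.
apply: (@logexp_cons _ kappa 0 e _ _ _ _ le IH) => //; first by rewrite coef0 rpred0.
by apply: ev1 E _ => x ->; rewrite horner0 mulr0 add0r.
Qed.

Lemma logexp_lnpoly A (m : R) e : m \is a Num.int -> laurent e ->
  logexp A (fun x => m * ln x + e x).
Proof.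
move=> mi le; apply: (@logexp_cons _ 0 m%:P e _ (fun=> 0)) => //.
- by rewrite ltxx.
- by rewrite coefC.
- exact/logexp_err/experr0.
- by apply: evT => x; rewrite mul0r expR0 hornerC mul1r addr0 mulrC.
Qed.

(** * Leading terms of [ln x * p(x) + x ^ d * g(x)] *)

Lemma poly_upper (q : {poly R}) n : (size q <= n.+1)%N ->
  exists2 C, 0 <= C & forall x, 1 <= x -> `|q.[x]| <= C * x ^+ n.
Proof.
move=> sq; exists (\sum_(i < n.+1) `|q`_i|); first by apply: sumr_ge0.
move=> x x1; rewrite (horner_coef_wide x sq); apply: le_trans (ler_norm_sum _ _ _) _.
rewrite mulr_suml; apply: ler_sum => i _; rewrite normrM ler_wpM2l //.
by rewrite ger0_norm ?exprn_ge0 ?(le_trans _ x1) // ler_weXn2l // -ltnS.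
Qed.

Lemma poly_lead (q : {poly R}) n : (size q <= n.+1)%N ->
  exists2 C, 0 <= C & forall x, 1 <= x -> `|q.[x] - q`_n * x ^+ n| <= C * (x ^+ n / x).
Proof.
move=> sq; exists (\sum_(i < n) `|q`_i|); first by apply: sumr_ge0.
move=> x x1; have x0 : 0 < x by apply: lt_le_trans x1.
rewrite (horner_coef_wide x sq) big_ord_recr /= addrK.
apply: le_trans (ler_norm_sum _ _ _) _.
rewrite mulr_suml; apply: ler_sum => i _; rewrite normrM ler_wpM2l //.
rewrite ger0_norm ?exprn_ge0 ?(ltW x0) // ler_pdivlMr // -exprSr ler_weXn2l //.
Qed.

Lemma lead_lnpoly_pos (p : {poly R}) d g (c C : R) : (size p <= d.+1)%N -> 0 < p`_d ->
  ev (fun x => `|g x - c| <= C / x) ->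
  forall B, ev (fun x => B * x ^+ d <= ln x * p.[x] + x ^+ d * g x).
Proof.
move=> sp pd Hg B; have [C' C'0 Hp] := poly_lead sp.
have b0 : 0 < p`_d / 2 by rewrite divr_gt0.
apply: ev4 Hg (ev_ge (Num.max 1 (C' / (p`_d / 2)))) (ev_ge `|C|)
  (ln_large (Num.max 1 ((`|B| + `|c| + 1) / (p`_d / 2)))) _.
move=> x Hg; rewrite ge_max => /andP[x1 xC'] xC; rewrite ge_max => /andP[l1 lB].
have x0 : 0 < x by apply: lt_le_trans x1.
have xd : 0 < x ^+ d by rewrite exprn_gt0.
have l0 : 0 <= ln x by apply: le_trans l1.
have {}Hp : p`_d / 2 * x ^+ d <= p.[x].
  have := Hp x x1; rewrite ler_norml => /andP[+ _].
  have : C' * (x ^+ d / x) <= p`_d / 2 * x ^+ d.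
    rewrite mulrA ler_pdivrMr // mulrAC ler_pM2r //.
    by rewrite mulrC -ler_pdivrMr.
  lra.
have Hg' : - (`|c| + 1) <= g x.
  have Cx : C / x <= 1.
    by rewrite ler_pdivrMr // mul1r; apply: le_trans (ler_norm C) xC.
  have := le_trans Hg Cx; rewrite ler_norml => /andP[+ _].
  have := ler_norm (- c); rewrite normrN; lra.
rewrite ler_pdivrMr // in lB.
have H1 : ln x * (p`_d / 2 * x ^+ d) <= ln x * p.[x] by rewrite ler_wpM2l.
have H2 : x ^+ d * - (`|c| + 1) <= x ^+ d * g x by rewrite ler_wpM2l // ltW.
apply: le_trans (lerD H1 H2).
move: (p`_d / 2) lB => b lB.
rewrite (_ : _ + _ = x ^+ d * (ln x * b - (`|c| + 1))); last by ring.
by rewrite mulrC ler_pM2l //; have := ler_norm B; lra.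
Qed.

Lemma lead_lnpoly_small (p : {poly R}) d g (c C : R) : (size p <= d.+1)%N -> p`_d = 0 -> 0 < c ->
  ev (fun x => `|g x - c| <= C / x) ->
  ev (fun x => c / 2 * x ^+ d <= ln x * p.[x] + x ^+ d * g x).
Proof.
move=> sp pd c0 Hg; have [C' C'0 Hp] := poly_lead sp.
(* A margin of [c / 4] goes to the logarithmic part and another one to the error of [g], leaving
   [c / 2]. *)
have e0 : 0 < c / 4 / (C' + 1) by rewrite !divr_gt0 // ltr_wpDl.
apply: ev4 Hg (ev_ge 1) (ln_small e0) (ev_ge (`|C| / (c / 4))) _.
move=> x Hg x1 lx xC.
have x0 : 0 < x by apply: lt_le_trans x1.
have xd : 0 < x ^+ d by rewrite exprn_gt0.
have l0 : 0 <= ln x by apply: ln_ge0.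
have C1 : 0 < C' + 1 by rewrite ltr_wpDl.
have {}Hp : - (c / 4 * x ^+ d) <= ln x * p.[x].
  have := Hp x x1; rewrite pd mul0r subr0 => H.
  have : `|ln x * p.[x]| <= c / 4 * x ^+ d.
    rewrite normrM (ger0_norm l0); apply: le_trans (ler_wpM2l l0 H) _.
    have lC : ln x * C' <= c / 4 * x.
      apply: (@le_trans _ _ (ln x * (C' + 1))); first by rewrite ler_wpM2l // lerDl.
      by rewrite -ler_pdivlMr // mulrAC.
    have q0 : 0 <= x ^+ d / x by rewrite divr_ge0 // ltW.
    have := ler_wpM2r q0 lC; rewrite -[leLHS]mulrA => /le_trans; apply.
    by rewrite le_eqVlt; apply/orP; left; apply/eqP; field; rewrite gt_eqF.
  by rewrite ler_norml => /andP[].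
have Hg' : c - c / 4 <= g x.
  have Cx : C / x <= c / 4.
    rewrite ler_pdivrMr // mulrC -ler_pdivrMr ?divr_gt0 //.
    by apply: le_trans xC; rewrite ler_wpM2r ?ler_norm // invr_ge0 ltW // divr_gt0.
  have := le_trans Hg Cx; rewrite ler_norml => /andP[+ _]; lra.
have H2 : x ^+ d * (c - c / 4) <= x ^+ d * g x by rewrite ler_wpM2l // ltW.
apply: le_trans (lerD Hp H2); rewrite [c / 2 * _]mulrC [c / 4 * _]mulrC -mulrN -mulrDr.
by rewrite ler_pM2l //; lra.
Qed.

Lemma lead_lnpoly_inf (p : {poly R}) d g (c C : R) : (size p <= d.+1)%N ->
  ev (fun x => `|g x - c| <= C / x) -> p`_d != 0 ->
  (forall B, ev (fun x => B * x ^+ d <= ln x * p.[x] + x ^+ d * g x)) \/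
  (forall B, ev (fun x => ln x * p.[x] + x ^+ d * g x <= B * x ^+ d)).
Proof.
move=> sp Hg; case: ltgtP => // pd _; last by left; apply: lead_lnpoly_pos Hg.
right=> B.
have Hg' : ev (fun x => `|- g x - (- c)| <= C / x).
  by apply: ev1 Hg _ => x; rewrite -opprD normrN.
have sp' : (size (- p) <= d.+1)%N by rewrite size_polyN.
have pd' : 0 < (- p)`_d by rewrite coefN oppr_gt0.
apply: ev1 (lead_lnpoly_pos sp' pd' Hg' (- B)) _ => x.
by rewrite hornerN !mulrN -opprD mulNr lerN2.
Qed.

Lemma lead_lnpoly (p : {poly R}) d g (c C : R) : (size p <= d.+1)%N ->
  ev (fun x => `|g x - c| <= C / x) -> (p`_d != 0) || (c != 0) ->
  exists2 b, 0 < b & (ev (fun x => b * x ^+ d <= ln x * p.[x] + x ^+ d * g x) \/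
    ev (fun x => ln x * p.[x] + x ^+ d * g x <= - (b * x ^+ d))).
Proof.
move=> sp Hg.
have Hg' : ev (fun x => `|- g x - (- c)| <= C / x).
  by apply: ev1 Hg _ => x; rewrite -opprD normrN.
have sp' : (size (- p) <= d.+1)%N by rewrite size_polyN.
have neg b : ev (fun x => b * x ^+ d <= ln x * (- p).[x] + x ^+ d * (- g x)) ->
    ev (fun x => ln x * p.[x] + x ^+ d * g x <= - (b * x ^+ d)).
  by move=> H; apply: ev1 H _ => x; rewrite hornerN !mulrN -opprD lerNr.
have [pd /= c0|pd _] := eqVneq p`_d 0; last first.
  exists 1 => //; case: (lead_lnpoly_inf sp Hg pd) => H; [left; exact: H|right].
  by apply: ev1 (H (-1)) _ => x; rewrite mulNr.
have {c0} [c0|c0] : 0 < c \/ c < 0.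
  by have [?|?|ce] := ltgtP c 0; [right|left|rewrite ce eqxx in c0].
  by exists (c / 2); [rewrite divr_gt0|left; apply: lead_lnpoly_small Hg].
exists (- c / 2); first by rewrite divr_gt0 ?oppr_gt0.
right; apply: neg; apply: lead_lnpoly_small Hg' => //; last by rewrite oppr_gt0.
by rewrite coefN pd oppr0.
Qed.

Definition lnlaurent (delta : fn) : Prop := exists p e,
  laurent e /\ ev (fun x => delta x = ln x * p.[x] + e x).

Lemma lnlaurent_add d d' : lnlaurent d -> lnlaurent d' -> lnlaurent (d \+ d').
Proof.
move=> [p [e [le E]]] [p' [e' [le' E']]]; exists (p + p'), (e \+ e').
split; first exact: laurent_add.
by apply: ev2 E E' _ => x /= -> ->; rewrite hornerD; ring.
Qed.

Lemma lnlaurent0 : lnlaurent (fun=> 0).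
Proof.
exists 0, (fun=> 0); split; first exact: laurent_cst.
by apply: evT => x; rewrite horner0 mulr0 addr0.
Qed.

Lemma lnlaurent_upper d : lnlaurent d ->
  exists C N, 0 <= C /\ ev (fun x => `|d x| <= C * x ^+ N).
Proof.
move=> [p [e [/laurent_upper[C [N [C0 HC]]] E]]].
have [C' C'0 Hp] := poly_upper (leqnSn (size p)).
exists (C' + C), ((size p).+1 + N)%N; split; first exact: addr_ge0.
apply: ev3 HC E (ev_ge 1) _ => x HC -> x1.
have x0 : 0 < x by apply: lt_le_trans x1.
apply: le_trans (ler_normD _ _) _; rewrite mulrDl; apply: lerD.
  rewrite normrM (ger0_norm (ln_ge0 x1)).
  apply: le_trans (ler_pM _ _ (ltW (ln_sublinear x0)) (Hp x x1)) _ => //.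
    exact: ln_ge0.
  rewrite mulrCA -exprS ler_wpM2l // ler_weXn2l //; exact: leq_addr.
apply: le_trans HC _; rewrite ler_wpM2l // ler_weXn2l //; exact: leq_addl.
Qed.

(** A nonzero Laurent part is [x ^ N / x ^ k] times a function with nonzero limit. After
    multiplication by [x ^ k] the higher of the degrees of [p * 'X^k] and of [x ^ N] leads, the
    logarithm deciding a tie. *)
Lemma lnlaurent_dich d : lnlaurent d -> ev (fun x => d x = 0) \/
  exists c N, 0 < c /\ (ev (fun x => c / x ^+ N <= d x) \/
    ev (fun x => d x <= - (c / x ^+ N))).
Proof.
move=> [p [e [[N [a [aa Ea]]] E]]].
set concl := (X in _ \/ X).
have fin (k : nat) (P : {poly R}) M g (c C : R) : (size P <= M.+1)%N ->
    ev (fun x => `|g x - c| <= C / x) -> (P`_M != 0) || (c != 0) ->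
    ev (fun x => x ^+ k * d x = ln x * P.[x] + x ^+ M * g x) -> concl.
  move=> sP Hg nz Ed; have [b b0 Hb] := lead_lnpoly sP Hg nz; exists b, k; split=> //.
  case: Hb => Hb; [left|right]; apply: ev3 Hb Ed (ev_ge 1) _ => x Hb Edx x1.
    have x0 : 0 < x by apply: lt_le_trans x1.
    rewrite ler_pdivrMr ?exprn_gt0 // mulrC Edx; apply: le_trans Hb.
    by rewrite ler_peMr ?exprn_ege1 // ltW.
  have x0 : 0 < x by apply: lt_le_trans x1.
  rewrite lerNr ler_pdivrMr ?exprn_gt0 // mulNr mulrC Edx lerNr; apply: le_trans Hb _.
  by rewrite lerN2 ler_peMr ?exprn_ege1 // ltW.
have [[r r0 a0]|[k [a0 [K [r [aN0 r0 K0 Ha]]]]]] := analytic_dich aa.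
  have e0 : ev (fun x => e x = 0).
    by apply: ev2 Ea (ev_inv r0) _ => x -> [_ xr]; rewrite a0 ?mulr0.
  have [p0|p0] := eqVneq p 0.
    by left; apply: ev2 E e0 _ => x -> ->; rewrite p0 horner0 mulr0 addr0.
  right; apply: (@fin 0%N p (size p).-1 (fun=> 0) 0 0).
  - by rewrite prednK // size_poly_gt0.
  - by apply: evT => x; rewrite subrr normr0 mul0r.
  - by rewrite -lead_coefE lead_coef_eq0 p0.
  - by apply: ev2 E e0 _ => x -> ->; rewrite expr0 mul1r mulr0.
right; pose g x := x ^+ k * a x^-1; pose P := p * 'X^k.
have Hg : ev (fun x => `|g x - a0| <= K / x).
  apply: ev1 (ev_inv r0) _ => x [x0 xr]; rewrite /g; have [h -> hK] := Ha _ xr.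
  rewrite exprVn mulVKf ?expf_neq0 ?gt_eqF // addrC addKr normrM mulrC.
  have xi : 0 <= x^-1 by rewrite invr_ge0 ltW.
  by rewrite (ger0_norm xi) ler_wpM2r.
have Ed : ev (fun x => x ^+ k * d x = ln x * P.[x] + x ^+ N * g x).
  apply: ev2 E Ea _ => x -> ->; rewrite /P /g hornerM hornerXn; ring.
have [sP|sP] := leqP (size P) N.+1.
  by apply: (fin k P N g a0 K) => //; rewrite aN0 orbT.
pose M := (size P).-1; have NM : (N < M)%N by rewrite /M; lia.
apply: (@fin k P M (fun x => x ^+ N * g x / x ^+ M) 0 (`|a0| + K)) => //.
- by rewrite /M; lia.
- apply: ev2 Hg (ev_ge 1) _ => x Hg x1; have x0 : 0 < x by apply: lt_le_trans x1.
  rewrite subr0 normrM [X in _ * X]ger0_norm ?invr_ge0 ?exprn_ge0 ?(ltW x0) //.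
  rewrite ler_pdivrMr ?exprn_gt0 // -(subnK NM) addnS exprS exprD -!mulrA mulKf ?gt_eqF //.
  rewrite normrM [X in X * _]ger0_norm ?exprn_ge0 ?(ltW x0) // mulrA [_ * x ^+ N]mulrC.
  rewrite ler_pM2l ?exprn_gt0 //.
  apply: (@le_trans _ _ (`|a0| + K)).
    rewrite -[g x](subrK a0) addrC; apply: le_trans (ler_normD _ _) _.
    rewrite lerD2l; apply: le_trans Hg _; rewrite ler_pdivrMr // ler_peMr //.
  by rewrite ler_peMr ?addr_ge0 // exprn_ege1.
- by rewrite -lead_coefE lead_coef_eq0 -size_poly_gt0; apply/orP; left; lia.
- apply: ev2 Ed (ev_gt 0) _ => x -> x0; congr (_ + _).
  by rewrite [RHS]mulrC divfK // expf_neq0 ?gt_eqF.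
Qed.

(** Exponents may be repeated and their coefficients may cancel; the list is not in normal form. *)
Definition expsum (s : seq (R * fn)) : fn :=
  fun x => \sum_(kd <- s) expR (kd.1 * x) * kd.2 x.

Definition lnlaurents (s : seq (R * fn)) : Prop :=
  forall kd, List.In kd s -> lnlaurent kd.2.

Lemma expsum_upper s kappa : lnlaurents s ->
  (forall kd, List.In kd s -> kd.1 < kappa) ->
  exists2 k, k < kappa & exists C, ev (fun x => `|expsum s x| <= C * expR (k * x)).
Proof.
elim: s => [|[k0 d] s IH] ls lk.
  exists (kappa - 1); first by rewrite ltrBlDr ltrDl.
  by exists 0; apply: evT => x; rewrite /expsum big_nil normr0 mul0r.
have [kd H|kd H|k kk [C HC]] := IH; [by apply: ls; right|by apply: lk; right|].
have k0k : k0 < kappa by apply: (lk (k0, d)); left.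
have [C' [N [C'0 Hd]]] := lnlaurent_upper (ls (k0, d) (or_introl erefl)).
have mu0 : 0 < (kappa - k0) / 2 by rewrite divr_gt0 // subr_gt0.
exists (Num.max k ((kappa + k0) / 2)); first by rewrite gt_max kk; lra.
exists (1 + `|C|); apply: ev4 Hd HC (poly_lt_exp C' N mu0) (ev_gt 0) _.
move=> x /= Hd' HC' Hp x0; rewrite /expsum big_cons /= -/(expsum s x).
apply: le_trans (ler_normD _ _) _; rewrite mulrDl mul1r; apply: lerD.
  rewrite normrM ger0_norm ?expR_ge0 //.
  apply: le_trans (ler_wpM2l (expR_ge0 _) (le_trans Hd' Hp)) _.
  rewrite -expRD ler_expR (_ : _ + _ = (kappa + k0) / 2 * x); last by field.
  by rewrite ler_pM2r // le_max lexx orbT.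
apply: le_trans HC' _; apply: le_trans (ler_wpM2r (expR_ge0 _) (ler_norm C)) _.
by rewrite ler_wpM2l // ler_expR ler_pM2r // le_max lexx.
Qed.

Lemma expsum_filter s kappa x : expsum s x =
  expR (kappa * x) * (\sum_(kd <- [seq kd <- s | kd.1 == kappa]) kd.2 x) +
  expsum [seq kd <- s | kd.1 != kappa] x.
Proof.
elim: s => [|[k d] s IH]; first by rewrite /expsum !big_nil mulr0 addr0.
rewrite /expsum big_cons /= -/(expsum s x) IH.
by case: eqP => [->|_] /=; rewrite big_cons /=; [rewrite mulrDr addrA|rewrite addrCA].
Qed.

Lemma max_key (s : seq (R * fn)) kd : exists2 km, List.In km (kd :: s) &
  forall kd', List.In kd' (kd :: s) -> kd'.1 <= km.1.
Proof.
elim: s kd => [|a s IH] kd; first by exists kd; [left|move=> kd' [<-|[]]].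
have [km kmin kmax] := IH a; have [le|lt] := leP kd.1 km.1.
  by exists km; [right|move=> kd' [<-//|/kmax]].
exists kd; first by left.
by move=> kd' [<-//|/kmax H]; apply: le_trans H (ltW lt).
Qed.

(** Collect the coefficients of the largest exponent. If they cancel, a shorter list remains;
    otherwise their sum is at least an inverse power of [x] in size, and the largest exponential
    outweighs the rest. *)
Lemma expsum_dich s : lnlaurents s -> (forall kd, List.In kd s -> 0 < kd.1) ->
  ev (fun x => expsum s x = 0) \/ exists2 theta, 0 < theta &
    (ev (fun x => expR (theta * x) <= expsum s x) \/
     ev (fun x => expsum s x <= - expR (theta * x))).
Proof.
have [n] := ubnP (size s); elim: n s => // n IH [|kd s] /=.
  by move=> _ _ _; left; apply: evT => x; rewrite /expsum big_nil.
rewrite ltnS => sn ls lk; have [km kmin kmax] := max_key s kd.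
set S := kd :: s in kmin kmax ls lk *; set kappa := km.1 in kmax *.
have k0 : 0 < kappa by apply: lk.
have inF (P : pred (R * fn)) kd' : List.In kd' [seq z <- S | P z] -> List.In kd' S /\ P kd'.
  elim: (S) => //= a t IHt; case: ifP => [Pa [<-|/IHt[? ?]]|_ /IHt[? ?]]; by auto.
pose delta x := \sum_(kd <- [seq kd <- S | kd.1 == kappa]) kd.2 x.
pose rest := [seq kd <- S | kd.1 != kappa].
have ldelta : lnlaurent delta.
  rewrite /delta; have: lnlaurents [seq kd <- S | kd.1 == kappa].
    by move=> kd' /inF[/ls].
  elim: [seq _ <- _ | _] => [_|a t IHt lt].
    have [p [e [le E]]] := lnlaurent0; exists p, e; split=> //.
    by apply: ev1 E _ => x; rewrite big_nil.
  have [|p [e [le E]]] := lnlaurent_add (lt a (or_introl erefl)) (IHt _).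
    by move=> ? H; apply: lt; right.
  by exists p, e; split=> //; apply: ev1 E _ => x; rewrite big_cons.
have lrest : lnlaurents rest by move=> kd' /inF[/ls].
have krest kd' : List.In kd' rest -> kd'.1 < kappa.
  by move=> /inF[/kmax le ne]; rewrite lt_neqAle ne.
have E x : expsum S x = expR (kappa * x) * delta x + expsum rest x.
  exact: expsum_filter.
have [d0|[c [N [c0 Hd]]]] := lnlaurent_dich ldelta.
  have sz : (size rest < n)%N.
    have cS : (count (fun kd => kd.1 == kappa) S + size rest = (size s).+1)%N.
      by rewrite /rest size_filter; apply: count_predC.
    have : (0 < count (fun kd => kd.1 == kappa) S)%N.
      by rewrite -has_count; elim: (S) kmin => //= a t IHt [->|/IHt ->];
        rewrite ?eqxx ?orbT.
    by lia.
  have [H|[theta t0 H]] := IH rest sz lrest (fun kd' H => lk kd' (inF _ _ H).1).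
    by left; apply: ev2 d0 H _ => x d0x H; rewrite E d0x mulr0 add0r.
  right; exists theta => //; case: H => H; [left|right]; apply: ev2 d0 H _ => x d0x H;
    by rewrite E d0x mulr0 add0r.
have [k kk [C HC]] := expsum_upper lrest krest.
have k20 : 0 < kappa / 2 by rewrite divr_gt0.
right; exists (kappa / 2) => //.
(* [c / x ^ N] beats both [C exp ((k - kappa) x)] and [exp (- kappa x / 2)]. *)
have main : ev (fun x => `|expsum rest x| + expR (kappa / 2 * x) <=
    expR (kappa * x) * (c / x ^+ N)).
  have m1 : 0 < kappa - k by rewrite subr_gt0.
  apply: ev4 HC (poly_lt_exp (2 * C / c) N m1) (poly_lt_exp (2 / c) N k20) (ev_gt 0) _.
  move=> x HC' H1 H2 x0; have xN : 0 < x ^+ N by rewrite exprn_gt0.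
  have half u : u * 2 * x ^+ N / c <= expR (kappa * x) ->
      u <= expR (kappa * x) * (c / x ^+ N) / 2.
    by move=> H; rewrite ler_pdivlMr // mulrA ler_pdivlMr // -ler_pdivrMr.
  have H1' : C * expR (k * x) <= expR (kappa * x) * (c / x ^+ N) / 2.
    apply: half; have := ler_wpM2r (expR_ge0 (k * x)) H1; rewrite -expRD.
    rewrite -mulrDl subrK; apply: le_trans.
    by rewrite [leLHS](_ : _ = 2 * C / c * x ^+ N * expR (k * x)) //; ring.
  have H2' : expR (kappa / 2 * x) <= expR (kappa * x) * (c / x ^+ N) / 2.
    apply: half; have := ler_wpM2r (expR_ge0 (kappa / 2 * x)) H2; rewrite -expRD.
    rewrite -mulrDl -splitr; apply: le_trans.
    by rewrite [leLHS](_ : _ = 2 / c * x ^+ N * expR (kappa / 2 * x)) //; ring.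
  by have := le_trans HC' H1'; lra.
case: Hd => Hd; [left|right]; apply: ev2 main Hd _ => x H Hd'; rewrite E.
  have := ler_wpM2l (expR_ge0 (kappa * x)) Hd'.
  have := ler_norm (- expsum rest x); rewrite normrN; lra.
have := ler_wpM2l (expR_ge0 (kappa * x)) Hd'; rewrite mulrN.
have := ler_norm (expsum rest x); lra.
Qed.

Lemma laurent_split e : laurent e -> exists P s,
  analytic s /\ ev (fun x => e x = P.[x] + x^-1 * s x^-1).
Proof.
move=> [N [a [aa E]]]; have [F [r [K [B [[r0 K0 B0] fE Fs Fb]]]]] := aa.
exists (\poly_(i < N.+1) F (N - i)%N 0), (F N.+1); split.
  exists (fun n => F (n + N.+1)%N), r, (K * B ^+ N.+1), B; split=> //.
  - by split=> //; rewrite mulr_ge0 ?exprn_ge0.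
  - by move=> n t tr; rewrite addSn; apply: Fs.
  - by move=> n t tr; rewrite -mulrA -exprD addnC; apply: Fb.
apply: ev2 E (ev_inv r0) _ => x -> [x0 xr].
have xN := lt0r_neq0 x0.
rewrite fE // (shifts_expand N.+1 Fs xr) horner_poly mulrDr mulr_sumr; congr (_ + _).
  rewrite (reindex_inj rev_ord_inj); apply: eq_bigr => i _ /=; rewrite subSS.
  have iN : (i <= N)%N by rewrite -ltnS.
  have -> : x ^+ N = x ^+ (N - i) * x ^+ i by rewrite -exprD subnK.
  by rewrite exprVn; field; rewrite expf_neq0.
by rewrite exprSr exprVn !mulrA mulfV ?mul1r // expf_neq0.
Qed.

Lemma logexp_split A D : logexp A D -> exists s p e psi,
  [/\ lnlaurents s, forall kd, List.In kd s -> 0 < kd.1,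
      p`_0 \is a Num.int /\ laurent e, esmall A psi &
      ev (fun x => D x = expsum s x + (ln x * p.[x] + e x) + psi x)].
Proof.
elim=> [phi H|kappa p e phi phi' kp pi le _ [s [q [e' [psi [ls lk [qi le'] Hpsi E]]]]] E'].
  exists [::], 0, (fun=> 0), phi; split=> //.
  - by rewrite coef0 rpred0; split=> //; apply: laurent_cst.
  - exact: esmall_err.
  - by apply: evT => x; rewrite /expsum big_nil horner0 mulr0 !add0r.
have [kn|kn|k0] := ltgtP kappa 0.
- exists s, q, e', ((fun x => expR (kappa * x) * e x) \+ psi); split=> //.
    by apply: (esmall_cons kn le Hpsi); apply: evT.
  by apply: ev2 E E' _ => x E ->; rewrite E kp //= horner0; ring.
- pose d x := ln x * p.[x] + e x.
  exists ((kappa, d) :: s), q, e', psi; split=> //.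
  + move=> kd /= [<-|/ls//]; exists p, e; split=> //; exact: evT.
  + by move=> kd /= [<-|/lk].
  + apply: ev2 E E' _ => x E ->; rewrite E /expsum big_cons /= -/(expsum s x) /d; ring.
- exists s, (p + q), (e \+ e'), psi; split=> //.
    by split; [rewrite coefD rpredD|apply: laurent_add].
  by apply: ev2 E E' _ => x E -> /=; rewrite E k0 mul0r expR0 hornerD; ring.
Qed.

(** The functions whose exponential is again [exp (rho x)] times a Laurent series, up to a factor
    exponentially close to 1; that [m] is an integer makes [exp (m ln x)] a power of [x]. *)
Definition logpoly A D := exists (m : int) (rho r : R) s psi,
  [/\ analytic s, esmall A psi & ev (fun x =>
     D x = m%:~R * ln x + rho * x + r + x^-1 * s x^-1 + psi x)].

(** A growing exponential, a polynomial part of degree at least 2, or [ln x] with a coefficient of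
    degree at least 1 outruns all linear functions. What is left has [p] constant and [P] of degree
    at most 1. *)
Lemma logexp_cases A D : 0 < A -> logexp A D ->
  [\/ forall B, ev (fun x => B * x <= D x), forall B, ev (fun x => D x <= B * x) |
     logpoly A D].
Proof.
move=> A0 /logexp_split [s [p [e [psi [ls lk [pi le] Hpsi E]]]]].
have psib := esmall_bnd A0 Hpsi.
have ld : lnlaurent (fun x => ln x * p.[x] + e x) by exists p, e; split=> //; apply: evT.
have [S0|[theta t0 HS]] := expsum_dich ls lk; last first.
  have [C [N [C0 Hd]]] := lnlaurent_upper ld.
  have big (B : R) : ev (fun x => `|ln x * p.[x] + e x| + `|psi x| + `|B| * x <= expR (theta * x)).
    apply: ev4 Hd psib (ev_ge 1) (poly_lt_exp (C + 1 + `|B|) N.+1 t0) _.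
    move=> x Hd' Hp x1 H; apply: le_trans H.
    have x0 : 0 < x by apply: lt_le_trans x1.
    have xN : 1 <= x ^+ N.+1 by rewrite exprn_ege1.
    have xx : x <= x ^+ N.+1 by rewrite exprS ler_peMr ?exprn_ege1 // ltW.
    have xN' : x ^+ N <= x ^+ N.+1 by rewrite exprS ler_peMl ?exprn_ge0 // ltW.
    rewrite !mulrDl mul1r; apply: lerD; last by rewrite ler_wpM2l.
    apply: lerD; last exact: le_trans Hp xN.
    by apply: le_trans Hd' _; rewrite ler_wpM2l.
  case: HS => HS; [apply: Or31|apply: Or32] => B.
    apply: ev4 (big B) HS E (ev_gt 0) _ => x H1 H2 -> x0.
    have := ler_wpM2r (ltW x0) (ler_norm B).
    have := ler_norm (- (ln x * p.[x] + e x)); rewrite normrN.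
    have := ler_norm (- psi x); rewrite normrN; lra.
  apply: ev4 (big B) HS E (ev_gt 0) _ => x H1 H2 -> x0.
  have := ler_wpM2r (ltW x0) (ler_norm (- B)); rewrite normrN.
  have := ler_norm (ln x * p.[x] + e x); have := ler_norm (psi x); lra.
have [P [sg [asg EP]]] := laurent_split le.
have [sz|sz] := boolP ((size p <= 1)%N && (size P <= 2)%N).
  apply: Or33; move: sz => /andP[sp sP].
  have /intrP[m Em] := pi.
  exists m, P`_1, P`_0, sg, psi; split=> //.
  apply: ev3 S0 E EP _ => x S0 -> ->; rewrite S0 add0r.
  rewrite (size1_polyC sp) hornerC Em (horner_coef_wide x sP) !big_ord_recl big_ord0 /=.
  by rewrite /bump /= expr0 expr1; ring.
pose d := (maxn (size p) (size P)).-1.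
have spd : (size p <= d.+1)%N by rewrite /d; lia.
have sPd : (size P <= d.+1)%N by rewrite /d; lia.
have d1 : (0 < d)%N by move: sz; rewrite negb_and -!ltnNge /d; lia.
have [r [K [r0 K0 sgb]]] := analytic_bnd asg.
have [C C0 HC] := poly_lead sPd.
pose g x := (P.[x] + x^-1 * sg x^-1) / x ^+ d.
have Hg : ev (fun x => `|g x - P`_d| <= (C + K) / x).
  apply: ev2 (ev_inv r0) (ev_ge 1) _ => x [x0 xr] x1.
  have xd : 0 < x ^+ d by rewrite exprn_gt0.
  have -> : g x - P`_d = ((P.[x] - P`_d * x ^+ d) + x^-1 * sg x^-1) / x ^+ d.
    by rewrite /g; field; rewrite !gt_eqF.
  rewrite normrM [X in _ * X]gtr0_norm ?invr_gt0 // ler_pdivrMr //.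
  apply: le_trans (ler_normD _ _) _; rewrite -mulrA mulrDl; apply: lerD.
    by rewrite [x^-1 * _]mulrC; apply: HC.
  rewrite normrM gtr0_norm ?invr_gt0 // mulrC; apply: ler_pM => //.
  - by rewrite invr_ge0 ltW.
  - exact: sgb.
  - by rewrite ler_peMr ?invr_ge0 ?(ltW x0) // exprn_ege1.
have Ed : ev (fun x => D x = (ln x * p.[x] + x ^+ d * g x) + psi x).
  apply: ev4 S0 E EP (ev_gt 0) _ => x S0 -> -> x0; rewrite S0 add0r /g.
  by rewrite [x ^+ d * _]mulrC divfK // expf_neq0 ?gt_eqF.
have shift_up : (forall B, ev (fun x => B * x <= ln x * p.[x] + x ^+ d * g x)) ->
    forall B, ev (fun x => B * x <= D x).
  move=> H B; apply: ev4 (H (B + 1)) Ed psib (ev_ge 1) _ => x H1 -> H2 x1.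
  by move: H1; rewrite mulrDl mul1r; have := ler_norm (- psi x); rewrite normrN; lra.
have shift_dn : (forall B, ev (fun x => ln x * p.[x] + x ^+ d * g x <= B * x)) ->
    forall B, ev (fun x => D x <= B * x).
  move=> H B; apply: ev4 (H (B - 1)) Ed psib (ev_ge 1) _ => x H1 -> H2 x1.
  by move: H1; rewrite mulrBl mul1r; have := ler_norm (psi x); lra.
have xxd (x : R) : 1 <= x -> x <= x ^+ d.
  move=> x1; rewrite -(prednK d1) exprS ler_peMr ?exprn_ege1 // (le_trans _ x1) //.
have [pd|pd] := eqVneq p`_d 0; last first.
  case: (lead_lnpoly_inf spd Hg pd) => H; [apply: Or31; apply: shift_up|apply: Or32; apply: shift_dn] => B.
    apply: ev2 (H `|B|) (ev_ge 1) _ => x H1 x1; apply: le_trans H1.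
    apply: le_trans (_ : _ <= `|B| * x) _; last by rewrite ler_wpM2l // xxd.
    by rewrite ler_wpM2r ?ler_norm // (le_trans _ x1).
  apply: ev2 (H (- `|B|)) (ev_ge 1) _ => x H1 x1; apply: le_trans H1 _.
  apply: le_trans (_ : _ <= - `|B| * x) _; last first.
    by rewrite ler_wpM2r ?(le_trans _ x1) // lerNl -normrN ler_norm.
  by rewrite !mulNr lerN2 ler_wpM2l // xxd.
(* [d = 1] would leave [p] constant, as its coefficient of degree 1 vanishes, and [P] of degree at
   most 1: the case already treated. *)
have d2 : (1 < d)%N.
  rewrite ltn_neqAle d1 andbT; apply/eqP => d1'; move: sz; rewrite negb_and -!ltnNge.
  have -> /= : (1 < size p)%N = false.
    apply/negP => sp; have sp2 : size p = 2 by lia.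
    have p1 : p`_1 = 0 by move: pd; rewrite -d1'.
    have : lead_coef p == 0 by rewrite lead_coefE sp2 /= p1.
    by rewrite lead_coef_eq0 => /eqP p0; rewrite p0 size_poly0 in sp2.
  by move=> sP2; have := leq_trans sP2 sPd; rewrite -d1'.
have Pd : P`_d != 0.
  have dP : d = (size P).-1.
    apply/eqP; rewrite eqn_leq; apply/andP; split; last by rewrite /d; lia.
    have : (size p <= d)%N by apply/leq_sizeP => j; rewrite leq_eqVlt => /orP[/eqP<-//|dj];
      apply/(leq_sizeP _ _ spd).
    by rewrite /d; lia.
  by rewrite dP -lead_coefE lead_coef_eq0 -size_poly_gt0; lia.
have [|b b0 H] := lead_lnpoly spd Hg; first by rewrite Pd orbT.
have xx2 (x : R) : 1 <= x -> x * x <= x ^+ d.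
  by move=> x1; rewrite -expr2 ler_weXn2l.
case: H => H; [apply: Or31; apply: shift_up|apply: Or32; apply: shift_dn] => B.
  apply: ev3 H (ev_ge 1) (ev_ge (`|B| / b)) _ => x H1 x1 xB; apply: le_trans H1.
  apply: le_trans (_ : _ <= b * (x * x)) _; last by rewrite ler_pM2l // xx2.
  rewrite mulrA ler_wpM2r ?(le_trans _ x1) //.
  by move: xB; rewrite ler_pdivrMr // mulrC => /(le_trans (ler_norm B)).
apply: ev3 H (ev_ge 1) (ev_ge (`|B| / b)) _ => x H1 x1 xB; apply: le_trans H1 _.
apply: le_trans (_ : _ <= - (b * (x * x))) _; first by rewrite lerN2 ler_pM2l // xx2.
rewrite mulrA -mulNr ler_wpM2r ?(le_trans _ x1) // lerNl.
by move: xB; rewrite ler_pdivrMr // mulrC -normrN => /(le_trans (ler_norm _)).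
Qed.

Lemma laurent_xint (m : int) : laurent (fun x => expR (m%:~R * ln x)).
Proof.
case: m => n.
  apply: laurent_ext (laurent_xn n); apply: ev1 (ev_gt 0) _ => x x0.
  by rewrite expRM_natl lnK.
apply: laurent_ext (laurent_analytic (analytic_pow R n.+1)).
apply: ev1 (ev_gt 0) _ => x x0.
by rewrite NegzE mulrNz mulNr expRN expRM_natl lnK // exprVn.
Qed.

(** The exponential is exponentially small if [rho < 0]. If [rho = 0] and [m <= 0], it is analytic
    in [1 / x] up to the factor [1 + psi']. In both cases the logarithm can be expanded. *)
Lemma logexp_ln1p A (m : int) (rho r : R) s psi : 0 < A -> analytic s -> esmall A psi ->
  (rho < 0) || (rho == 0) && (m <= 0) ->
  logexp A (fun x => ln (1 + expR (m%:~R * ln x + rho * x + r + x^-1 * s x^-1 + psi x))).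
Proof.
move=> A0 as_ Hpsi Hm.
pose psi' x := expR (psi x) - 1.
have Hpsi' : esmall A psi'.
  apply: (@esmall_comp A (fun t => expR t - 1)) => //; last by rewrite expR0 subrr.
  exact: analytic_add (@analytic_expR R) (analytic_cst _).
pose b t := expR (r + t * s t).
have ab : analytic b.
  by apply: analytic_exp; apply: analytic_add (analytic_cst _) (analytic_mul (@analytic_id R) as_).
pose q x := expR (m%:~R * ln x) * b x^-1.
have lq : laurent q by apply: laurent_mul (laurent_xint m) (laurent_analytic ab).
have ED x : expR (m%:~R * ln x + rho * x + r + x^-1 * s x^-1 + psi x) =
    expR (rho * x) * q x * (1 + psi' x).
  by rewrite /psi' (addrC 1) subrK /q /b !expRD; ring.
have ln_esmall tau : esmall A tau -> esmall A (fun x => ln (1 + tau x)).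
  move=> Ht; apply: (@esmall_comp A (fun t => ln (1 + t))) => //.
    exact: analytic_ln1p.
  by rewrite addr0 ln1.
case: (ltP rho 0) Hm => [rho0 _|_ /= /andP[/eqP rho0 m0]].
  apply: esmall_logexp; apply: ln_esmall.
  have H1 : esmall A (fun x => expR (rho * x) * q x).
    apply: (esmall_cons rho0 lq (esmall0 A)); by apply: evT => x; rewrite addr0.
  apply: esmall_ext (esmall_add H1 (esmall_mul A0 H1 Hpsi')).
  by apply: evT => x /=; rewrite ED; ring.
have [n mn] : exists n : nat, m = - n%:Z.
  by exists `|m|%N; rewrite abszE ler0_norm // opprK.
pose a t := t ^+ n * b t.
have aa : analytic a by apply: analytic_mul (analytic_pow R n) ab.
have qE : ev (fun x => q x = a x^-1).
  apply: ev1 (ev_gt 0) _ => x x0; rewrite /q /a mn mulrNz mulNr expRN expRM_natl lnK //.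
  by rewrite exprVn.
have q0 x : 0 < q x by rewrite /q /b mulr_gt0 ?expR_gt0.
pose eta t := 1 + a t.
have aeta : analytic eta by apply: analytic_add (analytic_cst _) aa.
have eta0 : 0 < eta 0.
  by rewrite /eta ltr_pwDl // /a /b mulr_ge0 ?expR_ge0 // exprn_ge0.
have aie := analytic_inv (lt0r_neq0 eta0) aeta.
have [rb [K [rb0 K0 HK]]] := analytic_bnd (analytic_mul aa aie).
(* From [1 + a (1 + psi') = (1 + a) (1 + tau)]: the first factor has an analytic logarithm, the
   second an exponentially small one. *)
pose tau x := (a x^-1 * (eta x^-1)^-1) * psi' x.
have Htau : esmall A tau.
  apply: (@esmall_bmul A psi' (fun x => a x^-1 * (eta x^-1)^-1) K) => //.
    exact: laurent_analytic (analytic_mul aa aie).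
  by apply: ev1 (ev_inv rb0) _ => x [_ xr]; apply: HK.
have lneta : laurent (fun x => ln (eta x^-1)).
  exact: laurent_analytic (analytic_ln eta0 aeta).
have H0 := logexp_add (logexp_lnpoly A (rpred0 _) lneta)
  (esmall_logexp (ln_esmall _ Htau)).
apply: logexp_ext H0; apply: ev1 qE _ => x qEx /=.
have e1 : 0 < eta x^-1 by rewrite /eta -qEx addr_gt0.
have E : 1 + expR (rho * x) * q x * (1 + psi' x) = eta x^-1 * (1 + tau x).
  rewrite rho0 mul0r expR0 mul1r /tau qEx; set z := eta x^-1 in e1 *.
  have -> : a x^-1 = z - 1 by rewrite /z /eta addrC addKr.
  by field; rewrite gt_eqF.
have t1 : 0 < 1 + tau x.
  by rewrite -(pmulr_rgt0 _ e1) -E -ED addr_gt0 ?expR_gt0.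
by rewrite ED E lnM ?posrE // mul0r add0r.
Qed.

Lemma ln1p_exp_err A D : (forall B, ev (fun x => D x <= B * x)) ->
  experr A (fun x => ln (1 + expR (D x))).
Proof.
move=> H; exists 1; apply: ev1 (H (- A)) _ => x H1.
have e0 := expR_gt0 (D x).
rewrite ger0_norm; last by rewrite ln_ge0 // lerDl ltW.
rewrite mul1r; apply: le_trans (le_ln1Dx _) _; first by lra.
by rewrite ler_expR.
Qed.

(** In a sum the larger term is factored out, leaving [ln (1 + exp D)] with [D] bounded above; if
    [D] falls below all linear functions, this is mere error. Powers consume precision, so [A]
    varies in the induction. *)
Lemma uev_logexp (t : ut) A : 0 < A -> logexp A (fun x => ln (uev t x)).
Proof.
elim: t A => [||a IHa b IHb|a IHa b IHb|a IHa|p a IHa] A A0.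
- apply: logexp_ext (logexp_lnpoly A (rpred0 _) (laurent_cst 0)).
  by apply: evT => x /=; rewrite ln1 mul0r addr0.
- apply: logexp_ext (logexp_lnpoly A (rpred1 _) (laurent_cst 0)).
  by apply: evT => x /=; rewrite mul1r addr0.
- pose D (x : R) := ln (uev b x) - ln (uev a x).
  have HD : logexp A D by apply: logexp_add (IHb A A0) (logexp_opp (IHa A A0)).
  have add a' b' : logexp A (fun x => ln (uev a' x)) ->
      logexp A (fun x => ln (1 + expR (ln (uev b' x) - ln (uev a' x)))) ->
      logexp A (fun x => ln (uev (UAdd a' b') x)).
    move=> Ha H; apply: logexp_ext (logexp_add Ha H); apply: ev1 (ev_ge 2) _ => x x2 /=.
    have a0 := uev_gt0 a' x2; have b0 := uev_gt0 b' x2.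
    rewrite -lnM ?posrE ?addr_gt0 ?expR_gt0 // expRB !lnK ?posrE //; congr (ln _).
    by field; rewrite gt_eqF.
  have Ea := add a b (IHa A A0).
  have Eb : logexp A (fun x => ln (1 + expR (- D x))) -> logexp A (fun x => ln (uev (UAdd a b) x)).
    move=> H; apply: logexp_ext (add b a (IHb A A0) (logexp_ext _ H)); apply: evT => x.
      by rewrite /= addrC.
    by rewrite opprB.
  have [H|H|H] := logexp_cases A0 HD.
  + apply: Eb; apply: logexp_err; apply: ln1p_exp_err => B.
    by apply: ev1 (H (- B)) _ => x; rewrite mulNr lerNl.
  + by apply: Ea; apply: logexp_err; apply: ln1p_exp_err.
  + have [m [rho [r [s [psi [as_ Hpsi E]]]]]] := H.
    have [Hm|Hm] := boolP ((rho < 0) || (rho == 0) && (m <= 0)).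
      apply: Ea; apply: logexp_ext (logexp_ln1p r A0 as_ Hpsi Hm).
      by apply: ev1 E _ => x <-.
    have Hm' : (- rho < 0) || (- rho == 0) && (- m <= 0).
      move: Hm; rewrite oppr_lt0 oppr_eq0 oppr_le0.
      by case: ltgtP => //= _; rewrite -ltNge => /ltW.
    apply: Eb; apply: logexp_ext (logexp_ln1p (- r) A0 (analytic_scale (-1) as_)
      (esmall_scale (-1) Hpsi) Hm').
    by apply: ev1 E _ => x ->; congr (ln (1 + expR _)); rewrite mulrNz; ring.
- apply: logexp_ext (logexp_add (IHa A A0) (IHb A A0)).
  by apply: ev1 (ev_ge 2) _ => x x2 /=; rewrite lnM ?posrE ?uev_gt0.
- have A1 : 0 < A + 1 by rewrite addr_gt0.
  apply: logexp_ext (logexp_xmul (IHa (A + 1) A1)).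
  by apply: evT => x /=; rewrite expRK.
- pose k : R := ln p.+2%:R; have k0 : 0 <= k by rewrite ln_ge0 // ler1n.
  have A1 : 0 < A + k by rewrite ltr_pwDl.
  apply: logexp_ext (logexp_expmul k0 (IHa (A + k) A1)).
  by apply: evT => x /=; rewrite expRK /kpow [k * x]mulrC.
Qed.

(** The logarithm of the quotient outruns all linear functions in one direction or is
    [m * ln x + rho * x + O(1)]. If [rho = 0], the integer [m] is at most 0 or at least 1, and this
    is the gap. *)
Lemma uev_gap (a b : ut) :
  dom (@uev R b) (uev a) \/ dom (xshift 1 (@uev R a)) (uev b).
Proof.
pose D (x : R) := ln (uev b x) - ln (uev a x).
have HD : logexp 1 D by apply: logexp_add (uev_logexp b _) (logexp_opp (uev_logexp a _)).
have up (C : R) : ev (fun x => D x <= C) -> dom (@uev R b) (uev a).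
  move=> H; exists (expR C); apply: ev2 H (ev_ge 2) _ => x; rewrite /D lerBlDr => H x2.
  by rewrite -[leLHS]lnK ?posrE ?uev_gt0 // -[X in _ * X]lnK ?posrE ?uev_gt0 // -expRD ler_expR.
have dn (C : R) : ev (fun x => ln x - C <= D x) -> dom (xshift 1 (@uev R a)) (uev b).
  move=> H; exists (expR C); apply: ev2 H (ev_ge 2) _ => x; rewrite /D lerBrDr => H x2.
  have x0 : 0 < x by apply: lt_le_trans x2.
  rewrite /xshift expr1 -[X in X * _]lnK ?posrE // -[X in _ * X <= _]lnK ?posrE ?uev_gt0 //.
  rewrite -[X in _ <= _ * X]lnK ?posrE ?uev_gt0 // -!expRD ler_expR; lra.
have [H|H|[m [rho [r [s [psi [as_ Hpsi E]]]]]]] := logexp_cases ltr01 HD.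
- right; apply: (dn 0); apply: ev2 (H 1) (ev_gt 0) _ => x; rewrite mul1r subr0 => H1 x0.
  by apply: le_trans H1; apply/ltW/ln_sublinear.
- by left; apply: (up 0); apply: ev1 (H 0) _ => x; rewrite mul0r.
have psib := esmall_bnd ltr01 Hpsi.
have [rb [K [rb0 K0 HK]]] := analytic_bnd as_.
have bnd : ev (fun x => `|r + x^-1 * s x^-1 + psi x| <= `|r| + K + 1).
  apply: ev3 psib (ev_inv rb0) (ev_ge 1) _ => x H1 [x0 xr] x1.
  apply: le_trans (ler_normD _ _) _; apply: lerD => //.
  apply: le_trans (ler_normD _ _) _; rewrite lerD2l normrM.
  apply: le_trans (ler_wpM2l _ (HK _ xr)) _ => //.
  by rewrite ler_piMl // ger0_norm ?invr_ge0 ?(ltW x0) // invf_le1.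
have E' : ev (fun x => `|D x - (m%:~R * ln x + rho * x)| <= `|r| + K + 1).
  by apply: ev2 E bnd _ => x -> ; rewrite (_ : _ - _ = r + x^-1 * s x^-1 + psi x) //; ring.
have lnc (k t : R) : 0 < t -> ev (fun x => k * ln x <= t * x).
  move=> t0; have c0 : 0 < `|k| + 1 by rewrite ltr_wpDl.
  apply: ev2 (ln_small (divr_gt0 t0 c0)) (ev_ge 1) _ => x lx x1.
  apply: (@le_trans _ _ ((`|k| + 1) * ln x)).
    by rewrite ler_wpM2r ?ln_ge0 // (le_trans (ler_norm _)) // lerDl.
  by rewrite mulrC -ler_pdivlMr // mulrAC.
have [rn|rp|r0] := ltgtP rho 0.
- left; apply: (up (`|r| + K + 1)); have rn' : 0 < - rho by rewrite oppr_gt0.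
  by apply: ev2 E' (lnc m%:~R _ rn') _ => x; rewrite ler_norml => /andP[_ H]; lra.
- right; apply: (dn (`|r| + K + 1)).
  apply: ev2 E' (lnc (1 - m%:~R) _ rp) _ => x; rewrite ler_norml => /andP[H _].
  by rewrite mulrBl mul1r; lra.
have [m0|m1] := lerP m 0.
  left; apply: (up (`|r| + K + 1)).
  apply: ev2 E' (ev_ge 1) _ => x; rewrite r0 mul0r addr0 ler_norml => /andP[_ H] x1.
  have : m%:~R * ln x <= 0 by rewrite mulr_le0_ge0 ?ln_ge0 // lerz0.
  lra.
right; apply: (dn (`|r| + K + 1)).
apply: ev2 E' (ev_ge 1) _ => x; rewrite r0 mul0r addr0 ler_norml => /andP[H _] x1.
have : ln x <= m%:~R * ln x.
  by rewrite ler_peMl ?ln_ge0 // -[1]/(1%:~R) ler_int; lia.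
lra.
Qed.

End Expansions.

(** * Order types of sets of bounded weight *)

Section Counting.
Variable R : realType.
Local Notation fn := (R -> R).
Local Notation uev := (@uev R).

Definition uset (n : nat) : set fn := uev @` [set t | (wt t <= n)%N].

Lemma leinf_lei i : forall f g : fn, leinf f g -> lei i f g.
Proof. by move=> f g H; exists 0; apply: ev1 H _ => x; rewrite mul0r addr0. Qed.

Lemma wbound_powers : wbound leinf (osucc ozero) (range (fun (k : nat) (x : R) => x ^+ k)).
Proof.
apply/wboundP => _ [k _ <-].
apply: (@fcover_sub _ _ _ [set f | exists2 j, (j < k)%N & [set fun x : R => x ^+ j] f]).
  move=> _ [[j _ <-] N]; exists j => //; rewrite ltnNge; apply/negP => kj; apply: N.
  by apply: ev1 (ev_ge 1) _ => x x1; rewrite ler_weXn2l.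
apply: fcover_bigU => j; exists ozero; first exact: olt_succ.
apply/wboundP => f ->; apply: fcover_sub (fcover0 _) => g [-> []]; exact: leinf_refl.
Qed.

(** The base with exponent [(m + 2) ^ x] has weight at most [n / (m + 2)], less than [n], so it is
    bounded by the induction on weights; the factors are multiplied in one after the other. *)
Lemma wbound_wterm n m : (0 < n)%N -> (m <= n)%N ->
  (forall i, (i < n)%N -> exists2 e, olt e epsilon0 & wbound leinf e (uset i)) ->
  exists2 e, olt e epsilon0 &
    wbound leinf e [set f | exists k g, wgood n g /\ f = uev (wterm m k g)].
Proof.
move=> n0 mn IH; elim: m mn => [_|m IHm mn].
  exists (osucc ozero); first exact/osucc_epsilon0/zero_epsilon0.
  apply: wbound_sub wbound_powers => _ [k [g [_ ->]]]; exists k => //.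
  by apply/funext => x; rewrite /= uev_xpow.
have [e ee we] := IHm (ltnW mn).
have [|e' ee' we'] := IH (n %/ m.+2)%N; first by rewrite ltn_Pdiv.
exists (nadd e' e); first exact: nadd_epsilon0.
apply: (@wbound_prod _ _ _ leinf leinf leinf
  (fun g w f => f = (fun x => expR (kpow m.+2 x * ln (g x)) * w x)) _ _ _ _ _ _ _ we' we).
  move=> _ [k [g [gg ->]]]; exists (uev (g m)), (uev (wterm m k g)); split=> //.
    by exists (g m) => //=; rewrite leq_divRL // mulnC gg.
  by exists k, g.
move=> _ _ _ _ _ _ [a _ <-] [a' _ <-] [k [g [_ ->]]] [k' [g' [_ ->]]] _ _ -> -> H1 H2.
apply: ev3 H1 H2 (ev_ge 2) _ => x H1 H2 x2.
apply: ler_pM; rewrite ?expR_ge0 ?(ltW (uev_gt0 _ _)) //.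
by rewrite ler_expR ler_wpM2l ?kpow_ge0 // ler_ln ?posrE ?uev_gt0.
Qed.

(** * All levels of a fixed weight *)

Section Level.
Variables (n : nat) (bW : ord).
Hypothesis n0 : (0 < n)%N.
Hypothesis wW : wbound leinf bW [set f | exists k g, wgood n g /\ f = uev (wterm n k g)].

Let lfun j : set fn := uev @` lset n j.

(** The relations are arbitrary because three pairs will be used: [leinf] to [leinf], [lei i.+1] to
    [lei i], and [lei 1] to [dom]. *)
Lemma wbound_gset (leL leG : fn -> fn -> Prop) j e :
  (forall w w' u u', leinf (uev w) (uev w') -> leL (uev u) (uev u') ->
     leG (uev (UMul w (UPowX u))) (uev (UMul w' (UPowX u')))) ->
  wbound leL e (lfun j) -> wbound leG (nadd bW e) (@gset R n j).
Proof.
move=> mono wL.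
apply: (@wbound_prod _ _ _ leinf leL leG
  (fun w u f => f = (fun x => w x * expR (x * ln (u x)))) _ _ _ _ _ _ _ wW wL).
  move=> _ [k [g [u [gg lu ->]]]]; exists (uev (wterm n k g)), (uev u).
  by split=> //; [exists k, g|exists u].
move=> _ _ _ _ _ _ [k [g [_ ->]]] [k' [g' [_ ->]]] [u _ <-] [u' _ <-] _ _ -> -> H1 H2.
exact: mono H1 H2.
Qed.

Lemma powx_leinf w w' u u' : leinf (uev w) (uev w') -> leinf (uev u) (uev u') ->
  leinf (uev (UMul w (UPowX u))) (uev (UMul w' (UPowX u'))).
Proof.
move=> H1 H2; apply: ev3 H1 H2 (ev_ge 2) _ => x H1 H2 x2 /=.
apply: ler_pM; rewrite ?expR_ge0 ?(ltW (uev_gt0 _ _)) //.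
by rewrite ler_expR ler_wpM2l ?(le_trans _ x2) // ler_ln ?posrE ?uev_gt0.
Qed.

(* A relative error [C / x ^ (i + 1)] becomes [exp (C / x ^ i)] after raising to
   the power [x]. *)
Lemma powx_err i u u' : lei i.+1 (uev u) (uev u') -> exists2 C, 0 <= C &
  ev (fun x => expR (x * ln (uev u x)) <= expR (x * ln (uev u' x)) * expR (C / x ^+ i)).
Proof.
move=> [C H]; exists `|C| => //; apply: ev2 H (ev_ge 2) _ => x H x2.
have x0 : 0 < x by apply: lt_le_trans x2.
have u0 := uev_gt0 u x2; have u0' := uev_gt0 u' x2.
rewrite -expRD ler_expR -(ler_pM2l (_ : 0 < x^-1)) ?invr_gt0 // mulrDr !mulKf ?gt_eqF //.
have {}H : uev u x <= uev u' x * expR (`|C| / x ^+ i.+1).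
  apply: le_trans H _; rewrite -[X in X + _]mulr1 mulrCA -mulrDr ler_pM2l //.
  apply: le_trans (expR_ge1Dx _); rewrite lerD2l ler_wpM2r ?ler_norm //.
  by rewrite invr_ge0 exprn_ge0 // ltW.
rewrite -ler_expR expRD !lnK ?posrE //; apply: le_trans H _.
by rewrite exprS invfM mulrCA.
Qed.

Lemma powx_lei i w w' u u' : (0 < i)%N ->
  leinf (uev w) (uev w') -> lei i.+1 (uev u) (uev u') ->
  lei i (uev (UMul w (UPowX u))) (uev (UMul w' (UPowX u'))).
Proof.
move=> i0 H1 /powx_err[C C0 H2]; exists (2 * C).
apply: ev4 H1 H2 (ev_ge 2) (ev_ge (2 * C)) _ => x H1 H2 x2 xC /=.
have x0 : 0 < x by apply: lt_le_trans x2.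
have w0 := uev_gt0 w x2; have w0' := uev_gt0 w' x2.
set q := C / x ^+ i.
have q0 : 0 <= q by rewrite divr_ge0 // exprn_ge0 // ltW.
(* Gives [exp q <= 1 / (1 - q) <= 1 + 2 * q], the source of the constant [2 * C]. *)
have q2 : q <= 2^-1.
  rewrite ler_pdivrMr ?exprn_gt0 // -ler_pdivrMl ?invr_gt0 // invrK.
  apply: le_trans xC _; rewrite -(prednK i0) exprS.
  apply: ler_peMr; first exact: ltW.
  by apply: exprn_ege1; apply: le_trans x2; rewrite ler1n.
have eq : expR q <= 1 + 2 * q.
  have := expR_ge1Dx (- q); rewrite expRN => H.
  have {}H : expR q <= (1 - q)^-1.
    by rewrite -[leLHS]invrK lef_pV2 ?posrE ?invr_gt0 ?expR_gt0 //; lra.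
  apply: le_trans H _; rewrite -[leLHS]mul1r ler_pdivrMr; last lra.
  by nra.
apply: (@le_trans _ _ (uev w' x * (expR (x * ln (uev u' x)) * expR q))).
  by apply: ler_pM => //; rewrite ?expR_ge0 // ltW.
rewrite mulrA; set A := uev w' x * _.
have A0 : 0 <= A by rewrite mulr_ge0 ?expR_ge0 // ltW.
apply: le_trans (ler_wpM2l A0 eq) _; rewrite mulrDr mulr1 lerD2l.
by rewrite /q le_eqVlt; apply/orP; left; apply/eqP; ring.
Qed.

Lemma powx_dom w w' u u' :
  leinf (uev w) (uev w') -> lei 1 (uev u) (uev u') ->
  dom (uev (UMul w (UPowX u))) (uev (UMul w' (UPowX u'))).
Proof.
move=> H1 /powx_err[C C0 H2]; exists (expR C).
apply: ev3 H1 H2 (ev_ge 2) _ => x; rewrite expr0 divr1 => H1 H2 x2 /=.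
have w0 := uev_gt0 w x2; have w0' := uev_gt0 w' x2.
rewrite [leRHS]mulrC -mulrA; apply: ler_pM => //; rewrite ?expR_ge0 // ltW //.
Qed.

Lemma gset_term j f : @gset R n j f -> exists t, f = uev t.
Proof. by move=> [k [g [u [_ _ ->]]]]; eexists. Qed.

Lemma gset_nneg j : evnneg (@gset R n j).
Proof.
move=> f /gset_term[t ->]; apply: ev1 (ev_ge 2) _ => x x2; exact/ltW/uev_gt0.
Qed.

Lemma gset_gap j y g (k : nat) : @gset R n j y -> @gset R n j g ->
  dom y (xshift k g) \/ dom (xshift k.+1 g) y.
Proof.
move=> /gset_term[b ->] /gset_term[a ->].
pose t := UMul (iter k (UMul UX) UOne) a.
have E x : uev t x = x ^+ k * uev a x by rewrite /= uev_xpow.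
case: (uev_gap R t b) => -[C H]; [left|right]; exists C; apply: ev1 H _ => x.
  by rewrite E.
by rewrite /xshift E expr1 mulrA exprS.
Qed.

Lemma lfun_sums (P : set fn) (le : fn -> fn -> Prop) e j :
  (forall f f' g g' : fn, (forall x, 2 <= x -> f x = f' x) ->
     (forall x, 2 <= x -> g x = g' x) -> le f g -> le f' g') ->
  (forall g f, @gset R n j g -> sums (@gset R n j) f -> P (g \+ f)) ->
  wbound le e P -> wbound le e (lfun j.+1).
Proof.
move=> ext HP.
apply: (@wbound_image _ _ le le (fun f h => forall x, 2 <= x -> h x = f x)).
  move=> _ [t lt <-]; have [g [f [Gg Sf E]]] := lset_issum R n0 lt.
  by exists (g \+ f) => //; apply: HP.
move=> f f' h h' _ _ _ _ E E'; apply: ext => x x2; by rewrite ?E ?E'.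
Qed.

Variable eta : ord.
Hypothesis bW_eta : olt bW (wexp eta).
Variable b0 : ord.
Hypothesis b0_eta : olt b0 (wexp eta).
Hypothesis wL0 : wbound leinf b0 (lfun 0).

(** [eta + 2 j]: at each level one successor makes room for the factors [w], the other for the [i]
    scales of a sum. *)
Let lam j := iter j.*2 osucc eta.

Lemma ole_lam j : ole eta (lam j).
Proof.
rewrite /lam; elim: j => [|j IH]; first exact: ole_refl.
apply: ole_trans IH _; apply: ole_trans (oltW (olt_succ _)) _.
exact/oltW/olt_succ.
Qed.

(** Precision [i] at level [j + 1] rests on precision [i + 1] at level [j], hence the induction for
    all [i] together. The precision enters the bound only through [i] copies of
    [omega ^ (lam j + 1)], which stay below [omega ^ (lam j + 2)] for every [i]. *)
Lemma wbound_lfun_lei j i : (0 < i)%N -> wbound (lei i) (wexp (lam j)) (lfun j).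
Proof.
elim: j i => [|j IH] i i0.
  apply: wbound_le (oltW b0_eta) _; apply: wbound_rel wL0 => f g _ _.
  exact: leinf_lei.
set d := nadd bW (wexp (lam j)).
have d_lt : olt d (wexp (osucc (lam j))).
  apply: olt_wexp_nadd; last exact/wexp_lt/olt_succ.
  apply: olt_ole_trans bW_eta _; apply: wexp_le.
  exact: ole_trans (ole_lam j) (oltW (olt_succ _)).
have wGi : wbound (lei i) d (@gset R n j).
  apply: wbound_gset (IH i.+1 _) => // w w' u u'; exact: powx_lei.
have wGd : wbound dom d (@gset R n j).
  apply: wbound_gset (IH 1%N _) => // w w' u u'; exact: powx_dom.
have := wbound_topsums (@gset_nneg j) (@gset_gap j) i0 wGi d_lt (fun _ H => H) wGd.
move=> /wbound_le H.
apply: (lfun_sums _ (sums_topsums (@gset_nneg j) (@gset_gap j)) (H _ _)).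
  move=> f f' g g' Ef Eg [C HC]; exists C; apply: ev2 HC (ev_ge 2) _ => x HC x2.
  by rewrite -Ef // -Eg.
apply: oltW; rewrite /lam doubleS.
have lt2 : olt d (wexp (osucc (osucc (lam j)))).
  by apply: olt_trans d_lt _; apply/wexp_lt/olt_succ.
apply: olt_wexp_nadd => //.
apply: olt_wexp_osucc.
  by apply: ole_olt_trans (olt_succ _); apply: ole_zero.
apply: olt_wexp_natmul; exact/wexp_lt/olt_succ.
Qed.

(** The natural sum of [eta] and [omega], above every [lam j]. *)
Let lam_sup := nadd eta (wexp (osucc ozero)).

Lemma lam_lt j : olt (lam j) lam_sup.
Proof.
rewrite /lam; set m := j.*2.
have H : ole (iter m osucc eta) (nadd eta (natmul m (osucc ozero))).
  elim: m => [|m IH]; first exact: nadd_gel.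
  apply: osucc_ole; apply: ole_olt_trans IH _; apply: nadd_lt2l.
  apply: ole_olt_trans (nadd_ger ozero _) _; exact/nadd_lt2r/olt_succ.
apply: ole_olt_trans H _; apply: nadd_lt2l; apply: olt_wexp_natmul.
apply: ole_olt_trans (wexp_lt (olt_succ _)).
exact/osucc_ole/olt_wexp_zero.
Qed.

(** Passing to the next level takes [z] to the natural sum of [z + 1] and the bound on classes,
    which comes from the coarse comparison. These class bounds are below [omega ^ lam_sup], an
    additively closed ordinal, so [z] remains below it at all levels. *)
Lemma wbound_lfun_leinf j : exists2 z, olt z (wexp lam_sup) &
  olt bW (wexp z) /\ wbound leinf (wexp z) (lfun j).
Proof.
have lam_pos : olt ozero lam_sup by apply: ole_olt_trans (lam_lt 0); apply: ole_zero.
elim: j => [|j [z zlt [bz wz]]].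
  exists eta; last by split=> //; apply: wbound_le (oltW b0_eta) wL0.
  apply: ole_olt_trans (ole_wexp _) _; apply: wexp_lt; exact: (lam_lt 0).
set d := nadd bW (wexp z).
have d_lt : olt d (wexp (osucc z)).
  apply: olt_wexp_nadd; last exact/wexp_lt/olt_succ.
  by apply: olt_trans bz _; apply/wexp_lt/olt_succ.
set e := nadd bW (wexp (lam j)).
have wG : wbound leinf d (@gset R n j).
  apply: wbound_gset wz => w w' u u'; exact: powx_leinf.
have wGd : wbound dom e (@gset R n j).
  apply: wbound_gset (wbound_lfun_lei j (ltn0Sn 0)) => w w' u u'; exact: powx_dom.
have H := wbound_sums (@gset_nneg j) wG d_lt (fun _ H => H) wGd.
exists (nadd (osucc z) e).
  apply: olt_wexp_nadd; first exact: olt_wexp_osucc.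
  apply: olt_wexp_nadd; last exact/wexp_lt/lam_lt.
  apply: olt_trans bW_eta _; apply: wexp_lt; exact: (lam_lt 0).
split.
  apply: olt_ole_trans bz _; apply: wexp_le.
  exact: ole_trans (oltW (olt_succ _)) (nadd_gel _ _).
apply: (lfun_sums _ (@sumsS _ _) H).
move=> f f' g g' Ef Eg HC; apply: ev2 HC (ev_ge 2) _ => x HC x2.
by rewrite -Ef // -Eg.
Qed.

(** The levels are unbounded on the whole set, but bounded on the residual of each [t], and a bound
    of this kind only concerns residuals. *)
Lemma wbound_uset_step : wbound leinf (wexp (wexp lam_sup)) (uset n).
Proof.
apply/wboundP => _ [t /= tn <-].
have [j Hj] := uln_upper R t.
have [z zlt [_ wz]] := wbound_lfun_leinf j.+2.
(* A term of level above [j + 2] exceeds [t]: since [x >= 2], one extra power of [x] compensates for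
   the constant [ln 2 >= 1 / 2] in its lower bound. *)
apply: (@fcover_sub _ _ _ (lfun j.+2)); last first.
  by apply: fcover1; exists (wexp z) => //; apply: wexp_lt.
move=> _ [[u /= un <-] Nu]; exists u => //; split=> //.
rewrite leqNgt; apply/negP => lu; apply: Nu.
apply: ev1 (ev_ge 2) _ => x x2.
have x1 : 1 <= x by apply: le_trans x2; rewrite ler1n.
have x0 : 0 <= x by apply: le_trans x1.
rewrite -(@ler_ln R) ?posrE ?uev_gt0 //; apply: le_trans (Hj x x2) _.
have [k ek] : exists k, lev n u = k.+1 by exists (lev n u).-1; rewrite prednK //; lia.
apply: le_trans (uln_lev x2 n0 un ek).
have l2 := ln2_ge_half R.
apply: (@le_trans _ _ (x ^+ j * kpow n x)).
  by rewrite ler_wpM2l ?exprn_ge0 // kpow_le //; lia.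
rewrite mulrA ler_wpM2r ?kpow_ge0 //.
apply: (@le_trans _ _ (2^-1 * x ^+ k)); last by rewrite ler_wpM2r ?exprn_ge0.
apply: (@le_trans _ _ (2^-1 * x ^+ j.+1)).
  by rewrite exprS mulrA ler_peMl ?exprn_ge0 //; lra.
by rewrite ler_wpM2l // ler_weXn2l //; lia.
Qed.

End Level.

Lemma wbound_uset n : exists2 e, olt e epsilon0 & wbound leinf e (uset n).
Proof.
elim/ltn_ind: n => -[|n] IH.
  exists ozero; first exact: zero_epsilon0.
  apply/wboundP => _ [t /= t0 <-]; apply: fcover_sub (fcover0 _) => _ [[u /= u0 <-] []].
  by apply: evT => x; rewrite !uev_wt0 //; apply/eqP; rewrite -leqn0.
have [bW bWe wW] := @wbound_wterm n.+1 n.+1 (ltn0Sn n) (leqnn _) IH.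
have [b0 b0e wb0] := IH n (leqnn _).
pose eta := osucc (nadd bW b0).
have bW_eta : olt bW (wexp eta).
  apply: ole_olt_trans (ole_wexp _) _; apply: wexp_lt.
  exact: ole_olt_trans (nadd_gel _ _) (olt_succ _).
have b0_eta : olt b0 (wexp eta).
  apply: ole_olt_trans (ole_wexp _) _; apply: wexp_lt.
  exact: ole_olt_trans (nadd_ger _ _) (olt_succ _).
exists (wexp (wexp (nadd eta (wexp (osucc ozero))))).
  do 2 apply: wexp_epsilon0; apply: nadd_epsilon0.
    exact/osucc_epsilon0/nadd_epsilon0.
  exact/wexp_epsilon0/osucc_epsilon0/zero_epsilon0.
apply: (wbound_uset_step (ltn0Sn n) wW bW_eta b0_eta).
(* Level 0 at weight [n + 1] means weight at most [n], which induction covers. *)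
apply: wbound_sub wb0 => _ [t [tn lt] <-]; exists t => //=.
rewrite -ltnS ltn_neqAle tn andbT; apply/eqP => e.
by have := lev_ge1 (ltn0Sn n) e; rewrite ltnNge lt.
Qed.

End Counting.

(** * Hardy fields *)

Section Hardy.
Variable R : realType.
Local Notation fn := (R -> R).
Implicit Types (f g h a c y : fn) (K : set fn).

Definition evsign f : Prop :=
  ev (fun x => 0 < f x) \/ ev (fun x => f x = 0) \/ ev (fun x => f x < 0).

Definition evder f g : Prop := ev (fun x => is_derive (x : R) (1 : R) f (g x)).

(** Germs are represented by total functions, with closure under eventual equality. Inverses are
    unconditional: the zero germ is its own inverse, by [0^-1 = 0]. *)
Record hardy K : Prop := Hardy {
  hardy_cst : forall c : R, K (fun=> c);
  hardy_add : forall f g, K f -> K g -> K (f \+ g);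
  hardy_mul : forall f g, K f -> K g -> K (f \* g);
  hardy_inv : forall f, K f -> K (fun x => (f x)^-1);
  hardy_ext : forall f g, K f -> ev (fun x => f x = g x) -> K g;
  hardy_der : forall f, K f -> exists2 g, K g & evder f g;
  hardy_sign : forall f, K f -> evsign f
}.

Lemma evder_ext f f' g g' : ev (fun x => f x = f' x) -> ev (fun x => g x = g' x) ->
  evder f g -> evder f' g'.
Proof.
move=> [M HM] Hg Hd; apply: ev3 Hg Hd (ev_gt M) _ => x <- Hd xM.
apply: near_eq_is_derive Hd; near=> z; apply: HM; near: z.
exact: lt_nbhsr.
Unshelve. all: by end_near. Qed.

Lemma evder_add f f' g g' : evder f f' -> evder g g' -> evder (f \+ g) (f' \+ g').
Proof. by move=> H1 H2; apply: ev2 H1 H2 _ => x ? ?; apply: is_deriveD. Qed.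

Lemma evder_mul f f' g g' : evder f f' -> evder g g' ->
  evder (f \* g) (fun x => f x * g' x + g x * f' x).
Proof. by move=> H1 H2; apply: ev2 H1 H2 _ => x ? ?; apply: is_deriveM. Qed.

Lemma evder_inv f f' : ev (fun x => f x != 0) -> evder f f' ->
  evder (fun x => (f x)^-1) (fun x => - (f x) ^- 2 * f' x).
Proof. by move=> H1 H2; apply: ev2 H1 H2 _ => x ? ?; apply: is_deriveV. Qed.

Lemma evder_pow f f' n : evder f f' ->
  evder (fun x => f x ^+ n) (fun x => n%:R * f x ^+ n.-1 * f' x).
Proof.
move=> H; apply: ev1 H _ => x H; have := @is_deriveX R R f n x 1 (f' x) H.
by rewrite (_ : f ^+ n = (fun x => f x ^+ n)) //; apply/funext => z; rewrite fctE.
Qed.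

Lemma ev_mvt f f' : evder f f' -> exists M : R, forall a b : R, M < a -> a < b ->
  exists c : R, [/\ a < c, c < b & f b - f a = f' c * (b - a)].
Proof.
move=> [M HM]; exists M => a b Ma ab.
have [||c] := @MVT R f f' a b ab.
- by move=> x; rewrite in_itv /= => /andP[ax _]; apply/HM/(lt_trans Ma).
- apply: derivable_within_continuous => x; rewrite in_itv /= => /andP[ax _].
  by have [] := HM x (lt_le_trans Ma ax).
by rewrite in_itv /= => /andP[ac cb] E; exists c.
Qed.

Lemma evsign_ext f g : ev (fun x => f x = g x) -> evsign f -> evsign g.
Proof.
move=> E [H|[H|H]]; [left|right; left|right; right]; apply: ev2 E H _ => x ->//.
Qed.

Lemma evsign_neq0 f : evsign f -> ev (fun x => f x = 0) \/ ev (fun x => f x != 0).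
Proof.
by case=> [H|[H|H]]; [right|left|right] => //; apply: ev1 H _ => x; rewrite lt_neqAle;
  case/andP => //; rewrite eq_sym.
Qed.

Lemma sign_cases (c : R) : 0 < c \/ c = 0 \/ c < 0.
Proof.
have [c0|c0|->] := ltgtP c 0; [by right; right|by left|by right; left].
Qed.

Lemma evsign_mul f g : evsign f -> evsign g -> evsign (f \* g).
Proof.
move=> [H|[H|H]] H'; [|by right; left; apply: ev1 H _ => x /= ->; rewrite mul0r|].
  case: H' => [H'|[H'|H']]; [left|right; left|right; right]; apply: ev2 H H' _ => x /=.
  - exact: mulr_gt0.
  - by move=> _ ->; rewrite mulr0.
  - by move=> a b; rewrite pmulr_rlt0.
case: H' => [H'|[H'|H']]; [right; right|right; left|left]; apply: ev2 H H' _ => x /=.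
- by move=> a b; rewrite pmulr_llt0.
- by move=> _ ->; rewrite mulr0.
- by move=> a b; rewrite nmulr_rgt0.
Qed.

Lemma evsign_opp f : evsign f -> evsign (fun x => - f x).
Proof.
move=> [H|[H|H]]; [right; right|right; left|left]; apply: ev1 H _ => x.
- by rewrite oppr_lt0.
- by move=> ->; rewrite oppr0.
- by rewrite oppr_gt0.
Qed.

(** [f] is eventually strictly increasing: once nonnegative it is positive from there on, and
    otherwise it stays negative. *)
Lemma evsign_incr f f' : evder f f' -> ev (fun x => 0 < f' x) -> evsign f.
Proof.
move=> /ev_mvt[M HM] [N HN]; pose L := Num.max M N.
have incr (a b : R) : L < a -> a < b -> f a < f b.
  rewrite gt_max => /andP[Ma Na] ab; have [c [ac _ E]] := HM a b Ma ab.
  by rewrite -subr_gt0 E mulr_gt0 ?subr_gt0 // HN // (lt_trans Na).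
have [[a [La fa]]|H] := pselect (exists a : R, L < a /\ 0 <= f a).
  left; exists a => x ax; exact: le_lt_trans fa (incr _ _ La ax).
right; right; exists L => x Lx; rewrite ltNge; apply/negP => fx.
by apply: H; exists x.
Qed.

Lemma evsign_der f f' : evder f f' -> evsign f' -> evsign f.
Proof.
move=> Hd [H|[H|H]]; first exact: evsign_incr H.
  have [M HM] := ev_mvt Hd; case: H => N HN; pose L := Num.max M N.
  have cst b : L + 1 < b -> f b = f (L + 1).
    move=> Lb; have L1 : L < L + 1 by rewrite ltrDl.
    move: (L1); rewrite gt_max => /andP[ML NL].
    have [c [ac _ E]] := HM _ _ ML Lb.
    by apply/eqP; rewrite -subr_eq0 E HN ?mul0r // (lt_trans NL).
  have [fp|[f0|fn]] := sign_cases (f (L + 1)).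
  - by left; exists (L + 1) => x /cst ->.
  - by right; left; exists (L + 1) => x /cst ->.
  - by right; right; exists (L + 1) => x /cst ->.
have Hd' : evder (fun x => - f x) (fun x => - f' x).
  by apply: ev1 Hd _ => x ?; apply: is_deriveN.
have H' : ev (fun x => 0 < - f' x) by apply: ev1 H _ => x; rewrite oppr_gt0.
have := evsign_opp (evsign_incr Hd' H').
by apply: evsign_ext; apply: evT => x; rewrite opprK.
Qed.

(** * Adjoining a solution of [y' = alpha y + beta], for exponentials and primitives *)

Section Adjoin.
Variables (K : set fn) (y alpha beta : fn).
Hypothesis HK : hardy K.
Hypothesis Ka : K alpha.
Hypothesis Kb : K beta.
Hypothesis yder : evder y (fun x => alpha x * y x + beta x).

(** Polynomials in [y] over [K] of degree at most [d]; the leading coefficient may vanish. *)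
Fixpoint pol (d : nat) : set fn :=
  if d is e.+1 then
    [set f | exists a g, [/\ K a, pol e g & ev (fun x => f x = a x * y x ^+ e.+1 + g x)]]
  else K.

Let K0 : K (fun=> 0). Proof. exact: hardy_cst HK 0. Qed.

Lemma pol_ext d f g : ev (fun x => f x = g x) -> pol d f -> pol d g.
Proof.
case: d => [|d] fg; first by move=> Kf; apply: hardy_ext HK _ _ Kf fg.
move=> [a [h [Kah ph E]]]; exists a, h; split=> //.
by apply: ev2 fg E _ => x <-.
Qed.

Lemma pol_add d f g : pol d f -> pol d g -> pol d (f \+ g).
Proof.
elim: d f g => [|d IH] f g; first exact: (hardy_add HK).
move=> [a [f1 [Ka1 pf1 E1]]] [b [g1 [Kb1 pg1 E2]]].
exists (a \+ b), (f1 \+ g1); split; [exact: (hardy_add HK)|exact: IH|].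
by apply: ev2 E1 E2 _ => x /= -> ->; ring.
Qed.

Lemma pol_scale d c f : K c -> pol d f -> pol d (c \* f).
Proof.
move=> Kc; elim: d f => [|d IH] f; first exact: (hardy_mul HK).
move=> [a [f1 [Ka1 pf1 E1]]]; exists (c \* a), (c \* f1).
split; [exact: (hardy_mul HK)|exact: IH|].
by apply: ev1 E1 _ => x /= ->; ring.
Qed.

Lemma pol_up d f : pol d f -> pol d.+1 f.
Proof.
by move=> pf; exists (fun=> 0), f; split=> //; apply: evT => x; rewrite mul0r add0r.
Qed.

Lemma pol_le d e f : (d <= e)%N -> pol d f -> pol e f.
Proof. by move=> /subnK <-; elim: (e - d)%N => // k IH /IH /pol_up. Qed.

Lemma pol_y d f : pol d f -> pol d.+1 (y \* f).
Proof.
elim: d f => [|d IH] f.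
  move=> Kf; exists f, (fun=> 0); split=> //.
  by apply: evT => x /=; rewrite expr1 addr0 mulrC.
move=> [a [f1 [Ka1 pf1 E1]]]; exists a, (y \* f1); split=> //; first exact: IH.
by apply: ev1 E1 _ => x /= ->; rewrite !exprS; ring.
Qed.

Lemma pol_ypow k d f : pol d f -> pol (k + d) (fun x => y x ^+ k * f x).
Proof.
elim: k => [|k IH] pf.
  by apply: pol_ext pf; apply: evT => x; rewrite expr0 mul1r.
by apply: pol_ext (pol_y (IH pf)); apply: evT => x /=; rewrite exprS mulrA.
Qed.

Lemma pol_mul d e f g : pol d f -> pol e g -> pol (d + e) (f \* g).
Proof.
elim: d f => [|d IH] f; first exact: pol_scale.
move=> [a [f1 [Ka1 pf1 E1]]] pg.
have H1 := pol_scale Ka1 (pol_ypow d.+1 pg).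
have H2 := pol_up (IH _ pf1 pg).
apply: pol_ext (pol_add H1 H2).
by apply: ev1 E1 _ => x /= ->; ring.
Qed.

Lemma pol_der d f : pol d f -> exists2 g, pol d g & evder f g.
Proof.
elim: d f => [|d IH] f; first exact: (hardy_der HK).
move=> [a [f1 [Ka1 pf1 E1]]].
have [a' Ka' da] := hardy_der HK Ka1; have [f1' pf1' df1] := IH _ pf1.
have dy := evder_pow d.+1 yder.
have dall := evder_add (evder_mul da dy) df1.
pose A := a' \+ (fun x => d.+1%:R) \* (a \* alpha).
pose B := (fun x => d.+1%:R) \* (a \* beta).
have KA : K A.
  apply: (hardy_add HK) => //; apply: (hardy_mul HK); first exact: (hardy_cst HK).
  exact: (hardy_mul HK).
have KB : pol 0 B.
  apply: (hardy_mul HK); first exact: (hardy_cst HK).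
  exact: (hardy_mul HK).
exists (fun x => A x * y x ^+ d.+1 + (y x ^+ d * B x + f1' x)).
  exists A, (fun x => y x ^+ d * B x + f1' x); split=> //; last exact: evT.
  by apply: pol_add => //; rewrite -[X in pol X]addn0; apply: pol_ypow.
apply: evder_ext dall; first by apply: ev1 E1 _ => x /= ->.
by apply: evT => x; rewrite /A /B /= exprS; ring.
Qed.

(** Divided by its leading monomial, [f] becomes [1 + g1 / y ^ (d + 1)]. As [y' = alpha y], its
    derivative is [y ^ -(d + 1)] times a polynomial of degree at most [d], which has a sign by
    induction, and a sign of the derivative gives one of the function. *)
Lemma pol_sign_exp d f : ev (fun x => 0 < y x) -> ev (fun x => beta x = 0) ->
  pol d f -> evsign f.
Proof.
move=> y0 b0; elim: d f => [|d IH] f; first exact: (hardy_sign HK).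
move=> [a [g [Ka1 pg E]]].
have sgna := hardy_sign HK Ka1.
have [a0|aN0] := evsign_neq0 sgna.
  apply: evsign_ext (IH _ pg); apply: ev2 E a0 _ => x -> ->.
  by rewrite mul0r add0r.
pose g1 := (fun x => (a x)^-1) \* g.
have pg1 : pol d g1 by apply: pol_scale => //; apply: (hardy_inv HK).
have [g1' pg1' dg1] := pol_der pg1.
have yN0 : ev (fun x => y x ^+ d.+1 != 0).
  by apply: ev1 y0 _ => x yx; rewrite expf_neq0 // gt_eqF.
pose h := fun x => 1 + g1 x * (y x ^+ d.+1)^-1.
have dh := evder_mul dg1 (evder_inv yN0 (evder_pow d.+1 yder)).
pose num := g1' \+ ((fun=> - (d.+1%:R : R)) \* alpha) \* g1.
have snum : evsign num.
  apply: IH; apply: pol_add => //; apply: pol_scale => //.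
  by apply: (hardy_mul HK) => //; apply: (hardy_cst HK).
have dh' : evder h (fun x => num x * (y x ^+ d.+1)^-1).
  apply: evder_ext (evder_add (evT (fun x => is_derive_cst (1 : R) x 1)) dh).
    exact: evT.
  apply: ev2 y0 b0 _ => x yx bx; rewrite /num /= bx.
  rewrite [y x ^+ d.+1]exprS; set N := d.+1%:R; have A0 : y x ^+ d != 0 by rewrite expf_neq0 ?gt_eqF.
  by move: (y x ^+ d) A0 => A A0; field; rewrite A0 gt_eqF.
have yinv : evsign (fun x => (y x ^+ d.+1)^-1).
  by left; apply: ev1 y0 _ => x yx; rewrite invr_gt0 exprn_gt0.
have sh : evsign h by apply: evsign_der dh' (evsign_mul snum yinv).
have sy : evsign (fun x => y x ^+ d.+1).
  by left; apply: ev1 y0 _ => x yx; rewrite exprn_gt0.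
apply: evsign_ext (evsign_mul (evsign_mul sgna sy) sh).
apply: ev3 E aN0 yN0 _ => x /= -> ax yx; rewrite /h /g1 /=; field.
by rewrite ax yx.
Qed.

(** Divided by its leading coefficient, [f] becomes monic, and with [y'] in [K] differentiation
    lowers the degree. *)
Lemma pol_sign_prim d f : ev (fun x => alpha x = 0) -> pol d f -> evsign f.
Proof.
move=> al0; elim: d f => [|d IH] f; first exact: (hardy_sign HK).
move=> [a [g [Ka1 pg E]]].
have sgna := hardy_sign HK Ka1.
have [a0|aN0] := evsign_neq0 sgna.
  apply: evsign_ext (IH _ pg); apply: ev2 E a0 _ => x -> ->.
  by rewrite mul0r add0r.
pose g1 := (fun x => (a x)^-1) \* g.
have pg1 : pol d g1 by apply: pol_scale => //; apply: (hardy_inv HK).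
have [g1' pg1' dg1] := pol_der pg1.
have dh := evder_add (evder_pow d.+1 yder) dg1.
have pb : pol 0 ((fun=> d.+1%:R) \* beta).
  by apply: (hardy_mul HK) => //; apply: (hardy_cst HK).
have := pol_ypow d pb; rewrite addn0 => pb'.
have sh := evsign_der dh (evsign_ext _ (IH _ (pol_add pb' pg1'))).
apply: evsign_ext (evsign_mul sgna (sh _)).
  by apply: ev2 E aN0 _ => x /= -> ax; rewrite /g1 /=; field.
by apply: ev1 al0 _ => x /= ->; ring.
Qed.

Definition frac : set fn := [set f | exists d p q,
  [/\ pol d p, pol d q, ev (fun x => q x != 0) & ev (fun x => f x = p x / q x)]].

Lemma hardy_frac : (forall d f, pol d f -> evsign f) ->
  [/\ hardy frac, K `<=` frac & frac y].
Proof.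
move=> psign.
have K1 : K (fun=> 1) by apply: (hardy_cst HK).
have sub d f : pol d f -> frac f.
  move=> pf; exists d, f, (fun=> 1); split=> //; first by apply: (@pol_le 0).
    by apply: evT => x; rewrite oner_eq0.
  by apply: evT => x; rewrite divr1.
have subK : K `<=` frac by move=> f; apply: (sub 0%N).
split=> //; last first.
  apply: (sub 1%N); exists (fun=> 1), (fun=> 0); split=> //.
  by apply: evT => x; rewrite mul1r addr0 expr1.
split.
- by move=> c; apply/subK/(hardy_cst HK).
- move=> f g [d [p [q [pp pq q0 E]]]] [e [p' [q' [pp' pq' q0' E']]]].
  exists (d + e)%N, ((p \* q') \+ (q \* p')), (q \* q'); split.
  + by apply: pol_add; apply: pol_mul.
  + exact: pol_mul.
  + by apply: ev2 q0 q0' _ => x /= ? ?; rewrite mulf_neq0.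
  + apply: ev4 q0 q0' E E' _ => x /= ? ? -> ->; field.
    by apply/andP.
- move=> f g [d [p [q [pp pq q0 E]]]] [e [p' [q' [pp' pq' q0' E']]]].
  exists (d + e)%N, (p \* p'), (q \* q'); split.
  + exact: pol_mul.
  + exact: pol_mul.
  + by apply: ev2 q0 q0' _ => x /= ? ?; rewrite mulf_neq0.
  + apply: ev4 q0 q0' E E' _ => x /= ? ? -> ->; field.
    by apply/andP.
- move=> f [d [p [q [pp pq q0 E]]]].
  have [p0|p0] := evsign_neq0 (psign _ _ pp).
    exists 0%N, (fun=> 0), (fun=> 1); split=> //.
      by apply: evT => x; rewrite oner_eq0.
    by apply: ev2 p0 E _ => x -> ->; rewrite !mul0r invr0.
  exists d, q, p; split=> //.
  by apply: ev1 E _ => x ->; rewrite invfM invrK mulrC.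
- move=> f g [d [p [q [pp pq q0 E]]]] fg; exists d, p, q; split=> //.
  by apply: ev2 fg E _ => x <-.
- move=> f [d [p [q [pp pq q0 E]]]].
  have [p' pp' dp] := pol_der pp; have [q' pq' dq] := pol_der pq.
  exists (fun x => (p' x * q x - p x * q' x) / (q x * q x)).
    exists (d + d)%N, (fun x => p' x * q x - p x * q' x), (q \* q); split.
    + apply: pol_ext (pol_add (pol_mul pp' pq) (pol_scale (hardy_cst HK (-1)) (pol_mul pp pq'))).
      by apply: evT => x /=; ring.
    + exact: pol_mul.
    + by apply: ev1 q0 _ => x /= ?; rewrite mulf_neq0.
    + exact: evT.
  apply: evder_ext (evder_mul dp (evder_inv q0 dq)).
    by apply: ev1 E _ => x ->.
  by apply: ev1 q0 _ => x ? /=; field.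
- move=> f [d [p [q [pp pq q0 E]]]].
  have iq : evsign (fun x => (q x)^-1).
    case: (psign _ _ pq) => [H|[H|H]]; [left|right; left|right; right];
      apply: ev1 H _ => x; rewrite ?invr_gt0 ?invr_lt0 // => ->; by rewrite invr0.
  apply: evsign_ext (evsign_mul (psign _ _ pp) iq).
  by apply: ev1 E _ => x ->.
Qed.

End Adjoin.

Lemma hardy_adjoin_prim K y b : hardy K -> K b -> evder y b ->
  exists K', [/\ hardy K', K `<=` K' & K' y].
Proof.
move=> HK Kb yb; have Kz := hardy_cst HK 0.
have yder : evder y (fun x => (fun=> 0) x * y x + b x).
  by apply: evder_ext yb; apply: evT => x //; rewrite mul0r add0r.
exists (frac K y); apply: (hardy_frac HK Kz Kb yder) => d f.
by apply: (pol_sign_prim HK Kz Kb yder); apply: evT.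
Qed.

Lemma hardy_adjoin_exp K f : hardy K -> K f ->
  exists K', [/\ hardy K', K `<=` K' & K' (fun x => expR (f x))].
Proof.
move=> HK Kf; have Kz := hardy_cst HK 0; have [f' Kf' df] := hardy_der HK Kf.
have yder : evder (fun x => expR (f x)) (fun x => f' x * expR (f x) + (fun=> 0) x).
  apply: ev1 df _ => x df; have := is_derive1_comp (is_derive_expR (f x)) df.
  by rewrite addr0 mulrC.
exists (frac K (fun x => expR (f x))); apply: (hardy_frac HK Kf' Kz yder) => d g.
apply: (pol_sign_exp HK Kf' Kz yder); last exact: evT.
by apply: evT => x; apply: expR_gt0.
Qed.

Lemma hardy_adjoin_ln K f : hardy K -> K f -> ev (fun x => 0 < f x) ->
  exists K', [/\ hardy K', K `<=` K' & K' (fun x => ln (f x))].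
Proof.
move=> HK Kf f0; have [f' Kf' df] := hardy_der HK Kf.
apply: (@hardy_adjoin_prim K _ ((fun x => (f x)^-1) \* f')) => //.
  by apply: (hardy_mul HK) => //; apply: (hardy_inv HK).
by apply: ev2 df f0 _ => x df fx; apply: is_derive1_comp (is_derive1_ln fx) df.
Qed.

Lemma hardy_id : exists2 K : set fn, hardy K & K id.
Proof.
pose K : set fn := [set f | exists c : R, ev (fun x => f x = c)].
have HK : hardy K.
  split.
  - by move=> c; exists c; apply: evT.
  - by move=> f g [c E] [d E']; exists (c + d); apply: ev2 E E' _ => x /= -> ->.
  - by move=> f g [c E] [d E']; exists (c * d); apply: ev2 E E' _ => x /= -> ->.
  - by move=> f [c E]; exists c^-1; apply: ev1 E _ => x ->.
  - by move=> f g [c E] fg; exists c; apply: ev2 E fg _ => x -> ->.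
  - move=> f [c E]; exists (fun=> 0); first by exists 0; apply: evT.
    apply: (@evder_ext (fun=> c) _ (fun=> 0)); [|exact: evT|].
      by apply: ev1 E _ => x ->.
    by apply: evT => x; apply: is_derive_cst.
  - move=> f [c E]; have [c0|[c0|c0]] := sign_cases c.
    + by left; apply: ev1 E _ => x ->.
    + by right; left; apply: ev1 E _ => x ->.
    + by right; right; apply: ev1 E _ => x ->.
have [K' [HK' _ Kid]] := @hardy_adjoin_prim K id (fun=> 1) HK (hardy_cst HK 1)
  (evT (fun x => is_derive_id x 1)).
by exists K'.
Qed.

End Hardy.

(** * Skolem terms *)

Inductive st : Type := SOne | SX | SAdd of st & st | SMul of st & st | SPow of st & st.

Section SkolemTerms.
Variable R : realType.
Local Notation fn := (R -> R).

Fixpoint sev (t : st) (x : R) : R :=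
  match t with
  | SOne => 1
  | SX => x
  | SAdd a b => sev a x + sev b x
  | SMul a b => sev a x * sev b x
  | SPow a b => sev a x `^ sev b x
  end.

Lemma Sk_term (f : {posnum R} -> {posnum R}) : Sk f ->
  exists t, forall x, (f x)%:num = sev t x%:num.
Proof.
elim=> [||g h _ [a Ea] _ [b Eb]|g h _ [a Ea] _ [b Eb]|g h _ [a Ea] _ [b Eb]].
- by exists SOne.
- by exists SX.
- by exists (SAdd a b) => x /=; rewrite -Ea -Eb.
- by exists (SMul a b) => x /=; rewrite -Ea -Eb.
- by exists (SPow a b) => x /=; rewrite -Ea -Eb.
Qed.

Lemma powRE (a b : R) : 0 < a -> a `^ b = expR (b * ln a).
Proof. by move=> a0; rewrite /powR gt_eqF. Qed.

Lemma sev_gt0 t x : 0 < x -> 0 < sev t x.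
Proof.
move=> x0; elim: t => //= [a IHa b IHb|a IHa b IHb|a IHa b IHb].
- exact: addr_gt0.
- exact: mulr_gt0.
- exact: powR_gt0.
Qed.

Lemma sev_ge1 t x : 1 <= x -> 1 <= sev t x.
Proof.
move=> x1; elim: t => //= [a IHa b IHb|a IHa b IHb|a IHa b IHb].
- by apply: le_trans IHa _; rewrite lerDl (le_trans _ IHb).
- exact: mulr_ege1.
- have a0 : 0 < sev a x by apply: lt_le_trans IHa.
  by rewrite powRE // -[leLHS]expR0 ler_expR mulr_ge0 ?ln_ge0 // (le_trans _ IHb).
Qed.

(** Separates the base 1, whose powers say nothing about the exponent, from bases at least 2, for
    which a bound on [a ^ b] is a bound on [b]. *)
Lemma sev_dich t : (forall x : R, 2 <= x -> sev t x = 1) \/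
  (forall x : R, 2 <= x -> 2 <= sev t x).
Proof.
have x1 (x : R) : 2 <= x -> 1 <= x by apply: le_trans; rewrite ler1n.
elim: t => /= [||a IHa b IHb|a [IHa|IHa] b [IHb|IHb]|a [IHa|IHa] b IHb].
- by left.
- by right.
- right=> x x2; rewrite (natrD _ 1 1); apply: lerD; exact/sev_ge1/x1.
- by left=> x x2; rewrite IHa // IHb // mulr1.
- by right=> x x2; rewrite IHa // mul1r IHb.
- by right=> x x2; rewrite IHb // mulr1 IHa.
- right=> x x2; apply: le_trans (IHa x x2) _; rewrite ler_peMr ?sev_ge1 ?x1 //.
  by rewrite ltW // sev_gt0 // (lt_le_trans _ x2).
- by left=> x x2; rewrite IHa // powR1.
- right=> x x2; apply: le_trans (IHa x x2) _.
  have a1 := sev_ge1 a (x1 x x2); have b1 := sev_ge1 b (x1 x x2).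
  exact: le1r_powR.
Qed.

(** A pair [(k, a)] stands for [(k + 1) ^ x * x ^ a]. Skolem functions below [x ^ x] are sums of
    these, and they are the exponents that occur below [2 ^ (x ^ x)]. *)
Definition hev (s : seq (nat * nat)) (x : R) : R :=
  \sum_(p <- s) kpow p.1.+1 x * x ^+ p.2.

Lemma hev_cat s s' x : hev (s ++ s') x = hev s x + hev s' x.
Proof. by rewrite /hev big_cat. Qed.

Lemma hev_mul s s' : exists s'', forall x, hev s'' x = hev s x * hev s' x.
Proof.
elim: s => [|[k a] s [s1 IH]].
  by exists [::] => x; rewrite /hev big_nil mul0r.
exists ([seq ((k.+1 * p.1.+1)%N.-1, (a + p.2)%N) | p <- s'] ++ s1) => x.
rewrite hev_cat IH [hev (_ :: _) x]/hev big_cons mulrDl; congr (_ + _).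
rewrite /hev big_map mulr_sumr; apply: eq_bigr => -[k' a'] _.
by rewrite [in LHS]prednK ?muln_gt0 // kpowM // exprD /=; ring.
Qed.

Lemma hev_pow s n : exists s', forall x, hev s' x = hev s x ^+ n.
Proof.
elim: n => [|n [s1 IH]].
  by exists [:: (0, 0)%N] => x; rewrite /hev big_seq1 /= kpow1 expr0 mulr1.
by have [s2 E] := hev_mul s s1; exists s2 => x; rewrite E IH exprS.
Qed.

Lemma hev_term s p (x : R) : 0 <= x -> List.In p s -> kpow p.1.+1 x * x ^+ p.2 <= hev s x.
Proof.
move=> x0; have ge0 s' : 0 <= hev s' x.
  by apply: sumr_ge0 => q _; rewrite mulr_ge0 ?kpow_ge0 ?exprn_ge0.
elim: s => [//|q s IH] /= [->|/IH H]; rewrite /hev big_cons -/(hev s x).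
  by rewrite lerDl.
by apply: le_trans H _; rewrite lerDr mulr_ge0 ?kpow_ge0 ?exprn_ge0.
Qed.

Lemma ev_false (P : R -> Prop) : ev P -> (forall x, P x -> False) -> False.
Proof. by move=> /ev_ex[x Px] H; apply: H Px. Qed.

(** A summand other than [1] and [x] is at least [2 ^ x] or [x ^ 2], too large for the bound
    [x * ln x / ln 2]. *)
Lemma hev_linear s : ev (fun x => ln 2 * hev s x <= x * ln x) ->
  exists m n : nat, forall x, hev s x = m%:R * x + n%:R.
Proof.
move=> H; have {H} small p : List.In p s -> (p.1 == 0)%N && (p.2 <= 1)%N.
  move=> ps; have l2 := ln2_gt0 R.
  have hs : ev (fun x : R => ln 2 * (kpow p.1.+1 x * x ^+ p.2) <= x * ln x).
    apply: ev2 H (ev_gt 0) _ => x H x0; apply: le_trans H; rewrite ler_pM2l //.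
    exact: hev_term (ltW x0) ps.
  apply/andP; split; apply/negPn/negP => Hn.
    have k0 : (0 < p.1)%N by rewrite lt0n.
    apply: (ev_false (ev4 hs (poly_lt_exp (2 / ln 2) 2 l2) (ev_ge 1) (ev_gt 0)
      (fun x a b c d => conj a (conj b (conj c d))))) => x [H1 [H2 [x1 x0]]].
    have lx := ltW (ln_sublinear x0).
    have k2 : kpow 2 x <= kpow p.1.+1 x * x ^+ p.2.
      apply: le_trans (kpow_le (ltW x0) (isT : (0 < 2)%N) (k0 : (2 <= p.1.+1)%N)) _.
      by rewrite ler_peMr ?kpow_ge0 // exprn_ege1.
    have H3 : 2 * x ^+ 2 <= ln 2 * kpow 2 x.
      move: H2; rewrite [ln 2 * x]mulrC -/(kpow 2 x) mulrAC ler_pdivrMr //.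
      by rewrite mulrC [_ * ln 2]mulrC.
    have H4 : ln 2 * kpow 2 x <= x * x.
      apply: le_trans (le_trans _ H1) _; first by rewrite ler_pM2l.
      by rewrite ler_pM2l.
    have x2 : 1 <= x ^+ 2 by rewrite exprn_ege1.
    by move: H3 H4 x2; rewrite expr2; lra.
  rewrite -ltnNge in Hn.
  have e0 : 0 < ln (2 : R) / 2 by rewrite divr_gt0.
  apply: (ev_false (ev3 hs (ln_small e0) (ev_ge 1)
    (fun x a b c => conj a (conj b c)))) => x [H1 [H2 x1]].
  have x0 : 0 < x by apply: lt_le_trans x1.
  have H3 : x * x <= kpow p.1.+1 x * x ^+ p.2.
    rewrite -[leLHS]mul1r; apply: ler_pM => //; first by rewrite mulr_ge0 // ltW.
      by rewrite kpow_ge1 // ltW.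
    by rewrite -expr2 ler_weXn2l.
  have H4 : ln 2 * (x * x) <= x * ln x by apply: le_trans H1; rewrite ler_pM2l ?ln2_gt0.
  have H5 : x * ln x <= x * (ln 2 / 2 * x) by rewrite ler_pM2l.
  have xx : 0 < ln 2 * (x * x) by rewrite !mulr_gt0 ?ln2_gt0.
  by lra.
elim: s small => [|[k a] s IH] small.
  by exists 0%N, 0%N => x; rewrite /hev big_nil mul0r addr0.
have [p ps|m [n E]] := IH; first by apply: small; right.
have := small (k, a) (or_introl erefl) => /= /andP[/eqP->].
case: a {small} => [|[|//]] _.
  exists m, n.+1 => x; rewrite /hev big_cons -/(hev s x) E /= kpow1 expr0 -natr1; ring.
by exists m.+1, n => x; rewrite /hev big_cons -/(hev s x) E /= kpow1 expr1 -natr1; ring.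
Qed.

Lemma hev_const s : ev (fun x => hev s x < x) -> exists c : nat, forall x, hev s x = c%:R.
Proof.
move=> H; have {H} small p : List.In p s -> (p.1 == 0)%N && (p.2 == 0)%N.
  move=> ps; apply/negPn/negP => Hn.
  apply: (ev_false (ev4 H (ev_ge 1) (poly_lt_exp 1 1 (ln2_gt0 R)) (ev_gt 0)
    (fun x a b c d => conj a (conj b (conj c d))))) => x [H1 [x1 [H2 x0]]].
  have := hev_term (ltW x0) ps; apply/negP; rewrite -ltNge; apply: lt_le_trans H1 _.
  case: p {ps} Hn => [[|k] [|a]] //= _.
  - by rewrite kpow1 mul1r exprS ler_peMr ?exprn_ege1 // ltW.
  - rewrite expr0 mulr1; apply: le_trans (_ : kpow 2 x <= _); last exact: kpow_le (ltW x0) _ _.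
    by move: H2; rewrite mul1r expr1 /kpow mulrC.
  - rewrite exprS mulrCA ler_peMr ?(ltW x0) // mulr_ege1 ?kpow_ge1 ?(ltW x0) //.
    by rewrite exprn_ege1.
elim: s small => [|[k a] s IH] small; first by exists 0%N => x; rewrite /hev big_nil.
have [p ps|c E] := IH; first by apply: small; right.
have := small (k, a) (or_introl erefl) => /= /andP[/eqP-> /eqP->].
by exists c.+1 => x; rewrite /hev big_cons -/(hev s x) E /= kpow1 expr0 -natr1 mulr1 addrC.
Qed.

Definition xx (x : R) : R := expR (x * ln x).

(** In a power [a ^ b] with [a >= 2] the exponent is at most [x * ln x / ln 2], hence of the form
    [m * x + n]. For [m = 0] this is an ordinary natural power. For [m > 0] the base is below [x],
    hence a constant [c], and the power is [c ^ n] copies of [(c ^ m) ^ x]. *)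
Lemma sev_below_xx t : ev (fun x => sev t x < xx x) ->
  exists s, forall x : R, 2 <= x -> sev t x = hev s x.
Proof.
have ge1 t' : ev (fun x : R => 1 <= sev t' x).
  by apply: ev1 (ev_ge 1) _ => x; apply: sev_ge1.
elim: t => /= [||a IHa b IHb|a IHa b IHb|a IHa b IHb] H.
- by exists [:: (0, 0)%N] => x _; rewrite /hev big_seq1 /= kpow1 expr0 mulr1.
- by exists [:: (0, 1)%N] => x _; rewrite /hev big_seq1 /= kpow1 expr1 mul1r.
- have [|sa Ea] := IHa; first by apply: ev2 H (ge1 b) _ => x; lra.
  have [|sb Eb] := IHb; first by apply: ev2 H (ge1 a) _ => x; lra.
  by exists (sa ++ sb) => x x2; rewrite hev_cat Ea // Eb.
- have [|sa Ea] := IHa.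
    apply: ev3 H (ge1 a) (ge1 b) _ => x H a1 b1; apply: le_lt_trans H.
    by rewrite ler_peMr // (le_trans _ a1).
  have [|sb Eb] := IHb.
    apply: ev3 H (ge1 a) (ge1 b) _ => x H a1 b1; apply: le_lt_trans H.
    by rewrite ler_peMl // (le_trans _ b1).
  by have [s E] := hev_mul sa sb; exists s => x x2; rewrite E Ea // Eb.
have [a1|a2] := sev_dich a.
  exists [:: (0, 0)%N] => x x2; rewrite a1 // powR1.
  by rewrite /hev big_seq1 /= kpow1 expr0 mulr1.
have Hl : ev (fun x => sev b x * ln (sev a x) < x * ln x).
  apply: ev2 H (ev_ge 2) _ => x H x2; move: H.
  by rewrite powRE ?sev_gt0 ?(lt_le_trans _ x2) // ltr_expR.
have Hb : ev (fun x => ln 2 * sev b x <= x * ln x).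
  apply: ev3 Hl (ge1 b) (ev_ge 2) _ => x Hx b1 x2; apply: le_trans (ltW Hx).
  have a0 : 0 < sev a x by rewrite sev_gt0 // (lt_le_trans _ x2).
  by rewrite mulrC ler_wpM2l ?(le_trans _ b1) // ler_ln ?posrE ?ltr0n // a2.
have [|sb Eb] := IHb.
  (* With [y = x * ln x >= 4] one has [b <= 2 * y < 1 + y ^ 2 / 2 <= exp y]. *)
  apply: ev3 Hb (ev_ge 4) (ln_large 1) _ => x Hb' x4 l1.
  have y4 : 4 <= x * ln x by rewrite -[leLHS]mulr1 ler_pM.
  have y0 : 0 <= x * ln x by apply: le_trans y4.
  apply: lt_le_trans (expR_ge1Dxn 1 y0); rewrite expr2.
  have b0 : 0 <= sev b x by rewrite ltW // sev_gt0 // (lt_le_trans _ x4).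
  have b2 : sev b x <= 2 * (x * ln x).
    rewrite -ler_pdivrMl ?ltr0n //; apply: le_trans Hb'.
    by rewrite ler_wpM2r // ln2_ge_half.
  apply: le_lt_trans b2 _; rewrite (_ : 2`!%:R = 2 :> R) //.
  by move: (x * ln x) y4 => y y4; nra.
have Hb2 : ev (fun x => ln 2 * hev sb x <= x * ln x).
  by apply: ev2 Hb (ev_ge 2) _ => x Hx x2; rewrite -Eb.
have [m [n E]] := hev_linear Hb2.
have [|sa Ea] := IHa.
  apply: ev3 H (ge1 a) (ge1 b) _ => x H a1 b1; apply: le_lt_trans H.
  exact: le1r_powR.
case: m E => [|m] E.
  have [s Es] := hev_pow sa n; exists s => x x2.
  rewrite Eb // E mul0r add0r powR_mulrn ?Es ?Ea // -Ea // ltW // sev_gt0 //.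
  exact: lt_le_trans x2.
have Hax : ev (fun x => hev sa x < x).
  apply: ev3 Hl (ev_ge 2) (ge1 a) _ => x Hl' x2 a1.
  have x0 : 0 < x by apply: lt_le_trans x2.
  have a0 : 0 < sev a x by apply: sev_gt0.
  rewrite -Ea // -ltr_ln ?posrE // -(ltr_pM2l x0); apply: le_lt_trans Hl'.
  rewrite ler_wpM2r ?ln_ge0 // Eb // E -natr1 mulrDl mul1r -addrA addrCA lerDl.
  by rewrite addr_ge0 // mulr_ge0 // ltW.
have [c Ec] := hev_const Hax.
have ac (x : R) : 2 <= x -> sev a x = c%:R by move=> x2; rewrite Ea // Ec.
have c0 : (0 < c)%N.
  rewrite -(ltr0n R) -(ac 2 (lexx _)); exact: sev_gt0.
exists (nseq (c ^ n) ((c ^ m.+1).-1, 0%N)) => x x2.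
have hn N p : hev (nseq N p) x = N%:R * (kpow p.1.+1 x * x ^+ p.2).
  elim: N => [|N IHN]; first by rewrite /hev big_nil mul0r.
  by rewrite /hev big_cons -/(hev _ x) IHN -natr1; ring.
rewrite hn [in RHS]prednK ?expn_gt0 ?c0 // expr0 mulr1 ac // Eb // E.
have cR : 0 < c%:R :> R by rewrite ltr0n.
rewrite powRE // /kpow !natrX lnXn // mulrDl expRD expRM_natl lnK ?posrE // mulrC.
by congr (_ * expR _); rewrite -mulr_natl; ring.
Qed.

(** A base other than 1 is at least 2, so the exponent is below [x ^ x] and is a sum of functions
    [k ^ x * x ^ j]. The power splits into factors [a ^ (k ^ x)], each raised [j] times to the power
    [x]. *)
Lemma sev_below_two_xx t : ev (fun x => sev t x < expR (xx x * ln 2)) ->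
  exists u, forall x : R, 2 <= x -> sev t x = uev u x.
Proof.
have ge1 t' : ev (fun x : R => 1 <= sev t' x).
  by apply: ev1 (ev_ge 1) _ => x; apply: sev_ge1.
elim: t => /= [||a IHa b IHb|a IHa b IHb|a IHa b IHb] H.
- by exists UOne.
- by exists UX.
- have [|ua Ea] := IHa; first by apply: ev2 H (ge1 b) _ => x; lra.
  have [|ub Eb] := IHb; first by apply: ev2 H (ge1 a) _ => x; lra.
  by exists (UAdd ua ub) => x x2 /=; rewrite Ea // Eb.
- have [|ua Ea] := IHa.
    apply: ev3 H (ge1 a) (ge1 b) _ => x H a1 b1; apply: le_lt_trans H.
    by rewrite ler_peMr // (le_trans _ a1).
  have [|ub Eb] := IHb.
    apply: ev3 H (ge1 a) (ge1 b) _ => x H a1 b1; apply: le_lt_trans H.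
    by rewrite ler_peMl // (le_trans _ b1).
  by exists (UMul ua ub) => x x2 /=; rewrite Ea // Eb.
have [a1|a2] := sev_dich a.
  by exists UOne => x x2; rewrite a1 // powR1.
have Hb : ev (fun x => sev b x < xx x).
  apply: ev3 H (ge1 b) (ev_ge 2) _ => x H b1 x2; move: H.
  have a0 : 0 < sev a x by rewrite sev_gt0 ?(lt_le_trans _ x2).
  rewrite powRE // ltr_expR => H.
  rewrite -(ltr_pM2r (ln2_gt0 R)); apply: le_lt_trans H.
  by rewrite ler_wpM2l ?(le_trans _ b1) // ler_ln ?posrE ?ltr0n // a2.
have [s Es] := sev_below_xx Hb.
have [|ua Ea] := IHa.
  apply: ev3 H (ge1 a) (ge1 b) _ => x H a1 b1; apply: le_lt_trans H.
  exact: le1r_powR.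
pose pt (p : nat * nat) :=
  iter p.2 UPowX (if p.1 is k.+1 then UPowK k ua else ua).
have ptE p x : 2 <= x -> uev (pt p) x = expR (kpow p.1.+1 x * x ^+ p.2 * ln (uev ua x)).
  move=> x2; rewrite /pt; elim: p.2 => [|j IHj] /=; last first.
    by rewrite IHj expRK exprS; congr expR; ring.
  rewrite expr0 mulr1; case: p.1 => [|k] //=.
  by rewrite kpow1 mul1r lnK // posrE uev_gt0.
exists (foldr (fun p => UMul (pt p)) UOne s) => x x2.
rewrite Es // powRE ?sev_gt0 ?(lt_le_trans _ x2) // Ea //.
elim: s {Es} => [|p s IHs] /=; first by rewrite /hev big_nil mul0r expR0.
by rewrite -IHs ptE // /hev big_cons mulrDl expRD.
Qed.

(** * Totality of the order on Skolem functions *)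

Lemma sev_analytic t (c : R) : 0 < c -> analytic (fun h => sev t (c + h)).
Proof.
move=> c0; elim: t => /= [||a IHa b IHb|a IHa b IHb|a IHa b IHb].
- exact: analytic_cst.
- exact: analytic_add (analytic_cst c) (@analytic_id R).
- exact: analytic_add.
- exact: analytic_mul.
have a0 : 0 < sev a (c + 0) by rewrite addr0 sev_gt0.
apply: (analytic_ext c0 _ (analytic_exp (analytic_mul IHb (analytic_ln a0 IHa)))).
move=> h; rewrite ltr_norml => /andP[h1 h2].
by rewrite powRE // sev_gt0 //; lra.
Qed.

(** Consider the supremum [s] of the points from [x1] on where the two functions differ. If the
    difference vanishes near [s], there are no such points close to [s]; if it has a first nonzero
    coefficient at [s], it cannot vanish to the right of [s]. *)
Lemma sev_identity t t' : ev (fun x => sev t x = sev t' x) ->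
  forall x : R, 0 < x -> sev t x = sev t' x.
Proof.
move=> [M HM] x1 x10; apply: contrapT => Nx1.
pose S := [set c : R | x1 <= c /\ sev t c <> sev t' c].
have S0 : S x1 by split.
have Sub : ubound S M.
  by move=> c [_ Nc]; rewrite leNgt; apply/negP => /HM.
have hS : has_sup S by split; [exists x1|exists M].
pose s := sup S.
have sx1 : x1 <= s by apply: ub_le_sup => //; exists M.
have s0 : 0 < s by apply: lt_le_trans sx1.
have after c : s < c -> sev t c = sev t' c.
  move=> sc; apply: contrapT => Nc.
  have : c <= s by apply: ub_le_sup; [exists M|split=> //; apply: le_trans sx1 (ltW sc)].
  by rewrite leNgt sc.
have aD : analytic (fun h => sev t (s + h) + (-1) * sev t' (s + h)).
  by apply: analytic_add; [|apply: analytic_scale]; apply: sev_analytic.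
have [[r r0 H]|[k [a [K [r [a0 r0 K0 H]]]]]] := analytic_dich aD.
  have [c [x1c Nc] rc] := sup_adherent r0 hS.
  have cs : c <= s by apply: ub_le_sup; [exists M|split].
  have E0 : s + (c - s) = c by ring.
  apply: Nc; have := H (c - s); rewrite E0 mulN1r => E.
  apply/eqP; rewrite -subr_eq0; apply/eqP; rewrite E // ler0_norm ?subr_le0 // opprB.
  by rewrite ltrBlDr -ltrBlDl.
(* Small enough for [h * K] to stay below [|a|], so that [a + h * z] is not 0. *)
pose h := Num.min (r / 2) (`|a| / (2 * (K + 1))).
have K1 : 0 < K + 1 by rewrite ltr_wpDl.
have h0 : 0 < h by rewrite lt_min !divr_gt0 ?normr_gt0 ?mulr_gt0.
have hr : `|h| < r.
  by rewrite gtr0_norm // (le_lt_trans (_ : _ <= r / 2)) ?ge_min ?lexx //; lra.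
have [z Ez zK] := H h hr.
have sh : s < s + h by rewrite ltrDl.
move: Ez; rewrite (after _ sh) mulN1r subrr => /esym/eqP; rewrite mulf_eq0.
rewrite expf_eq0 gt_eqF // andbF /= addr_eq0 => /eqP az.
have : `|a| < `|a|.
  rewrite {1}az normrN normrM gtr0_norm //.
  apply: le_lt_trans (ler_pM _ _ (lexx h) zK) _ => //; first exact: ltW.
  have hK : h * (K + 1) <= `|a| / 2.
    rewrite -ler_pdivlMr // -mulrA -invfM mulrC.
    by rewrite ge_min [_ / (2 * _)]mulrC lexx orbT.
  have : 0 < `|a| by rewrite normr_gt0.
  by move: hK; rewrite mulrDr mulr1; lra.
by rewrite ltxx.
Qed.

Lemma sev_hardy t (K : set fn) : hardy K -> K id ->
  exists K', [/\ hardy K', K `<=` K' & K' (sev t)].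
Proof.
elim: t K => /= [||a IHa b IHb|a IHa b IHb|a IHa b IHb] K HK Kid.
- by exists K; split=> //; apply: (hardy_cst HK).
- by exists K; split.
- have [K1 [H1 s1 k1]] := IHa K HK Kid; have [K2 [H2 s2 k2]] := IHb K1 H1 (s1 _ Kid).
  exists K2; split=> //; first exact: subset_trans s1 s2.
  by apply: (hardy_add H2) => //; apply: s2.
- have [K1 [H1 s1 k1]] := IHa K HK Kid; have [K2 [H2 s2 k2]] := IHb K1 H1 (s1 _ Kid).
  exists K2; split=> //; first exact: subset_trans s1 s2.
  by apply: (hardy_mul H2) => //; apply: s2.
have [K1 [H1 s1 k1]] := IHa K HK Kid; have [K2 [H2 s2 k2]] := IHb K1 H1 (s1 _ Kid).
have a0 : ev (fun x : R => 0 < sev a x).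
  by apply: ev1 (ev_gt 0) _ => x; apply: sev_gt0.
have [K3 [H3 s3 k3]] := hardy_adjoin_ln H2 (s2 _ k1) a0.
have [K4 [H4 s4 k4]] := hardy_adjoin_exp H3 (hardy_mul H3 (s3 _ k2) k3).
exists K4; split=> //.
  exact: subset_trans s1 (subset_trans s2 (subset_trans s3 s4)).
apply: hardy_ext H4 _ _ k4 _.
by apply: ev1 a0 _ => x a0 /=; rewrite powRE.
Qed.

Lemma sev_trichotomy t t' : [\/ ev (fun x : R => sev t x < sev t' x),
  forall x : R, 0 < x -> sev t x = sev t' x | ev (fun x : R => sev t' x < sev t x)].
Proof.
have [K HK Kid] := hardy_id R.
have [K1 [H1 s1 k1]] := sev_hardy t HK Kid.
have [K2 [H2 s2 k2]] := sev_hardy t' H1 (s1 _ Kid).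
have := hardy_sign H2 (hardy_add H2 (s2 _ k1) (hardy_mul H2 (hardy_cst H2 (-1)) k2)).
move=> [H|[H|H]].
- by apply: Or33; apply: ev1 H _ => x /=; lra.
- by apply: Or32; apply: sev_identity; apply: ev1 H _ => x /=; lra.
- by apply: Or31; apply: ev1 H _ => x /=; lra.
Qed.

End SkolemTerms.

(** * The order type *)

Section Rank.
Variables (T : Type) (A : set T) (lt : T -> T -> Prop).
Hypothesis lt_trans : forall x y z, lt x y -> lt y z -> lt x z.
Hypothesis lt_total : forall x y, A x -> A y -> [\/ lt x y, x = y | lt y x].

Let nlt x y := ~ lt y x.
Let below x := [set y | A y /\ lt y x].

Variable e : ord.
Hypothesis bounded : forall x, A x -> exists2 b, olt b e & obound nlt b (below x).

Let r y x := [/\ A y, A x & lt y x].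

Lemma obound_below b x y : r y x -> obound nlt b (below x) ->
  exists2 b', olt b' b & obound nlt b' (below y).
Proof.
case: b => J f [Ay Ax yx] /(_ y (conj Ay yx)) [j Hj].
exists (f j); first exact: olt_index.
apply: obound_sub Hj => z [Az zy]; split; first by split=> //; apply: lt_trans yx.
by move=> /(_ zy).
Qed.

(** The bound on the type below a point strictly decreases along [r], so induction on the tree that
    serves as bound gives accessibility. *)
Lemma r_wf : well_founded r.
Proof.
suff H b x : A x -> obound nlt b (below x) -> Acc r x.
  move=> x; constructor=> y [Ay _ _]; have [b _ Hb] := bounded Ay.
  exact: H Hb.
elim: b x => J f IH x Ax bx; constructor=> y yx.
have [b [j bj] Hb] := obound_below yx bx.
by case: yx => Ay _ _; apply: (IH j) => //; apply: obound_le bj Hb.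
Qed.

Definition rank : T -> ord :=
  Fix r_wf (fun=> ord) (fun x rec => Ord (fun p : {y | r y x} => rec (sval p) (svalP p))).

Lemma rankE x : rank x = Ord (fun p : {y | r y x} => rank (sval p)).
Proof.
rewrite /rank Fix_eq // => y f g H; congr Ord.
by apply/funext => p; apply: H.
Qed.

Lemma rank_lt x y : r y x -> olt (rank y) (rank x).
Proof.
by move=> yx; rewrite (rankE x); apply: (olt_index (fun p : {y | r y x} => rank (sval p)) (exist _ y yx)).
Qed.

Lemma rank_le b x : A x -> obound nlt b (below x) -> ole (rank x) b.
Proof.
elim: b x => J f IH x Ax bx; rewrite rankE => -[y yx] /=.
have [b [j bj] Hb] := obound_below yx bx; exists j.
by case: (yx) => Ay _ _; apply: IH => //; apply: obound_le bj Hb.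
Qed.

Lemma rank_order_type : exists a, has_order_type A lt a /\ ole a e.
Proof.
exists (Ord (fun p : {x | A x} => rank (sval p))).
have mono x y : A x -> A y -> lt x y <-> olt (rank x) (rank y).
  move=> Ax Ay; split=> [xy|H]; first by apply: rank_lt.
  have [//|xy|yx] := lt_total Ax Ay; first by rewrite xy in H; case: (olt_irr H).
  by case: (olt_irr (olt_trans H (rank_lt (And3 Ay Ax yx)))).
split; last first.
  apply/ole_olt => c [[x Ax] /= cx].
  have [b be bx] := bounded Ax.
  exact: ole_olt_trans cx (ole_olt_trans (rank_le Ax bx) be).
exists rank; split=> //.
- by move=> x Ax; apply: (olt_index (fun p : {x | A x} => rank (sval p)) (exist _ x Ax)).
(* Descend along [r] as long as some predecessor has rank at least [b]; where this stops, the rank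
   equals [b]. So the ranks leave no gaps. *)
- move=> b [[x Ax] /=]; elim/(well_founded_ind r_wf): x Ax => x IH Ax bx.
  have [[y yx by_]|H] := pselect (exists2 y, r y x & ole b (rank y)).
    by case: (yx) => Ay _ _; apply: (IH y).
  exists x => //; split=> //; rewrite rankE; apply/ole_olt => c [[y yx] /= cy].
  apply: ole_olt_trans cy _; have [by_|//] := ole_or_olt b (rank y).
  by case: H; exists y.
- move=> x y Ax Ay [xy yx]; have [|//|] := lt_total Ax Ay => /mono H.
    by case: (olt_irr (olt_ole_trans (H Ax Ay) yx)).
  by case: (olt_irr (olt_ole_trans (H Ay Ax) xy)).
Qed.

End Rank.

Section Main.
Variable R : realType.
Local Notation pfn := ({posnum R} -> {posnum R}).
Implicit Types f g : pfn.

Lemma evlt_ev f g t t' : (forall x, (f x)%:num = sev t x%:num) ->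
  (forall x, (g x)%:num = sev t' x%:num) ->
  (evlt f g <-> ev (fun x : R => sev t x < sev t' x)).
Proof.
move=> Ef Eg; split=> -[M H].
  exists (Num.max M 0) => x; rewrite gt_max => /andP[Mx x0].
  by have := H (PosNum x0) Mx; rewrite Ef Eg.
by exists M => x Mx; rewrite Ef Eg; apply: H.
Qed.

Lemma evlt_trans f g h : evlt f g -> evlt g h -> evlt f h.
Proof.
move=> [M H] [N K]; exists (Num.max M N) => x; rewrite gt_max => /andP[Mx Nx].
exact: lt_trans (H x Mx) (K x Nx).
Qed.

Lemma evlt_total f g : Sk f -> Sk g -> [\/ evlt f g, f = g | evlt g f].
Proof.
move=> /Sk_term[t Et] /Sk_term[t' Et'].
have [H|H|H] := sev_trichotomy R t t'.
- by apply: Or31; rewrite (evlt_ev Et Et').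
- by apply: Or32; apply/funext => x; apply: val_inj; rewrite /= Et Et' H.
- by apply: Or33; rewrite (evlt_ev Et' Et).
Qed.

Lemma two_pow_xxE (x : {posnum R}) : (two_pow_xx x)%:num = expR (xx x%:num * ln 2).
Proof. by rewrite /two_pow_xx /ppow /= !powRE. Qed.

Lemma below_two_xx_uev f : Sk f -> evlt f (@two_pow_xx R) ->
  exists u, forall x : {posnum R}, 2 <= x%:num -> (f x)%:num = uev u x%:num.
Proof.
move=> /Sk_term[t Et] [M H]; have [|u Eu] := @sev_below_two_xx R t.
  exists (Num.max M 0) => x; rewrite gt_max => /andP[Mx x0].
  by have := H (PosNum x0) Mx; rewrite two_pow_xxE Et.
by exists u => x x2; rewrite Et Eu.
Qed.

(** A larger weight wins because [((n + 1) / n) ^ x] outgrows the power [x ^ j] in the upper bound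
    for [t]; [mu] is the logarithm of that ratio. *)
Lemma below_uset f u (t : ut) : evlt f u -> forall v,
  (forall x : {posnum R}, 2 <= x%:num -> (u x)%:num = uev t x%:num) ->
  (forall x : {posnum R}, 2 <= x%:num -> (f x)%:num = uev v x%:num) ->
  (wt v <= (maxn 1 (wt t)).+1)%N.
Proof.
move=> [M H] v Eu Ev; rewrite leqNgt; apply/negP => wv.
have [j Hj] := uln_upper R t; pose n := maxn 1 (wt t).
have n1 : (0 < n)%N by rewrite leq_max.
pose mu : R := ln (n.+1%:R / n%:R).
have mu0 : 0 < mu by rewrite ln_gt0 // ltr_pdivlMr ?ltr0n // mul1r ltr_nat.
have Hp := poly_lt_exp (2 : R) j mu0.
have [x [Mx [x2 Hx]]] := ev_ex (ev_and (ev_gt M) (ev_and (ev_ge 2) Hp)).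
have x0 : 0 < x by apply: lt_le_trans x2.
have := H (PosNum x0) Mx; rewrite Eu // Ev //=; apply/negP; rewrite -leNgt.
rewrite -ler_ln ?posrE ?uev_gt0 //; apply: le_trans (Hj x x2) _.
apply: le_trans (uln_wt x2 _); last by apply: leq_trans wv.
apply: (@le_trans _ _ (2^-1 * kpow n.+1 x)); last first.
  apply: ler_pM => //; [exact: kpow_ge0|exact: ln2_ge_half|].
  by apply: kpow_le; [exact: ltW|done|exact: ltnW].
have -> : kpow n.+1 x = expR (mu * x) * kpow n x.
  rewrite /mu /kpow ln_div ?posrE ?ltr0n // -expRD; congr expR; ring.
rewrite mulrA ler_wpM2r ?kpow_ge0 //.
by rewrite ler_pdivlMl ?ltr0n.
Qed.

(** All functions below [f] have bounded weight, so a single bound from [wbound_uset] covers them.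
    The last exponential, from the exponent [e] to an order type, stays below [epsilon0]. *)
Lemma obound_below_two_xx f : Sk f -> evlt f (@two_pow_xx R) ->
  exists2 b, olt b epsilon0 & obound (fun g h => ~ evlt h g) b
    [set g | [set f | Sk f /\ evlt f (@two_pow_xx R)] g /\ evlt g f].
Proof.
move=> Sf f2; have [t Et] := below_two_xx_uev Sf f2.
have [e ee we] := @wbound_uset R (maxn 1 (wt t)).+1.
exists (wexp e); first exact: wexp_epsilon0.
apply: wbound_obound; apply: (@wbound_image _ _ leinf _
  (fun (x : R -> R) (z : pfn) =>
     forall p : {posnum R}, 2 <= p%:num -> (z p)%:num = x p%:num) e _ _ _ _ we).
  move=> g [[Sg g2] gf]; have [v Ev] := below_two_xx_uev Sg g2.
  by exists (uev v) => //; exists v => //=; apply: below_uset gf v Et Ev.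
move=> x x' z z' _ _ _ _ E E' [M H] [N K].
have [p [Mp [Np p2]]] := ev_ex (ev_and (ev_gt M) (ev_and (ev_gt N) (ev_ge 2))).
have p0 : 0 < p by apply: lt_le_trans p2.
have := K (PosNum p0) Np; rewrite E // E' //=; apply/negP; rewrite -leNgt.
exact: H.
Qed.

End Main.

Theorem mainTheorem3 (R : realType) :
  exists a : ord,
    has_order_type [set f | @Sk R f /\ evlt f (@two_pow_xx R)] (@evlt R) a
    /\ ole a epsilon0.
Proof.
apply: rank_order_type => [f g h|f g [Sf _] [Sg _]|f [Sf f2]].
- exact: evlt_trans.
- exact: evlt_total.
- exact: obound_below_two_xx.
Qed.
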